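(* Let $\lambda^1,\dots,\lambda^r$ be partitions with $|\lambda^{[r]}|=n$. Then for every nonnegative integer $s$, the coefficient of $(-u)^s$ in the plethystic substitution $\kappa(\lambda^1,\dots,\lambda^r)[1-u]$ equals \[ \sum_{\{\square_1,\dots,\square_s\}\subset\lambda^{[r]}}\mathcal{I}_{G^{\square_1,\dots,\square_s}_{\lambda^1,\dots,\lambda^r}}(q)\,t^{\sum_{i=1}^s\ell'_{\lambda^{[r]}}(\square_i)}, \] the sum over $s$-element subsets of boxes of $\lambda^{[r]}$. Equivalently, the multivariate $q,t$-Kostka number $\tilde K_{(n-s,1^s);\lambda^1,\dots,\lambda^r}(q,t)$ (for $0\le s\le n-1$) is a polynomial in $q,t$ with nonnegative integer coefficients given by \[ \tilde K_{(n-s,1^s);\lambda^1,\dots,\lambda^r}(q,t)=\sum_{\{\square_1,\dots,\square_s\}\subset\lambda^{[r]}\setminus\{(1,1)\}}\mathcal{I}_{G^{\square_1,\dots,\square_s}_{\lambda^1,\dots,\lambda^r}}(q)\,t^{\sum_{i=1}^s\ell'_{\lambda^{[r]}}(\square_i)}. \]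
   Context: Diagrams. A partition $\lambda$ is identified with its Young diagram $\{(i,j):1\le j\le\ell(\lambda),\ 1\le i\le\lambda_j\}$ (French convention: $i$ column, $j$ row, row 1 at the bottom); $\lambda^t$ is the conjugate. For $\square=(i,j)$: leg length $\ell_\lambda(\square)=\lambda^t_i-j$, coleg length $\ell'_\lambda(\square)=j-1$. $\mu\oplus\nu=(\mu_1+\nu_1,\mu_2+\nu_2,\dots)$ and $\lambda^B=\bigoplus_{b\in B}\lambda^b$ for $\emptyset\ne B\subseteq[r]$. For a filling $\sigma:\lambda\to\mathbb{Z}_{>0}$: $\mathrm{Des}(\sigma)$ is the set of boxes $(i,j+1)$ with $\sigma((i,j+1))>\sigma((i,j))$, $\mathrm{maj}(\sigma)=\sum_{\square\in\mathrm{Des}(\sigma)}(\ell_\lambda(\square)+1)$; an inversion pair is a pair $(\square_1,\square_2)$ in the same row with $\square_1$ strictly left of $\square_2$ such that, with $\square_3$ directly below $\square_1$, $\sigma(\square_1)\le\sigma(\square_3)<\sigma(\square_2)$ or $\sigma(\square_3)<\sigma(\square_2)<\sigma(\square_1)$ or $\sigma(\square_2)<\sigma(\square_1)\le\sigma(\square_3)$ (in row 1, $\sigma(\square_3)$ is smaller than all entries); $\mathrm{inv}(\sigma)$ is their number. Modified Macdonald polynomials: $\tilde H_\lambda(\mathbf{x};q,t)=\sum_{\sigma:\lambda\to\mathbb{Z}_{>0}}q^{\mathrm{inv}(\sigma)}t^{\mathrm{maj}(\sigma)}\prod_{\square}x_{\sigma(\square)}$. Macdonald cumulant: $\kappa(\lambda^1,\dots,\lambda^r)=(q-1)^{1-r}\sum_{\pi}(-1)^{\#\pi-1}(\#\pi-1)!\prod_{B\in\pi}\tilde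 H_{\lambda^B}$, sum over set partitions $\pi$ of $[r]$. The multivariate $q,t$-Kostka numbers are defined by $\kappa(\lambda^1,\dots,\lambda^r)=\sum_\mu\tilde K_{\mu;\lambda^1,\dots,\lambda^r}(q,t)\,s_\mu$ (Schur expansion). Plethysm: for a symmetric function $f=\sum_\lambda c_\lambda p_\lambda$ (power sums), $f[1-u]=\sum_\lambda c_\lambda\prod_i(1-u^{\lambda_i})$, i.e. $p_k[1-u]=1-u^k$. Coloring: $\lambda^{[r]}$ is formed by sorting all columns of $\lambda^1,\dots,\lambda^r$ in weakly decreasing length, columns of equal length from $\lambda^b$ placed before those of $\lambda^{b'}$ when $b<b'$; a box of $\lambda^{[r]}$ has color $b$ if its column comes from $\lambda^b$. Graph $G^{\square_1,\dots,\square_s}_{\lambda^1,\dots,\lambda^r}$ for boxes $\square_1,\dots,\square_s$ of $\lambda^{[r]}$: vertex set $[r]$; the number of edges between $i$ and $j$ (not necessarily distinct) is the number of pairs $(\square_k,\square')$, $1\le k\le s$, with $\square'$ in the same row as $\square_k$ strictly to its left and with color set $\{\mathrm{color}(\square_k),\mathrm{color}(\square')\}=\{i,j\}$. $G$-inversion polynomial: for a multigraph $G$ (loops allowed) on $[r]$, with $e_{i,j}(G)$ edge multiplicities, $\tilde G$ the underlying simple graph without loops, trees rooted at $1$: a $\kappa$-inversion of a spanning tree $T$ of $\tilde G$ is a pair $(i,j)$ of non-root vertices with $i$ an ancestor of $j$, $i>j$, $e_{\mathrm{parent}(i),j}(G)>0$; $\kappa(T)=\sum_{\kappa\text{-inversions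 }(i,j)}e_{\mathrm{parent}(i),j}(G)$; $\mathcal{I}_G(q)=q^{\#\text{loops}}\sum_T q^{\kappa(T)}\prod_{\{i,j\}\in E(T)}[e_{i,j}(G)]_q$ over spanning trees $T$ of $\tilde G$, $[n]_q=1+\dots+q^{n-1}$ ($0$ if $G$ is disconnected). *)

(* Defs.v *)
From HB Require Import structures.
From mathcomp Require Import all_boot all_order all_algebra.
From mathcomp Require Import finmap.
From mathcomp Require Import mpoly.
From Stdlib Require Import ClassicalEpsilon.

Set Implicit Arguments.
Unset Strict Implicit.
Unset Printing Implicit Defensive.

Import GRing.Theory.

Local Open Scope ring_scope.

(* The field Q(q,t). *)
Definition Qqt : fieldType := {fraction {mpoly rat[2]}}.
Definition q : Qqt := tofrac ('X_ord0 : {mpoly rat[2]}).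
Definition t : Qqt := tofrac ('X_ord_max : {mpoly rat[2]}).

(** Partitions and diagrams *)

(* A partition is the sequence of its (positive) parts, in weakly decreasing
   order. *)
Definition is_part (la : seq nat) : bool := sorted geq la && (0%N \notin la).

Definition conj_part (la : seq nat) : seq nat :=
  [seq count (fun p => (i < p)%N) la | i <- iota 0 (head 0%N la)].

(* French convention, with indices starting at 0: the pair (i, j) stands for
   the box in column i+1 and row j+1; in particular (0, 0) is the corner box
   written (1,1) with indices starting at 1. *)
Definition boxes (la : seq nat) : seq (nat * nat) :=
  [seq (i, j) | j <- iota 0 (size la), i <- iota 0 (nth 0%N la j)].

Definition box (la : seq nat) : finType := seq_sub (boxes la).

Definition bcol la (u : box la) : nat := (ssval u).1.
Definition brow la (u : box la) : nat := (ssval u).2.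

Definition leg la (u : box la) : nat :=
  (nth 0%N (conj_part la) (bcol u) - (brow u).+1)%N.

Definition coleg la (u : box la) : nat := brow u.

Definition left_of la (u v : box la) : bool :=
  (brow u == brow v) && (bcol u < bcol v)%N.

Definition below la (u v : box la) : bool :=
  (bcol u == bcol v) && (brow u < brow v)%N.

(** Fillings *)

(* Fillings with values in {1, ..., N}: the element k of 'I_N stands for the
   positive integer k+1, and for the variable x_{k+1}. *)
Definition filling (la : seq nat) (N : nat) : finType := {ffun box la -> 'I_N}.

(* The value, in {1, ..., N}, at a position of the plane; 0 off the diagram. *)
Definition entry la N (sg : filling la N) (p : nat * nat) : nat :=
  if (insub p : option (box la)) is Some u then (sg u).+1 else 0%N.

(* The value directly below u; it is 0, hence smaller than all the entries,
   when u is in the bottom row. *)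
Definition entry_below la N (sg : filling la N) (u : box la) : nat :=
  if brow u is j.+1 then entry sg (bcol u, j) else 0%N.

Definition Des la N (sg : filling la N) : {set box la} :=
  [set u | (0 < brow u)%N && (entry_below sg u < entry sg (ssval u))%N].

Definition maj la N (sg : filling la N) : nat :=
  (\sum_(u in Des sg) (leg u).+1)%N.

Definition inversion_pair la N (sg : filling la N) (u v : box la) : bool :=
  let a := entry sg (ssval u) in
  let b := entry sg (ssval v) in
  let c := entry_below sg u in
  left_of u v &&
  [|| (a <= c < b)%N, (c < b < a)%N | (b < a <= c)%N].

Definition inv la N (sg : filling la N) : nat :=
  #|[set uv : box la * box la | inversion_pair sg uv.1 uv.2]|.

(** Symmetric functions *)

(* A symmetric function over Q(q,t) is represented by the family of its images
   f(x_1, ..., x_N, 0, 0, ...) in N variables, for all N (the ring of symmetric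
   functions is the graded inverse limit of these rings of polynomials). *)
Definition symfun : Type := forall N : nat, {mpoly Qqt[N]}.

Definition monomial la N (sg : filling la N) : {mpoly Qqt[N]} :=
  \prod_(u : box la) 'X_(sg u).

Definition macdonaldH (la : seq nat) : symfun := fun N =>
  \sum_(sg : filling la N) (q ^+ inv sg * t ^+ maj sg) *: monomial sg.

Definition powersum (la : seq nat) : symfun := fun N =>
  \prod_(k <- la) \sum_(i < N) 'X_i ^+ k.

Definition semistandard la N (sg : filling la N) : bool :=
  [forall u : box la, forall v : box la,
     (left_of u v ==> (sg u <= sg v)%N) && (below u v ==> (sg u < sg v)%N)].

Definition schur (la : seq nat) : symfun := fun N =>
  \sum_(sg : filling la N | semistandard sg) monomial sg.

(* f = \sum_la c_la b_la, a finite sum over partitions. *)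
Definition expands (b : seq nat -> symfun) (f : symfun)
    (c : {fsfun seq nat -> Qqt with 0}) : Prop :=
  (forall la, la \in finsupp c -> is_part la) /\
  (forall N, f N = \sum_(la <- finsupp c) c la *: b la N).

(* The coefficients of f in the basis b; meaningful when f has an expansion. *)
Definition coefs (b : seq nat -> symfun) (f : symfun) :
    {fsfun seq nat -> Qqt with 0} :=
  epsilon (inhabits [fsfun]) (expands b f).

(* f[1-u], as a polynomial in u. *)
Definition pleth_1_minus_u (f : symfun) : {poly Qqt} :=
  \sum_(la <- finsupp (coefs powersum f))
     coefs powersum f la *: \prod_(k <- la) (1 - 'X^k).

(** Macdonald cumulants. The r partitions are indexed by 'I_r, with r written
    as r'+1 since r >= 1; color 1 is ord0. *)

Definition part_sum (r : nat) (lam : 'I_r -> seq nat) (B : {set 'I_r}) : seq nat :=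
  [seq (\sum_(b in B) nth 0 (lam b) j)%N
     | j <- iota 0 (\max_(b in B) size (lam b))].

Definition cumulant (r : nat) (lam : 'I_r.+1 -> seq nat) : symfun := fun N =>
  (q - 1) ^- r *:
  \sum_(P : {set {set 'I_r.+1}} | partition P [set: 'I_r.+1])
     ((-1) ^+ #|P|.-1 * (#|P|.-1)`!%:R) *:
     \prod_(B in P) macdonaldH (part_sum lam B) N.

Definition qtKostka (mu : seq nat) (r : nat) (lam : 'I_r.+1 -> seq nat) : Qqt :=
  coefs schur (cumulant lam) mu.

(** Coloring *)

(* The columns of all the diagrams, as pairs (color, length). *)
Definition colored_columns (r : nat) (lam : 'I_r -> seq nat) :
    seq ('I_r * nat) :=
  sort (fun x y : 'I_r * nat => (y.2 < x.2)%N || ((x.2 == y.2) && (x.1 <= y.1)%N))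
       [seq (b, h) | b <- enum 'I_r, h <- conj_part (lam b)].

Definition lam_all (r : nat) (lam : 'I_r -> seq nat) : seq nat :=
  part_sum lam [set: 'I_r].

Definition color (r : nat) (lam : 'I_r.+1 -> seq nat) (u : box (lam_all lam)) :
    'I_r.+1 :=
  (nth (ord0, 0%N) (colored_columns lam) (bcol u)).1.

(** Multigraphs and inversion polynomials *)

(* A multigraph, given by its (symmetric) edge multiplicities; e i i is the
   number of loops at i. *)
Definition multigraph (r : nat) : Type := 'I_r -> 'I_r -> nat.

Definition box_graph (r : nat) (lam : 'I_r.+1 -> seq nat)
    (S : {set box (lam_all lam)}) : multigraph r.+1 := fun i j =>
  #|[set uv : box (lam_all lam) * box (lam_all lam) |
      [&& uv.1 \in S, left_of uv.2 uv.1 &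
          [set color uv.1; color uv.2] == [set i; j]]]|.

Section Trees.
Variable r : nat.
Notation V := 'I_r.+1.
Implicit Type T : {set {set V}}.

Definition simple_edges (e : multigraph r.+1) : {set {set V}} :=
  [set [set ij.1; ij.2] | ij : V * V & (ij.1 != ij.2) && (0 < e ij.1 ij.2)%N].

Definition adj T : rel V := [rel x y | (x != y) && ([set x; y] \in T)].

(* Connected, and every simple closed walk has length at most 2. *)
Definition is_tree T : bool :=
  [forall x, forall y, connect (adj T) x y] &&
  [forall c : r.+1.-bseq V, ucycleb (adj T) c ==> (size c <= 2)%N].

Definition spanning_tree (e : multigraph r.+1) T : bool :=
  (T \subset simple_edges e) && is_tree T.

(* The vertices following the root on the simple path from the root to v. *)
Definition root_path T (v : V) : seq V :=
  if [pick p : r.+1.-bseq V |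
        [&& path (adj T) ord0 p, last ord0 p == v & uniq (ord0 :: p)]]
  is Some p then p else [::].

Definition ancestor T (i j : V) : bool :=
  i \in belast ord0 (root_path T j).

(* The root is sent to itself. *)
Definition parent T (i : V) : V :=
  odflt ord0 [pick k | adj T k i && ancestor T k i].

Definition kappa_inversion (e : multigraph r.+1) T (i j : V) : bool :=
  [&& i != ord0, j != ord0, ancestor T i j, (j < i)%N & (0 < e (parent T i) j)%N].

Definition tree_kappa (e : multigraph r.+1) T : nat :=
  (\sum_(ij : V * V | kappa_inversion e T ij.1 ij.2) e (parent T ij.1) ij.2)%N.

Definition qnum (n : nat) : Qqt := \sum_(k < n) q ^+ k.

Definition inversion_poly (e : multigraph r.+1) : Qqt :=
  q ^+ (\sum_(i : V) e i i)%N *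
  \sum_(T : {set {set V}} | spanning_tree e T)
     q ^+ tree_kappa e T *
     \prod_(ij : V * V | (ij.1 < ij.2)%N && ([set ij.1; ij.2] \in T))
        qnum (e ij.1 ij.2).

End Trees.

Definition nonneg_int_poly (x : Qqt) : Prop :=
  exists (d : nat) (c : nat -> nat -> nat),
    x = \sum_(i < d) \sum_(j < d) (c i j)%:R * q ^+ i * t ^+ j.

(* Main.v *)
(** For a symmetric function f, the value f(1, u, ..., u) with N variables equal
    to u is a polynomial Q(N), because p_k(1, u, ..., u) = 1 + N u^k, and
    f[1 - u] = Q(-1). If f is a sum over fillings whose weight depends only on the
    inversions of the reading word, then Q(-1) is computed by removing the boxes
    with the largest letter; it is the signed sum over the sets B of boxes of the
    weight of a filling that is 1 off B and strictly decreasing along B in reading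
    order. For Macdonald polynomials this gives
    H_la[1-u] = prod (1 - u q^(column) t^(row)), and for Schur functions it gives 0
    except for hooks, where it is (-u)^s (1 - u).

    The expansions of the cumulant into power sums and Schur functions exist
    because Macdonald polynomials are symmetric: they are combinations of
    unicellular LLT polynomials, whose symmetry in two variables follows from
    removing the longest edge of the interval graph.

    Expanding the products over the boxes of la^[r] reduces the theorem to the
    identity sum_pi (-1)^(k-1) (k-1)! prod_(B in pi) q^(edges of G in B) =
    (q-1)^(r-1) I_G(q). Both sides satisfy the same recursion, in which the branch
    at the root containing a fixed vertex is split off. *)

From HB Require Import structures.
From mathcomp Require Import all_boot all_order all_algebra all_fingroup.
From mathcomp Require Import finmap mpoly zify ring.
From Stdlib Require Import ClassicalEpsilon FunctionalExtensionality.
Require Import Defs.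

Set Implicit Arguments.
Unset Strict Implicit.
Unset Printing Implicit Defensive.

Import GRing.Theory.
Local Open Scope ring_scope.

(** * Two-letter sums over interval graphs *)

(** Coefficients in a basis are picked by choice, so nothing is known about them before an expansion
    is shown to exist. This forces the families to be treated as elements of the inverse limit:
    symmetric, homogeneous, and compatible with setting the last variable to 0; existence then
    follows from triangularity of the monomial coefficients. In characteristic 0 the polynomial Q is
    unique, so its value at -1 may be computed from fillings although the plethysm is defined by
    power sums. Weights depending only on the inversion set of the reading word put Macdonald and
    Schur polynomials under one symmetry criterion and one interpolation theorem. The two-letter
    identity behind LLT symmetry also yields the Schur case: semistandardness of the unforced boxes
    is its specialization at q = 0, where no edge may be cut. On the cumulant side the recursion is
    not derived from set partitions directly: its right-hand side is shown to satisfy the relation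
    between moments and cumulants, which determines them. Trees are handled as parent functions, for
    which cutting off or attaching a branch is a simple redefinition. *)

Lemma leq_subl m n p : (n < p)%N -> (p - n <= p - m)%N -> (m <= n)%N.
Proof. lia. Qed.

Section TwoLetters.
Variables (R : comNzRingType) (qq : R) (T : finType) (pos : T -> nat).
Implicit Types (A Z : {set T}) (E : {set T * T}).

(** Edge sets of interval graphs: every subinterval of an edge is an edge. Closure is asked only for
    pairs inside [Z], so that it survives the deletion of vertices. *)
Definition interval_closed Z E : Prop :=
  [/\ E \subset setX Z Z, forall e, e \in E -> (pos e.1 < pos e.2)%N &
   forall e e' : T * T, e \in E -> e' \in setX Z Z -> (pos e.1 <= pos e'.1)%N ->
     (pos e'.1 < pos e'.2)%N -> (pos e'.2 <= pos e.2)%N -> e' \in E].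

Definition cut E A : nat := #|[set e in E | (e.1 \in A) && (e.2 \notin A)]|.

(** For an interval graph this is the unicellular LLT polynomial in two variables: [A] is the set of
    vertices carrying the larger letter, and an edge counts when its left end is larger than its
    right end. *)
Definition cut_poly E Z (x y : R) : R :=
  \sum_(A : {set T} | A \subset Z) qq ^+ cut E A * (x ^+ #|Z :\: A| * y ^+ #|A|).

Lemma cut_poly_set0 Z x y : cut_poly set0 Z x y = cut_poly set0 Z y x.
Proof.
have cut0 A : cut set0 A = 0%N by rewrite /cut; apply: eq_card0 => e; rewrite !inE.
rewrite /cut_poly [RHS](reindex_onto (fun A => Z :\: A) (fun A => Z :\: A)) /=; last first.
  by move=> A sAZ; rewrite setDDr setDv set0U; apply/setIidPr.
apply: eq_big => A.
  rewrite subsetDl setDDr setDv set0U /=.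
  by apply/idP/eqP => [/setIidPr//|<-]; rewrite subsetIl.
by move=> sAZ; rewrite !cut0 setDDr setDv set0U (setIidPr sAZ) [x ^+ _ * _]mulrC.
Qed.

Hypothesis pos_inj : injective pos.

(* When p is raised and b is not, a vertex strictly between them is joined to
   both and contributes one cut edge whether it is raised or not; by maximality
   of (p, b) the other vertices contribute nothing. *)
Lemma cut_poly_edge E Z p b x y : interval_closed Z E -> (p, b) \in E ->
    (forall e, e \in E -> (pos e.2 - pos e.1 <= pos b - pos p)%N) ->
  let Z' := Z :\ p :\ b in let E' := E :&: setX Z' Z' in
  let K := #|[set r in Z | (pos p < pos r < pos b)%N]| in
  cut_poly E Z x y =
    cut_poly (E :\ (p, b)) Z x y + (qq - 1) * qq ^+ K * (x * y) * cut_poly E' Z' x y.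
Proof.
move=> [sEZ ltE clE] pbE maxE Z' E' K.
have /setXP[pZ bZ] := subsetP sEZ _ pbE.
have ltpb : (pos p < pos b)%N := ltE _ pbE.
have npb : p != b by apply: contraTneq ltpb => ->; rewrite ltnn.
have cutE A : cut E A = (((p \in A) && (b \notin A)) + cut (E :\ (p, b)) A)%N.
  rewrite /cut (cardsD1 (p, b)) !inE pbE /=; congr (_ + _)%N.
  by apply: eq_card => e; rewrite !inE -!andbA.
pose F A := qq ^+ cut (E :\ (p, b)) A * (x ^+ #|Z :\: A| * y ^+ #|A|).
pose c A := (p \in A) && (b \notin A).
have -> : cut_poly E Z x y = cut_poly (E :\ (p, b)) Z x y +
            (qq - 1) * \sum_(A : {set T} | (A \subset Z) && c A) F A.
  rewrite /cut_poly [X in _ = X + _](bigID c) [LHS](bigID c) /=.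
  rewrite [X in X + _ = _](eq_bigr (fun A => qq * F A)); last first.
    by move=> A /andP[_ cA]; rewrite cutE -/(c A) cA exprS -mulrA.
  rewrite [X in _ + X = _](eq_bigr F); last first.
    by move=> A /andP[_ cA]; rewrite cutE -/(c A) (negbTE cA).
  by rewrite -mulr_sumr -/F; ring.
congr (_ + _); rewrite -!mulrA; congr (_ * _).
have cutp A : A \subset Z' -> cut (E :\ (p, b)) (p |: A) = (K + cut E' A)%N.
  move=> sA.
  have pA : p \notin A by apply: contraTN isT => /(subsetP sA); rewrite !inE eqxx andbF.
  have bA : b \notin A by apply: contraTN isT => /(subsetP sA); rewrite !inE eqxx.
  have AZ r : r \in A -> r \in Z by move/(subsetP sA); rewrite !inE => /and3P[].
  (* Cut edges are sorted into those starting at [p], those ending at [b], and those meeting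
     neither. The first two kinds together have one edge for each vertex strictly between [p] and
     [b]: from [p] if the vertex is not in [A], to [b] if it is. *)
  pose S := [set e in E :\ (p, b) | (e.1 \in p |: A) && (e.2 \notin p |: A)].
  pose S1 := [set e in S | e.1 == p].
  pose S2 := [set e in S | (e.1 != p) && (e.2 == b)].
  pose S3 := [set e in S | (e.1 != p) && (e.2 != b)].
  have -> : cut (E :\ (p, b)) (p |: A) = (#|S1| + #|S2| + #|S3|)%N.
    rewrite /cut -/S -(cardsID [set e | e.1 == p] S).
    rewrite -(cardsID [set e | e.2 == b] (S :\: _)) addnA.
    congr (_ + _ + _)%N; apply: eq_card => e; rewrite !inE; 
    by case: (e.1 == p); case: (e.2 == b); rewrite ?andbT ?andbF ?andTb.
  congr (_ + _)%N; last first.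
    apply: eq_card => e; rewrite !inE; case: e => s r /=.
    case: (eqVneq s p) => [->|nsp]; rewrite ?andbF ?(negbTE pA) ?andbF //=.
    case: (eqVneq r b) => [->|nrb]; rewrite ?andbF //= ?xpair_eqE (negbTE nsp) /= andbT.
    case: (boolP ((s, r) \in E)) => //= /(subsetP sEZ)/setXP[sZ rZ].
    rewrite sZ rZ ?andbT negb_or; case: (boolP (s \in A)) => sA2 /=; last by rewrite ?andbF.
    have nsb : s != b by apply: contraNneq bA => <-.
    by rewrite nsb.
  rewrite /K -(cardsID A [set r in Z | _]) addnC; congr (_ + _)%N.
    have <- : [set e.1 | e in S2] = [set r in Z | (pos p < pos r < pos b)%N] :&: A.
      apply/setP => r; apply/imsetP/idP => [[[s r'] sS2 ->]|].
        move: sS2; rewrite !inE /= => /andP[/and3P[/andP[ne sE]]].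
        case: (eqVneq s p) => //= nsp sA' _ /eqP er; move: ne sE; rewrite {r'}er => ne sE.
        have /setXP[sZ _] := subsetP sEZ _ sE.
        have := ltE _ sE; have := maxE _ sE; rewrite /= sA' sZ => le1 lt1 /=.
        by rewrite lt1 andbT /= ltn_neqAle (inj_eq pos_inj) eq_sym nsp /= (leq_subl lt1 le1).
      rewrite !inE => /andP[/andP[rZ /andP[ltpr ltrb]] rA]; exists (r, b) => //.
      have nrp : r != p by apply: contraNneq pA => <-.
      rewrite !inE eqxx /= rA orbT negb_or bA (eq_sym b) npb /= xpair_eqE eqxx nrp !andbT /=.
      by rewrite nrp; apply: (clE (p, b)) => //=; rewrite ?inE /= ?bZ ?rZ // ltnW.
    rewrite card_in_imset // => -[s1 r1] [s2 r2]; rewrite !inE /=.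
    by move=> /and3P[_ _ /eqP->] /and3P[_ _ /eqP->] ->.
  have <- : [set e.2 | e in S1] = [set r in Z | (pos p < pos r < pos b)%N] :\: A.
    apply/setP => r; apply/imsetP/idP => [[[s r'] sS1 ->]|].
      move: sS1; rewrite !inE /= => /andP[/and3P[/andP[ne sE] _]].
      rewrite negb_or => /andP[nr rA] /eqP es; move: ne sE;
        rewrite {s}es xpair_eqE eqxx /= => ne sE.
      have /setXP[_ rZ] := subsetP sEZ _ sE.
      have := ltE _ sE; have := maxE _ sE; rewrite /= rA rZ => le1 lt1 /=.
      by rewrite lt1 /= ltn_neqAle (inj_eq pos_inj) ne /= -(leq_sub2rE _ (ltnW ltpb)).
    rewrite !inE => /and3P[rA rZ /andP[ltpr ltrb]]; exists (p, r) => //.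
    rewrite !inE eqxx /= andbT negb_or rA xpair_eqE eqxx /=.
    rewrite (clE (p, b)) ?inE //= ?pZ ?rZ ?(ltnW ltrb) // !andbT /=.
    by apply/andP; split; [apply: contraTneq ltrb|apply: contraTneq ltpr] => ->; rewrite ltnn.
  rewrite card_in_imset // => -[s1 r1] [s2 r2]; rewrite !inE /=.
  by move=> /andP[_ /eqP->] /andP[_ /eqP->] ->.
rewrite (reindex_onto (fun A => p |: A) (fun A => A :\ p)) /=; last first.
  by move=> A /and3P[_ pA _]; rewrite setD1K.
have eqc A : ((p |: A \subset Z) && c (p |: A)) && ((p |: A) :\ p == A) = (A \subset Z').
  rewrite /c !inE eqxx /= negb_or eq_sym npb /= subUset sub1set pZ /=.
  apply/idP/idP => [/andP[/andP[sAZ bA] /eqP<-]|sAZ].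
    apply/subsetP => r; rewrite !inE => /andP[nrp].
    case: (eqVneq r p) nrp => //= nrp _ rA; rewrite (subsetP sAZ) // andbT.
    by apply: contraNneq bA => <-.
  have pA : p \notin A by apply: contraTN isT => /(subsetP sAZ); rewrite !inE eqxx andbF.
  have bA : b \notin A by apply: contraTN isT => /(subsetP sAZ); rewrite !inE eqxx.
  rewrite bA andbT setU1K // eqxx andbT; apply/subsetP => r /(subsetP sAZ).
  by rewrite !inE => /and3P[].
rewrite /cut_poly !mulr_sumr; apply: eq_big => A; first exact: eqc.
rewrite eqc => sA; rewrite /F cutp // exprD.
have pA : p \notin A by apply: contraTN isT => /(subsetP sA); rewrite !inE eqxx andbF.
have bA : b \notin A by apply: contraTN isT => /(subsetP sA); rewrite !inE eqxx.
have -> : #|Z :\: (p |: A)| = #|Z' :\: A|.+1.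
  rewrite (cardsD1 b) !inE negb_or eq_sym npb bA bZ add1n; congr _.+1.
  by apply: eq_card => s; rewrite !inE negb_or -!andbA; do !bool_congr.
by rewrite cardsU1 pA add1n !exprS; ring.
Qed.

(** Induction on the number of edges. Removing an edge of maximal length leaves a closed set because
    no other edge contains it, and restricting to fewer vertices leaves one because closure is
    relative to the vertex set. The correction term carries the symmetric factor [x * y]. *)
Lemma cut_poly_sym E Z x y : interval_closed Z E -> cut_poly E Z x y = cut_poly E Z y x.
Proof.
have [n] := ubnP #|E|; elim: n E Z => // n IHn E Z ltEn clE.
have [->|/set0Pn[e0 e0E]] := eqVneq E set0; first exact: cut_poly_set0.
pose len (e : T * T) := (pos e.2 - pos e.1)%N.
case: (arg_maxnP len e0E) => -[p b] pbE0 maxE; have pbE : (p, b) \in E := pbE0.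
have := cut_poly_edge _ _ clE pbE maxE => /= cutE.
have [sEZ ltE cE] := clE.
have ltE1 : (#|E :\ (p, b)| < n)%N by move: ltEn; rewrite (cardsD1 (p, b) E) pbE add1n ltnS.
rewrite !cutE [y * x]mulrC; congr (_ + _ * _); apply: IHn.
- exact: ltE1.
- split; first exact: subset_trans (subsetDl _ _) sEZ.
    by move=> e /setD1P[_ /ltE].
  move=> e e' /setD1P[ne eE] e'Z le1 lt1 le2; rewrite !inE (cE e) // andbT.
  apply: contra ne => /eqP ee; rewrite ee /= in le1 lt1 le2.
  have := maxE _ eE; have := ltE _ eE; rewrite /len /= => lt2 le3.
  by apply/eqP; case: e {eE ee} le1 lt1 le2 le3 lt2 => s r /= *; congr pair; apply: pos_inj; lia.
- apply: leq_ltn_trans ltE1; apply/subset_leq_card/subsetP => e.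
  rewrite inE => /andP[eE]; rewrite !inE eE andbT => /andP[/and3P[_ np _] _].
  by apply: contraNneq np => ->.
split; first by rewrite subsetIr.
  by move=> e /setIP[/ltE].
move=> e e' /setIP[eE eZ] e'Z le1 lt1 le2; rewrite inE e'Z andbT (cE e) //.
by move: e'Z; rewrite !inE => /andP[/and3P[_ _ ->] /and3P[_ _ ->]].
Qed.

End TwoLetters.

(** * Symmetry of sums over words *)

Section SymmetricAdjacent.
Variables (K : comNzRingType) (N : nat).

Lemma msymXU (s : 'S_N) i : msym s ('X_i : {mpoly K[N]}) = 'X_(s i).
Proof. by rewrite /msym mmapX mmap1U. Qed.

(** Conjugating by an adjacent transposition shortens the span of a transposition, and
    transpositions generate the symmetric group. *)
Lemma sym_adjacent (p : {mpoly K[N]}) :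
  (forall i j : 'I_N, j = i.+1 :> nat -> msym (tperm i j) p = p) -> p \is symmetric.
Proof.
move=> adj; have symM (s1 s2 : 'S_N) : msym s1 p = p -> msym s2 p = p -> msym (s1 * s2)%g p = p.
  by move=> s1p s2p; rewrite msymMm s1p s2p.
have lt_tperm d (i j : 'I_N) : j = (i + d.+1)%N :> nat -> msym (tperm i j) p = p.
  elim: d i j => [|d IHd] i j eij; first by apply: adj; rewrite eij addn1.
  have ltkN : (i + d.+1 < N)%N by apply: leq_ltn_trans (ltn_ord j); rewrite eij; lia.
  pose k := Ordinal ltkN.
  have ejk : j = k.+1 :> nat by rewrite eij /= addnS.
  have nik : i != k by rewrite -val_eqE /=; lia.
  have nij : i != j by rewrite -val_eqE /=; lia.
  have -> : tperm i j = (tperm k j * tperm i k * tperm k j)%g.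
    have <- : (tperm i k ^ tperm k j = tperm i j)%g.
      by rewrite tpermJ tpermL tpermD // eq_sym.
    by rewrite /conjg tpermV mulgA.
  by apply/symM; [apply/symM; [apply: adj|apply: IHd]|apply: adj].
apply/issymP => s; have [ts -> /allP dts] := prod_tpermP s.
elim: ts dts => [|[i j] ts IHts] dts; first by rewrite big_nil msym1m.
rewrite big_cons; apply: symM; last by apply: IHts => u uts; apply: dts; rewrite inE uts orbT.
have /= nij := dts (i, j) (mem_head _ _).
case: (ltngtP i j) => [lt|lt|/val_inj eij]; last by rewrite eij eqxx in nij.
  by apply: (lt_tperm (j - i).-1); lia.
by rewrite tpermC; apply: (lt_tperm (i - j).-1); lia.
Qed.
End SymmetricAdjacent.

Section WordSums.
Variables (K : comNzRingType) (T : finType) (pos : T -> nat).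

Definition invs N (s : {ffun T -> 'I_N}) : {set T * T} :=
  [set e | (pos e.1 < pos e.2)%N && (s e.2 < s e.1)%N].

(* Macdonald and Schur polynomials are both sums over fillings whose weight
   depends only on the inversions of the reading word. *)
Definition word_sum (W : {set T * T} -> K) N : {mpoly K[N]} :=
  \sum_(s : {ffun T -> 'I_N}) W (invs s) *: \prod_u 'X_(s u).

(* s0 uses i but not j = i + 1; the boxes of A carry j instead of i. *)
Definition raise N (s0 : {ffun T -> 'I_N}) (j : 'I_N) (A : {set T}) : {ffun T -> 'I_N} :=
  [ffun u => if u \in A then j else s0 u].

(** Fillings are grouped by the filling [s0] obtained from them by lowering every [j] to [i]. Within
    a group only the distribution of [i] and [j] over [Z] varies, and the remaining variables form a
    common factor fixed by the exchange of [i] and [j]. *)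
Lemma word_sum_sym W N :
    (forall (i j : 'I_N) (s0 : {ffun T -> 'I_N}) (x y : {mpoly K[N]}),
       j = i.+1 :> nat -> (forall u, s0 u != j) ->
       let Z := [set u | s0 u == i] in
       let F (x y : {mpoly K[N]}) : {mpoly K[N]} := \sum_(A : {set T} | A \subset Z)
          W (invs (raise s0 j A)) *: (x ^+ #|Z :\: A| * y ^+ #|A|) in F x y = F y x) ->
  word_sum W N \is symmetric.
Proof.
move=> symW; apply: sym_adjacent => i j eji.
have nij : i != j by rewrite -val_eqE /= eji; lia.
pose base (s : {ffun T -> 'I_N}) := [ffun u => if s u == j then i else s u].
pose noj (s : {ffun T -> 'I_N}) := [forall u, s u != j].
have nojb s : noj (base s).
  by apply/forallP => u; rewrite ffunE; case: ifP => // /negbT.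
pose Z (s0 : {ffun T -> 'I_N}) := [set u | s0 u == i].
pose F s0 (x y : {mpoly K[N]}) := \sum_(A : {set T} | A \subset Z s0)
  W (invs (raise s0 j A)) *: (x ^+ #|Z s0 :\: A| * y ^+ #|A|).
have -> : word_sum W N = \sum_(s0 : {ffun T -> 'I_N} | noj s0)
            (\prod_(u | u \notin Z s0) 'X_(s0 u)) * F s0 'X_i 'X_j.
  rewrite /word_sum (partition_big base noj) //; apply: eq_bigr => s0 /forallP noj0.
  rewrite (reindex_onto (raise s0 j) (fun s => [set u | s u == j])) /=; last first.
    move=> s /eqP <-; apply/ffunP => u; rewrite !ffunE inE.
    by case: (eqVneq (s u) j) => [->|].
  rewrite /F mulr_sumr; apply: eq_big => A.
    apply/andP/idP => [[/eqP <- _]|/subsetP sAZ].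
      apply/subsetP => u uA; rewrite inE !ffunE uA eqxx //.
    split; last first.
      by apply/eqP/setP => u; rewrite inE ffunE; case: ifP; rewrite ?eqxx // (negbTE (noj0 u)).
    apply/eqP/ffunP => u; rewrite !ffunE; case: (boolP (u \in A)) => uA.
      by have := sAZ _ uA; rewrite inE eqxx => /eqP.
    by rewrite (negbTE (noj0 u)).
  move=> /andP[/eqP eb _].
  have sAZ : A \subset Z s0.
    by apply/subsetP => u uA; rewrite inE -eb !ffunE uA eqxx.
  rewrite -scalerAr; congr (_ *: _).
  rewrite (bigID (mem (Z s0))) /= mulrC; congr (_ * _).
    apply: eq_bigr => u uZ; rewrite ffunE ifN //.
    by apply: contra uZ => /(subsetP sAZ).
  rewrite (bigID (mem A)) /= mulrC; congr (_ * _).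
    rewrite -prodr_const; apply: eq_big => u; first by rewrite !inE andbC.
    by rewrite ffunE inE => /andP[/eqP-> /negbTE->].
  rewrite -prodr_const; apply: eq_big => u; last by rewrite ffunE => /andP[_ ->].
  by case: (boolP (u \in A)) => [/(subsetP sAZ)->|]; rewrite ?andbF.
rewrite linear_sum /=; apply: eq_bigr => s0 /forallP noj0.
rewrite msymM; congr (_ * _).
  rewrite rmorph_prod /=; apply: eq_bigr => u; rewrite inE => ni.
  by rewrite msymXU tpermD // eq_sym.
rewrite /F linear_sum /= -[RHS](symW i j s0) //=; apply: eq_bigr => A _.
by rewrite msymZ msymM !rmorphXn /= !msymXU tpermL tpermR.
Qed.
End WordSums.

(** * Unicellular LLT polynomials *)

Section LLT.
Variables (K : comNzRingType) (T : finType) (pos : T -> nat).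
Hypothesis pos_inj : injective pos.

(** No letter lies strictly between [i] and [j], and [s0] avoids [j], so raising affects only
    comparisons between two boxes that both carry [i] in [s0]. *)
Lemma raise_ltn N (i j : 'I_N) (s0 : {ffun T -> 'I_N}) (A : {set T}) u v :
    j = i.+1 :> nat -> (forall w, s0 w != j) -> A \subset [set w | s0 w == i] ->
  (raise s0 j A u < raise s0 j A v)%N =
    if (s0 u == i) && (s0 v == i) then (v \in A) && (u \notin A) else (s0 u < s0 v)%N.
Proof.
move=> eji noj /subsetP sA; rewrite !ffunE.
have inA w : w \in A -> s0 w = i :> nat by move/sA; rewrite inE => /eqP->.
have := noj u; have := noj v; rewrite -!val_eqE /= eji.
case: (boolP (u \in A)) => [/inA|] uA; case: (boolP (v \in A)) => [/inA|] vA;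
  rewrite /= ?uA ?vA ?eji ?eqxx /=;
  do ?case: eqP => ? /=; lia.
Qed.

Lemma llt_sym (qq : K) (E : {set T * T}) N : interval_closed pos [set: T] E ->
  word_sum pos (fun D => qq ^+ #|E :&: D|) N \is symmetric.
Proof.
move=> [_ ltE clE]; apply: word_sum_sym => i j s0 x y eji noj /=.
set Z := [set u | s0 u == i].
pose EZ := E :&: setX Z Z.
(* Edges not contained in [Z] contribute a number that does not depend on [A]. *)
pose c0 := #|[set e in E | (e \notin setX Z Z) && (s0 e.2 < s0 e.1)%N]|.
have cardE (A : {set T}) : A \subset Z -> #|E :&: invs pos (raise s0 j A)| = (c0 + cut EZ A)%N.
  move=> sA; rewrite -(cardsID (setX Z Z)) addnC; congr (_ + _)%N; apply: eq_card => e.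
    rewrite !inE (raise_ltn _ _ eji noj sA) andbC [(s0 e.2 == i) && _]andbC; case: ifP => _;
      rewrite ?andbF //=.
    by rewrite andbT; case: (boolP (e \in E)) => /= [/ltE->|].
  rewrite !inE (raise_ltn _ _ eji noj sA); case: (boolP (e \in E)) => //= /ltE-> /=.
  by rewrite [(s0 e.2 == i) && _]andbC; case: ifP; rewrite ?andbF // andbT.
have cE x' y' : \sum_(A : {set T} | A \subset Z)
    (qq ^+ #|E :&: invs pos (raise s0 j A)|) *: (x' ^+ #|Z :\: A| * y' ^+ #|A|) =
    (qq ^+ c0)%:MP * cut_poly qq%:MP_[N] EZ Z x' y'.
  rewrite mulr_sumr; apply: eq_bigr => A sA.
  by rewrite cardE // -mul_mpolyC exprD mpolyCM !rmorphXn /= !mulrA.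
rewrite (cE x y) (cE y x); congr (_ * _); apply: (cut_poly_sym _ pos_inj).
split; first by rewrite subsetIr.
  by move=> e /setIP[/ltE].
move=> e e' /setIP[eE _] e'Z le1 lt1 le2; rewrite inE e'Z andbT (clE e) //.
by rewrite !inE.
Qed.
End LLT.

(** * Boxes in reading order *)

Section Diagram.
Variable la : seq nat.
Hypothesis pla : is_part la.
Implicit Types u v w : box la.

Lemma mem_boxes (la' : seq nat) i j : ((i, j) \in boxes la') = (i < nth 0 la' j)%N.
Proof.
apply/allpairsPdep/idP => [[j' [i' [_]]]|ltij].
  by rewrite mem_iota => /andP[_ lti] [-> ->].
exists j, i; rewrite !mem_iota; split=> //=.
by rewrite add0n ltnNge; apply: contraTN ltij => lej; rewrite nth_default.
Qed.

Lemma box_bound u : (bcol u < nth 0 la (brow u))%N.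
Proof. by rewrite -mem_boxes -surjective_pairing; apply: ssvalP. Qed.

Lemma brow_bound u : (brow u < size la)%N.
Proof. by have := box_bound u; case: (ltnP (brow u) (size la)) => // le; rewrite nth_default. Qed.

Lemma nth_part j j' : (j <= j')%N -> (nth 0 la j' <= nth 0 la j)%N.
Proof.
move=> lejj'; case: (ltnP j' (size la)) => [ltj'|le]; last by rewrite (nth_default _ le).
have /andP[sla _] := pla.
have tr : transitive geq by move=> a b c; rewrite /geq /= => ??; apply: leq_trans; eassumption.
exact: (sorted_leq_nth tr leqnn 0%N sla _ _ (leq_ltn_trans lejj' ltj') ltj' lejj').
Qed.

Lemma bcol_head u : (bcol u < (head 0 la).+1)%N.
Proof. by rewrite ltnS -nth0 ltnW // (leq_trans (box_bound u)) // nth_part. Qed.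

Lemma box_inj u v : bcol u = bcol v -> brow u = brow v -> u = v.
Proof.
by move=> ec er; apply: val_inj; rewrite [LHS]surjective_pairing [RHS]surjective_pairing;
  congr pair.
Qed.

(** Rows are read from top to bottom and each row from left to right; the multiplier exceeds every
    column index. *)
Definition reading_pos u : nat := ((size la - brow u) * (head 0 la).+1 + bcol u)%N.

Lemma ltn_reading u v : (reading_pos u < reading_pos v)%N =
  (brow v < brow u)%N || ((brow u == brow v) && (bcol u < bcol v)%N).
Proof.
rewrite /reading_pos; have := bcol_head u; have := bcol_head v.
have := brow_bound u; have := brow_bound v; move: (head 0%N la).+1 => m bu bv cu cv.
case: (ltngtP (brow v) (brow u)) => /= [lt|lt|->]; last by rewrite ltn_add2l.
  have -> : (size la - brow v = size la - brow u + (brow u - brow v).-1.+1)%N by lia.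
  by rewrite mulnDl mulSn; nia.
have -> : (size la - brow u = size la - brow v + (brow v - brow u).-1.+1)%N by lia.
apply/negbTE; rewrite -leqNgt mulnDl mulSn; nia.
Qed.

Lemma reading_pos_inj : injective reading_pos.
Proof.
move=> u v euv; have := ltn_reading u v; have := ltn_reading v u.
rewrite euv ltnn; case: (ltngtP (brow u) (brow v)) => //= er.
by case: (ltngtP (bcol u) (bcol v)) => //= ec _ _; apply: box_inj.
Qed.

(* The bottom row is sent to itself. *)
Definition lower u : box la := insubd u (bcol u, (brow u).-1).

Lemma lowerE u : ssval (lower u) = (bcol u, (brow u).-1).
Proof.
rewrite /lower val_insubd mem_boxes ifT //.
exact: leq_trans (box_bound u) (nth_part (leq_pred _)).
Qed.

Lemma bcol_lower u : bcol (lower u) = bcol u.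
Proof. by rewrite /bcol lowerE. Qed.

Lemma brow_lower u : brow (lower u) = (brow u).-1.
Proof. by rewrite /brow lowerE. Qed.

Lemma entryE N (sg : filling la N) u : entry sg (ssval u) = (sg u).+1.
Proof. by rewrite /entry valK. Qed.

Lemma entry_belowE N (sg : filling la N) u :
  entry_below sg u = if (0 < brow u)%N then (sg (lower u)).+1 else 0%N.
Proof.
rewrite /entry_below; case er: (brow u) => [//|j] /=.
by rewrite -entryE lowerE er.
Qed.

End Diagram.

(** * Symmetry of Macdonald polynomials *)

Section MacdonaldWord.
Variable la : seq nat.
Hypothesis pla : is_part la.
Implicit Types (u v w : box la) (D : {set box la * box la}).
Notation pos := (@reading_pos la).
Notation low := (@lower la).

Definition word_des D : {set box la} := [set u | (0 < brow u)%N && ((u, low u) \in D)].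

Definition word_maj D : nat := (\sum_(u in word_des D) (leg u).+1)%N.

(** With letters a, b, c on [u], [v] and the box below [u], the three cyclic conditions for an
    inversion pair hold exactly when an odd number of the comparisons a > b, b > c, a > c are true.
    In the bottom row only a > b counts. *)
Definition word_inv D : nat :=
  #|[set e : box la * box la | left_of e.1 e.2 &&
      ((e \in D) (+) ((0 < brow e.1)%N &&
         (((e.2, low e.1) \in D) (+) ((e.1, low e.1) \in D))))]|.

Definition macdonald_weight D : Qqt := q ^+ word_inv D * t ^+ word_maj D.

Lemma left_of_pos u v : left_of u v -> (pos u < pos v)%N.
Proof. by rewrite ltn_reading // /left_of => ->; rewrite orbT. Qed.

Lemma lower_pos u v : brow u = brow v -> (0 < brow v)%N -> (pos u < pos (low v))%N.
Proof. by move=> er gt0; rewrite ltn_reading // brow_lower //; apply/orP; left; lia. Qed.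

Lemma word_des_invs N (sg : filling la N) : Des sg = word_des (invs pos sg).
Proof.
apply/setP => u; rewrite !inE /=; case: (boolP (0 < brow u)%N) => //= gt0.
by rewrite lower_pos // entryE entry_belowE // gt0 ltnS.
Qed.

Lemma word_inv_invs N (sg : filling la N) : inv sg = word_inv (invs pos sg).
Proof.
apply: eq_card => -[u v]; rewrite !inE /= /inversion_pair.
case: (boolP (left_of u v)) => //= luv; rewrite left_of_pos //= !entryE entry_belowE //.
have /andP[/eqP er _] := luv.
case: (boolP (0 < brow u)%N) => //= gt0; last by rewrite ltn0 /= addbF; lia.
rewrite !lower_pos //=.
by move: (nat_of_ord (sg u)) (nat_of_ord (sg v)) (nat_of_ord (sg (low u))) => a b c;
  case: (ltnP b a); case: (ltnP c b); case: (ltnP c a) => /=; lia.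
Qed.

Lemma macdonaldHE N : macdonaldH la N = word_sum pos macdonald_weight N.
Proof.
apply: eq_bigr => sg _; rewrite /macdonald_weight word_inv_invs; congr (_ * t ^+ _ *: _).
by apply: eq_bigl => u; rewrite word_des_invs.
Qed.

Definition arm_len u : nat := #|[set v | left_of u v]|.

(** The pairs [(u, w)] where [w] is read after [u] and, unless [u] is in the bottom row, before the
    box below [u]. *)
Definition attack : {set box la * box la} :=
  [set e | left_of e.1 e.2 || ((brow e.1 == (brow e.2).+1) && (bcol e.2 < bcol e.1)%N)].

(** The boxes attacked by [v] in the row below it are exactly the boxes [low u] with [u] to the left
    of [v]. *)
Lemma card_attack D : #|attack :&: D| =
  (\sum_(e | left_of e.1 e.2)
     ((e \in D) + ((0 < brow e.1)%N && ((e.2, low e.1) \in D))))%N.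
Proof.
rewrite -(cardsID [set e | left_of e.1 e.2] (attack :&: D)) big_split /=.
set L := [set e : box la * box la | left_of e.1 e.2].
pose c (e : box la * box la) := (0 < brow e.1)%N.
have eL F : (\sum_(e | left_of e.1 e.2) F e = \sum_(e in L) F e)%N.
  by apply: eq_bigl => e; rewrite !inE.
rewrite !eL.
congr (_ + _)%N.
  rewrite -sum1_card big_mkcond [RHS]big_mkcond; apply: eq_bigr => e _.
  by rewrite !inE /=; case: left_of => //=; rewrite ?andbF ?andbT.
  rewrite -[RHS]big_mkcondr /=.
  pose S := [set e in L | c e && ((e.2, low e.1) \in D)].
  rewrite (eq_bigl (mem S)) => [|e]; last by rewrite !inE.
  rewrite sum1_card -[RHS](card_in_imset (f := fun e => (e.2, low e.1))) /=; last first.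
    move=> [u v] [u' v']; rewrite !inE /=.
    move=> /andP[/andP[/eqP er _] _] /andP[/andP[/eqP er' _] _] [ev el].
    congr pair => //; apply: box_inj; last by rewrite er er' ev.
    by rewrite -(bcol_lower pla) el bcol_lower.
  apply: eq_card => -[v w]; apply/idP/imsetP => [|[[u v'] e1 [-> ->]]].
    rewrite in_setD in_setI => /andP[nL /andP[att dD]].
    move: nL att; rewrite !inE /= => /negbTE-> /= /andP[/eqP er lt].
    have bx : (bcol w, brow v) \in boxes la by rewrite mem_boxes (ltn_trans lt) // box_bound.
    pose u : box la := SeqSub bx; exists (u, v).
      have lu : low u = w by apply: box_inj; rewrite ?(bcol_lower pla) ?(brow_lower pla) // -[brow
        u]/(brow v) er.
      have luv : left_of u v by rewrite /left_of [brow u]/= [bcol u]/= eqxx lt.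
      by rewrite !inE /= luv lu dD /c -[brow u]/(brow v) er.
    by congr pair; apply: box_inj; rewrite ?(bcol_lower pla) ?(brow_lower pla) // -[brow u]/(brow
      v) er.
  move: e1; rewrite !inE /= => /andP[/andP[/eqP er lt] /andP[gt0 dD]].
  rewrite dD andbT /left_of !brow_lower // !bcol_lower // -er lt prednK // eqxx orbT andbT.
  by apply/negP => /andP[/eqP]; lia.
Qed.

(** Inversions are attacking inversions minus the arms of the descents. By transitivity [a > b] +
    [b > c] - [a > c] is 0 or 1, hence equal to the parity in [word_inv], and the terms [a > c] add
    up to the arms of the descents. Transitivity is the reason why [D] has to come from a
    filling. *)
Lemma word_inv_attack N (sg : filling la N) : let D := invs pos sg in
  (word_inv D + \sum_(u in word_des D) arm_len u)%N = #|attack :&: D|.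
Proof.
move=> D; rewrite card_attack.
pose c (e : box la * box la) := (0 < brow e.1)%N.
have -> : (\sum_(u in word_des D) arm_len u =
           \sum_(e | left_of e.1 e.2) (c e && ((e.1, low e.1) \in D)))%N.
  rewrite (eq_bigr (fun u => \sum_(v | left_of u v) 1))%N => [|u _]; last first.
    by rewrite sum1_card; apply: eq_card => v; rewrite inE.
  rewrite pair_big_dep /= -[RHS]big_mkcondr; apply: eq_bigl => -[u v].
  by rewrite !inE andbC.
pose tri (e : box la * box la) := (e \in D) (+) (c e && (((e.2, low e.1) \in D) (+) ((e.1,
  low e.1) \in D))).
rewrite /word_inv -sum1_card (eq_bigl (fun e => left_of e.1 e.2 && tri e)); last first.
  by move=> e; rewrite in_set.
rewrite big_mkcondr /=.
rewrite -big_split /=; apply: eq_bigr => -[u v] /= luv.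
rewrite /tri /c /= !inE /= left_of_pos //.
have /andP[/eqP er _] := luv.
case: (boolP (0 < brow u)%N) => //= gt0; last by rewrite addbF; case: (_ < _)%N.
rewrite !lower_pos //=.
by move: (nat_of_ord (sg u)) (nat_of_ord (sg v)) (nat_of_ord (sg (low u))) => a b c';
  case: (ltnP b a); case: (ltnP c' b); case: (ltnP c' a) => /=; lia.
Qed.

End MacdonaldWord.

Lemma q_neq0 : q != 0.
Proof.
rewrite /q tofrac_eq0; apply/eqP => /(congr1 (mcoeff U_(ord0))).
by rewrite mcoeffXU eqxx mcoeff0 => /eqP; rewrite oner_eq0.
Qed.

Lemma qB1_neq0 : q - 1 != 0.
Proof.
rewrite /q -tofrac1 -tofracB tofrac_eq0; apply/eqP => /(congr1 (mcoeff U_(ord0))).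
rewrite mcoeffB mcoeffXU eqxx mcoeff0 mcoeff1 mnm1_eq0 subr0 => /eqP.
by rewrite oner_eq0.
Qed.

Lemma natrQqt_eq0 n : (n%:R == 0 :> Qqt) = (n == 0%N).
Proof.
rewrite -[n%:R](rmorph_nat (@tofrac _)) tofrac_eq0 -[n%:R](rmorph_nat (@mpolyC 2 rat)).
by rewrite mpolyC_eq0 Num.Theory.pnatr_eq0.
Qed.

Lemma word_sum_lin (K : comNzRingType) (T I : finType) (pos' : T -> nat) (P : pred I) (c : I -> K)
    (W : I -> {set T * T} -> K) N :
  word_sum pos' (fun X => \sum_(i | P i) c i * W i X) N =
  \sum_(i | P i) c i *: word_sum pos' (W i) N.
Proof.
rewrite /word_sum; under [RHS]eq_bigr do rewrite scaler_sumr.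
rewrite [RHS]exchange_big; apply: eq_bigr => s _ /=.
by rewrite scaler_suml; apply: eq_bigr => i _; rewrite scalerA.
Qed.

Section MacdonaldSym.
Variable la : seq nat.
Hypothesis pla : is_part la.
Implicit Types (u v w : box la) (D : {set box la * box la}).
Notation pos := (@reading_pos la).
Notation low := (@lower la).

Definition attack_desc (B : {set box la}) : {set box la * box la} :=
  attack la :|: [set (u, low u) | u in B].

(** The attacking pairs starting at [u] end just before the box below [u], and adding [(u, low u)]
    extends this interval by one box. Since [low] is strictly increasing in reading order above the
    bottom row, right ends remain monotone whatever [B] is. *)
Lemma attack_desc_closed (B : {set box la}) : B \subset [set u | (0 < brow u)%N] ->
  interval_closed pos [set: box la] (attack_desc B).
Proof.
move=> /subsetP sB.
have inB e : (e \in [set (u, low u) | u in B]) = (e.1 \in B) && (e.2 == low e.1).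
  by apply/imsetP/andP => [[u uB ->]|[eB /eqP e2]] //; exists e.1 => //;
    rewrite -e2 -surjective_pairing.
have gt0 u : u \in B -> (0 < brow u)%N by move/sB; rewrite inE.
split; first by apply/subsetP => e; rewrite !inE.
  move=> [u v]; rewrite /attack_desc in_setU inB inE /= => /orP[/orP[/(left_of_pos
    pla)//|/andP[/eqP er _]]|].
    by rewrite ltn_reading // er ltnSn.
  by case/andP=> /gt0 g0 /eqP->; apply: lower_pos.
move=> [u v] [u' v'] /=; rewrite /attack_desc !in_setU !inB /= => uvE _.
rewrite leqNgt ltn_reading // => nu; rewrite ltn_reading // => lt1;
  rewrite leqNgt ltn_reading // => nv.
have vlow : (brow u = brow v /\ (bcol u < bcol v)%N) \/ 
   (brow u = (brow v).+1 /\ ((bcol v < bcol u)%N \/ (bcol v = bcol u /\ u \in B))).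
  move: uvE; rewrite inE /left_of /= => /orP[/orP[/andP[/eqP-> ->]|/andP[/eqP-> ->]]|/andP[uB
    /eqP->]]; [by left|by right; split=> //; left|].
  by right; rewrite brow_lower // bcol_lower // prednK ?gt0 //; split => //; right.
rewrite inE /left_of /=.
have [/eqP e1|ne] := boolP (brow u' == brow v'); first lia.
have ec : (brow u' = (brow v').+1 /\ (bcol v' <= bcol u')%N) by lia.
case: ec => er' le; have [e2|ne2] := eqVneq (bcol v') (bcol u'); last by rewrite er' eqxx /=; lia.
have eu : u' = u by apply: box_inj; lia.
have ev : v' = v by apply: box_inj; lia.
move: uvE; rewrite eu ev inE /left_of /= -!orbA => /or3P[/andP[/eqP]|/andP[_]|->]; try lia.
Qed.

(* Any function of a truth value d has the form alpha + beta q^d, so the weight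
   t^(leg + 1) / q^arm of a descent can be traded for an additional attacking
   pair: macdonaldH is a linear combination of unicellular LLT polynomials. *)
Lemma macdonald_sym N : macdonaldH la N \is symmetric.
Proof.
pose z u : Qqt := t ^+ (leg u).+1 / q ^+ arm_len u.
pose beta u := (z u - 1) / (q - 1).
pose NB := [set u : box la | (0 < brow u)%N].
pose c (B : {set box la}) := \prod_u (if u \in B then beta u else (if u \in NB then 1 - beta u else
  1)).
pose W B D := q ^+ #|attack_desc B :&: D|.
have -> : macdonaldH la N = word_sum pos (fun D => \sum_(B : {set box la} | B \subset NB) c B * W B
  D) N.
  rewrite macdonaldHE //; apply: eq_bigr => sg _; congr (_ *: _).
  set D := invs pos sg; have := word_inv_attack pla sg; rewrite /= -/D; move: D => D invD.
  have -> : macdonald_weight D = q ^+ #|attack la :&: D| * \prod_(u in word_des D) z u.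
    rewrite -invD exprD -mulrA; congr (_ * _).
    rewrite -!prodrXr -big_split /=; apply: eq_bigr => u _.
    by rewrite mulrCA divff ?mulr1 // expf_neq0 // q_neq0.
  pose d u := (u, low u) \in D.
  have -> : \prod_(u in word_des D) z u =
      \prod_u ((if u \in NB then beta u * q ^+ d u else 0) + (if u \in NB then 1 - beta u else 1)).
    rewrite big_mkcond; apply: eq_bigr => u _; rewrite !inE -/(d u).
    case: (0 < brow u)%N => /=; last by rewrite add0r.
    case: (d u) => /=; last by rewrite expr0 mulr1; ring.
    by rewrite expr1 addrCA -{2}[beta u]mulr1 -mulrBr divfK ?qB1_neq0 // addrC subrK.
  (* Expanding the product over all boxes chooses the set [B] where the term with [q] is taken; a
     set meeting the bottom row gives a factor 0. *)
  rewrite bigA_distr mulr_sumr [LHS](bigID (fun B : {set box la} => B \subset NB)) /= [X in _ +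
    X]big1 ?addr0; last first.
    move=> B /subsetPn[u uB uN]; rewrite (bigD1 u) //= uB (negbTE uN).
    by rewrite mul0r mulr0.
  apply: eq_big => // B sB.
  rewrite /W /c.
  have -> : #|attack_desc B :&: D| = (#|attack la :&: D| + \sum_(u in B) d u)%N.
    rewrite /attack_desc setIUl cardsU.
    have -> : attack la :&: D :&: ([set (u, low u) | u in B] :&: D) = set0.
      apply/setP => e; rewrite in_set0; apply/negP; rewrite in_setI => /andP[/setIP[eA _] /setIP[eB
        _]].
      case/imsetP: eB eA => u uB ->; rewrite inE /left_of /= brow_lower // bcol_lower //.
      by have := subsetP sB _ uB; rewrite inE; lia.
    rewrite cards0 subn0; congr (_ + _)%N.
    have -> : [set (u, low u) | u in B] :&: D = [set (u, low u) | u in [set v in B | d v]].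
      apply/setP => e; apply/setIP/imsetP => [[/imsetP[u uB ->] uD]|[u]].
        by exists u => //; rewrite in_set uB.
      by rewrite in_set => /andP[uB du] ->; split=> //; apply/imsetP; exists u.
    rewrite card_imset; last by move=> u v [].
    by rewrite -sum1dep_card big_mkcondr.
  rewrite exprD mulrCA; congr (_ * _).
  rewrite -prodrXr [X in _ * X]big_mkcond -big_split /=; apply: eq_bigr => u _.
  by case: ifP => uB; rewrite ?mulr1 // (subsetP sB).
rewrite word_sum_lin; apply: rpred_sum => B sB; apply: rpredZ.
exact: (llt_sym (reading_pos_inj pla) _ _ (attack_desc_closed sB)).
Qed.
End MacdonaldSym.

(** * Symmetry of Schur functions *)

Section SchurSym.
Variable la : seq nat.
Hypothesis pla : is_part la.
Implicit Types (u v w : box la) (D : {set box la * box la}).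
Notation pos := (@reading_pos la).

Definition word_semistandard D : bool :=
  [forall u : box la, forall v : box la,
     (left_of u v ==> ((u, v) \notin D)) && (below u v ==> ((v, u) \in D))].

Lemma below_pos u v : below u v -> (pos v < pos u)%N.
Proof. by rewrite ltn_reading // => /andP[_ ->]. Qed.

Lemma semistandard_invs N (sg : filling la N) :
  semistandard sg = word_semistandard (invs pos sg).
Proof.
apply: eq_forallb => u; apply: eq_forallb => v; rewrite !inE /=.
case: (boolP (left_of u v)) => [/(left_of_pos pla)->|_] /=;
  case: (boolP (below u v)) => [/below_pos->|_] //=; by rewrite -?leqNgt.
Qed.

Lemma schurE N : schur la N = word_sum pos (fun D => (word_semistandard D)%:R : Qqt) N.
Proof.
rewrite /schur big_mkcond; apply: eq_bigr => sg _; rewrite semistandard_invs.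
by case: ifP => _; rewrite ?scale1r ?scale0r.
Qed.

Lemma semistandardP N (sg : filling la N) :
  reflect ((forall u v, left_of u v -> (sg u <= sg v)%N) /\
           (forall u v, below u v -> (sg u < sg v)%N)) (semistandard sg).
Proof.
apply: (iffP forallP) => [H|[H1 H2] u].
  by split=> u v; have /forallP/(_ v)/andP[/implyP ? /implyP] := H u.
by apply/forallP => v; apply/andP; split; apply/implyP; [apply: H1|apply: H2].
Qed.

Lemma bit_betweenl (i m : nat) (x y : bool) :
  (i + x <= m -> m < i + y -> i <= m <= i.+1)%N.
Proof. by case: x; case: y; lia. Qed.

Lemma bit_betweenr (i m : nat) (x y : bool) :
  (i + x < m -> m <= i + y -> i <= m <= i.+1)%N.
Proof. by case: x; case: y; lia. Qed.

(* A box with another box of value i or j in its column has its value forced;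
   the remaining boxes, Fr, are only constrained by their row. *)
Section TwoValues.
Variables (N : nat) (i j : 'I_N) (s0 : filling la N).
Hypotheses (eji : j = i.+1 :> nat) (noj : forall u, s0 u != j).
Let Z := [set u | s0 u == i].
(** Boxes above another box of [Z] must carry [j], and those of [U0], below another box of [Z], must
    carry [i]. *)
Let U1 := [set v in Z | [exists u in Z, below u v]].
Let U0 := [set u in Z | [exists v in Z, below u v]].
Let Fr := Z :\: (U0 :|: U1).
Let E := [set e in setX Fr Fr | left_of e.1 e.2].

Variable A0 : {set box la}.
Hypotheses (sA0 : A0 \subset Z) (ssA0 : semistandard (raise s0 j A0)).
Let f := raise s0 j A0.

Let f_in u : u \in Z -> f u = (i + (u \in A0))%N :> nat.
Proof. by rewrite inE ffunE => /eqP->; case: ifP => _; rewrite ?eji ?addn1 ?addn0. Qed.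

Let f_out u : (i <= f u <= i.+1)%N -> u \in Z.
Proof.
rewrite ffunE inE; case: ifP => [uA _|_]; first by have := subsetP sA0 _ uA; rewrite inE.
by have := noj u; rewrite -!val_eqE /= eji => *; apply/eqP; lia.
Qed.

Let row_le u v : left_of u v -> (f u <= f v)%N.
Proof. by have [H _] := semistandardP _ ssA0; apply: H. Qed.

Let col_lt u v : below u v -> (f u < f v)%N.
Proof. by have [_ H] := semistandardP _ ssA0; apply: H. Qed.

Let U0P u : u \in U0 -> u \in Z /\ u \notin A0.
Proof.
rewrite inE => /andP[uZ /exists_inP[v vZ /col_lt lt]]; split=> //.
by move: lt; rewrite !f_in //; case: (u \in A0) => //; case: (v \in A0); lia.
Qed.

Let U1P u : u \in U1 -> u \in Z /\ u \in A0.
Proof.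
rewrite inE => /andP[uZ /exists_inP[v vZ /col_lt lt]]; split=> //.
by move: lt; rewrite !f_in //; case: (u \in A0) => //; case: (v \in A0); lia.
Qed.

(** Let [u'] be the box of [Z] below [u]. The box in its row and in the column of [v] has a value at
    least that of [u'] and less than that of [v], hence [i] or [j]; so [v] also lies above a box of
    [Z]. *)
Let U1_right u v : left_of u v -> v \in Z -> u \in U1 -> v \in U1.
Proof.
move=> /andP[/eqP er lt] vZ; rewrite inE => /andP[uZ /exists_inP[u' u'Z /andP[/eqP ec' lt']]].
have bx : (bcol v, brow u') \in boxes la.
  rewrite mem_boxes (leq_trans (box_bound v)) // nth_part // -er; exact: ltnW.
pose v' : box la := SeqSub bx.
have l1 := @row_le u' v' _; have l2 := @col_lt v' v _.
rewrite inE vZ; apply/exists_inP; exists v'; last by rewrite /below eqxx -er.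
have := l1 _; have := l2 _; rewrite /below /left_of eqxx -er ec' lt lt' eqxx => /(_ isT) + /(_ isT).
rewrite (f_in vZ) (f_in u'Z) => h2 h1; apply: f_out; exact: bit_betweenl h1 h2.
Qed.

Let U0_left u v : left_of u v -> u \in Z -> v \in U0 -> u \in U0.
Proof.
move=> /andP[/eqP er lt] uZ; rewrite inE => /andP[vZ /exists_inP[v' v'Z /andP[/eqP ec' lt']]].
have bx : (bcol u, brow v') \in boxes la.
  by rewrite mem_boxes (ltn_trans lt) // ec' box_bound.
pose u' : box la := SeqSub bx.
have l1 := @row_le u' v' _; have l2 := @col_lt u u' _.
rewrite inE uZ; apply/exists_inP; exists u'; last by rewrite /below eqxx er.
have := l1 _; have := l2 _; rewrite /below /left_of !eqxx er -ec' lt lt' => /(_ isT) + /(_ isT).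
rewrite (f_in uZ) (f_in v'Z) => h2 h1; apply: f_out; exact: bit_betweenr h2 h1.
Qed.

(** The given semistandard filling takes care of the comparisons not inside [Z]. In a row, a
    comparison involving a forced box is automatic by [U1_right] and [U0_left], so the free part is
    constrained only by having no cut edge. *)
Let semistandard_raise (A : {set box la}) : A \subset Z ->
  semistandard (raise s0 j A) = (A :&: (U0 :|: U1) == U1) && (cut E (A :&: Fr) == 0%N).
Proof.
move=> sA; apply/semistandardP/andP => [[H1 H2]|[/eqP eA /eqP/cards0_eq cA]].
  have lt u v : u \in Z -> v \in Z -> (raise s0 j A u < raise s0 j A v)%N = (v \in A) && (u \notin
    A).
    by rewrite (raise_ltn _ _ eji noj sA) !inE => -> ->.
  split; last first.
    apply/eqP/eq_card0 => e; rewrite !inE; apply/negP => /andP[].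
    case: e => u v /= /andP[/andP[/andP[uF uZ] /andP[vF vZ]] luv] /andP[/andP[uA _] vA].
    have := H1 _ _ luv; rewrite leqNgt lt ?inE // uA /=.
    by move: vA; rewrite vF vZ !andbT => ->.
  apply/eqP/setP => u; rewrite in_setI in_setU.
  case: (boolP (u \in U1)) => [|_].
    rewrite orbT andbT inE => /andP[uZ /exists_inP[v vZ /H2]].
    by rewrite lt // => /andP[].
  rewrite orbF; apply/negP => /andP[uA].
  rewrite inE => /andP[uZ /exists_inP[v vZ /H2]].
  by rewrite lt // uA andbF.
have AU1 u : u \in U1 -> u \in A by rewrite -eA => /setIP[].
have AU0 u : u \in U0 -> u \notin A.
  move=> uU; apply/negP => uA; have : u \in U1 by rewrite -eA !in_setI uA in_setU uU.
  by move/U1P=> [_]; apply/negP; have [] := U0P uU.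
split=> u v luv.
  rewrite leqNgt (raise_ltn _ _ eji noj sA); case: ifP => [/andP[sv su]|nZ]; last first.
    by have := row_le luv; rewrite leqNgt (raise_ltn _ _ eji noj sA0) nZ.
  have uZ : u \in Z by rewrite inE.
  have vZ : v \in Z by rewrite inE.
  apply/negP => /andP[uA vA].
  have uN1 : u \notin U1 by apply: contra vA => /(U1_right luv vZ)/AU1.
  have uN0 : u \notin U0 by apply/negP => /AU0; rewrite uA.
  have vN1 : v \notin U1 by apply: contra vA => /AU1.
  have vN0 : v \notin U0 by apply: contra uN0 => /(U0_left luv uZ).
  have uF : u \in Fr by rewrite in_setD in_setU negb_or uN0 uN1.
  have vF : v \in Fr by rewrite in_setD in_setU negb_or vN0 vN1.
  have uvE : (u, v) \in E by rewrite in_set in_setX uF vF luv.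
  have : (u, v) \in set0 by rewrite -cA in_set uvE /= !in_setI uA uF (negbTE vA).
  by rewrite inE.
rewrite (raise_ltn _ _ eji noj sA); case: ifP => [/andP[su sv]|nZ]; last first.
  by have := col_lt luv; rewrite (raise_ltn _ _ eji noj sA0) nZ.
have uZ : u \in Z by rewrite inE.
have vZ : v \in Z by rewrite inE.
have -> : v \in A by apply: AU1; rewrite inE vZ; apply/exists_inP; exists u.
by apply: AU0; rewrite inE uZ; apply/exists_inP; exists v.
Qed.

(** A column contains at most two boxes of [Z], since its entries increase strictly; the vertical
    pairs therefore match [U0] with [U1]. *)
Let card_U : #|U0| = #|U1|.
Proof.
pose P := [set e : box la * box la | [&& e.1 \in Z, e.2 \in Z & below e.1 e.2]].
have -> : U0 = [set e.1 | e in P].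
  apply/setP => u; apply/idP/imsetP => [|[[u' v] + ->]].
    by rewrite inE => /andP[uZ /exists_inP[v vZ luv]]; exists (u, v) => //; rewrite in_set /= uZ vZ.
  by rewrite in_set /= => /and3P[uZ vZ luv]; rewrite inE uZ; apply/exists_inP; exists v.
have -> : U1 = [set e.2 | e in P].
  apply/setP => v; apply/idP/imsetP => [|[[u v'] + ->]].
    by rewrite inE => /andP[vZ /exists_inP[u uZ luv]]; exists (u, v) => //; rewrite in_set /= uZ vZ.
  by rewrite in_set /= => /and3P[uZ vZ luv]; rewrite inE vZ; apply/exists_inP; exists u.
have PU u v : (u, v) \in P -> u \in U0 /\ v \in U1.
  rewrite in_set /= => /and3P[uZ vZ luv]; split; rewrite inE ?uZ ?vZ; apply/exists_inP;
    [exists v|exists u] => //.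
have fU0 u : u \in U0 -> f u = i :> nat.
  by move=> uU; have [uZ /negbTE uA] := U0P uU; rewrite f_in // uA addn0.
have fU1 u : u \in U1 -> f u = i.+1 :> nat.
  by move=> uU; have [uZ uA] := U1P uU; rewrite f_in // uA addn1.
have bel u v : (u, v) \in P -> bcol u = bcol v.
  by rewrite in_set => /and3P[_ _ /andP[/eqP]].
rewrite !card_in_imset // => -[u v] [u' v'] uv uv' /= e; [rewrite -e in uv' *|rewrite -e in uv' *];
  congr pair; have [? ?] := PU _ _ uv; have [? ?] := PU _ _ uv'.
  case: (ltngtP (brow u) (brow u')) => er.
  - by have := @col_lt u u'; rewrite /below (bel _ _ uv) (bel _ _ uv') eqxx er !fU0 // ltnn => /(_
    isT).
  - by have := @col_lt u' u; rewrite /below (bel _ _ uv) (bel _ _ uv') eqxx er !fU0 // ltnn => /(_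
    isT).
  - by apply: box_inj => //; rewrite (bel _ _ uv) (bel _ _ uv').
case: (ltngtP (brow v) (brow v')) => er.
- by have := @col_lt v v'; rewrite /below -(bel _ _ uv) -(bel _ _ uv') eqxx er !fU1 // ltnn => /(_
  isT).
- by have := @col_lt v' v; rewrite /below -(bel _ _ uv) -(bel _ _ uv') eqxx er !fU1 // ltnn => /(_
  isT).
- by apply: box_inj => //; rewrite -(bel _ _ uv) -(bel _ _ uv').
Qed.

(** Each forced pair contributes one [x] and one [y]. On the free boxes, forbidding cut edges
    amounts to the weight 0 to the power of the cut. *)
Lemma semistandard_raise_sum (R : comNzRingType) (x y : R) :
  \sum_(A : {set box la} | (A \subset Z) && semistandard (raise s0 j A))
     x ^+ #|Z :\: A| * y ^+ #|A| = (x * y) ^+ #|U0| * cut_poly 0 E Fr x y.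
Proof.
have dU : [disjoint U0 & U1].
  by apply/pred0P => u /=; apply/negP => /andP[/U0P[_ /negP nu] /U1P[_]].
have FrU u : u \in Fr -> u \notin U1 by rewrite in_setD in_setU negb_or => /andP[/andP[]].
have U1Z : U1 \subset Z by apply/subsetP => u /U1P[].
have U0Z : U0 \subset Z by apply/subsetP => u /U0P[].
have FrZ : Fr \subset Z by exact: subsetDl.
rewrite (reindex_onto (fun B => B :|: U1) (fun A => A :&: Fr)) /=; last first.
  move=> A /andP[sA]; rewrite semistandard_raise // => /andP[/eqP eA _].
  apply/setP => u; rewrite in_setU in_setI -eA in_setI in_setD.
  by case: (boolP (u \in A)) => //= /(subsetP sA)->; case: (u \in _ :|: _).
have key (B : {set box la}) : B \subset Fr -> (B :|: U1) :&: Fr = B /\ (B :|: U1) :&: (U0 :|: U1) =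
  U1.
  move=> sB; split; apply/setP => u; rewrite in_setI ?in_setU.
    case: (boolP (u \in B)) => [/(subsetP sB)//|_] /=.
    by apply/negP => /andP[u1 /FrU]; rewrite u1.
  case: (boolP (u \in U1)) => [_|nu]; first by rewrite !orbT.
  rewrite !orbF; apply/negP => /andP[/(subsetP sB)]; rewrite in_setD in_setU negb_or =>
    /andP[/andP[/negP nu0 _] _].
  exact: nu0.
rewrite /cut_poly mulr_sumr [RHS](bigID (fun B => cut E B == 0%N)) /= [X in _ + X]big1 ?addr0;
  last first.
  by move=> B /andP[_ /negbTE nz]; rewrite expr0n nz mul0r mulr0.
apply: eq_big => B.
  apply/idP/idP => [/andP[/andP[sB ss] /eqP eB]|/andP[sB cB]].
    have sBF : B \subset Fr by rewrite -eB subsetIr.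
    by move: ss; rewrite semistandard_raise // eB sBF => /andP[].
  have [k1 k2] := key B sB.
  have sBZ : B :|: U1 \subset Z by rewrite subUset U1Z (subset_trans sB).
  by rewrite sBZ semistandard_raise // k1 k2 !eqxx cB.
case/andP=> /andP[sBZ ss] /eqP eB; have sB : B \subset Fr by rewrite -eB subsetIr.
have [k1 k2] := key B sB.
move: ss; rewrite semistandard_raise // k1 => /andP[_ /eqP->]; rewrite expr0 mul1r.
have -> : #|B :|: U1| = (#|U0| + #|B|)%N.
  rewrite cardsU addnC card_U disjoint_setI0 ?cards0 ?subn0 //.
  by apply/pred0P => u /=; apply/negP => /andP[/(subsetP sB)/FrU/negP].
have -> : #|Z :\: (B :|: U1)| = (#|U0| + #|Fr :\: B|)%N.
  rewrite -(cardsID U0); congr (_ + _)%N; apply: eq_card => u; rewrite !(in_setI, in_setD, in_setU).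
    case: (boolP (u \in U0)) => uU; rewrite ?andbF // (subsetP U0Z) // !andbT.
    apply/norP; split; last by apply/negP => u1; move/pred0P/(_ u): dU; rewrite /= uU u1.
    by apply/negP => /(subsetP sB); rewrite in_setD in_setU uU.
  by rewrite !negb_or; case: (u \in U0); case: (u \in B); case: (u \in U1); rewrite ?andbF ?andbT.
by rewrite !exprD exprMn mulrACA.
Qed.

End TwoValues.

Lemma word_semistandard_sym (K : comNzRingType) N :
  word_sum pos (fun D => (word_semistandard D)%:R : K) N \is symmetric.
Proof.
apply: word_sum_sym => i j s0 x y eji noj /=.
set Z := [set u | s0 u == i].
pose P (A : {set box la}) := (A \subset Z) && semistandard (raise s0 j A).
have cond x' y' : \sum_(A : {set box la} | A \subset Z)
     (word_semistandard (invs pos (raise s0 j A)))%:R *: (x' ^+ #|Z :\: A| * y' ^+ #|A|)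
   = \sum_(A : {set box la} | P A) x' ^+ #|Z :\: A| * y' ^+ #|A| :> {mpoly K[N]}.
  rewrite big_mkcondr; apply: eq_bigr => A sA; rewrite -semistandard_invs.
  by case: ifP => _; rewrite ?scale1r ?scale0r.
(* If no raising of [s0] is semistandard, both sides are empty sums. *)
rewrite (cond x y) (cond y x); have [A0 /andP[sA0 ssA0]|noA] := pickP P; last by rewrite !big_pred0.
have rs x' y' := semistandard_raise_sum eji noj sA0 ssA0 (x' : {mpoly K[N]}) y'.
rewrite (rs x y) (rs y x) (mulrC y x); congr (_ * _).
apply: (cut_poly_sym _ (reading_pos_inj pla)); split.
- by apply/subsetP => e; rewrite in_set => /andP[].
- by move=> e; rewrite in_set => /andP[_ /(left_of_pos pla)].
move=> [u v] [u' v']; rewrite !in_set /= => /andP[_ luv] -> le1 lt1 le2 /=.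
move: luv le1 lt1 le2; rewrite [(pos u <= _)%N]leqNgt [(pos v' <= _)%N]leqNgt.
by rewrite !(ltn_reading pla) /left_of /=; lia.
Qed.

End SchurSym.

(** * Homogeneous symmetric functions and their expansions *)

Section Restriction.
Variables (K : comNzRingType) (N : nat).

Definition drop_last (i : 'I_N.+1) : {mpoly K[N]} :=
  if unlift ord_max i is Some j then 'X_j else 0.

Definition restr (p : {mpoly K[N.+1]}) : {mpoly K[N]} := mmap (@mpolyC N K) drop_last p.

HB.instance Definition _ := GRing.RMorphism.copy restr (mmap (@mpolyC N K) drop_last).

Lemma restrZ c p : restr (c *: p) = c *: restr p.
Proof. by rewrite /restr mmapZ mul_mpolyC. Qed.

Lemma restrXU i : restr 'X_i = drop_last i.
Proof. by rewrite /restr mmapX mmap1U. Qed.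

Lemma drop_last_widen (i : 'I_N) : drop_last (widen_ord (leqnSn N) i) = 'X_i.
Proof.
rewrite /drop_last (_ : widen_ord _ i = lift ord_max i) ?liftK //.
by apply: val_inj; rewrite /= /bump leqNgt ltn_ord.
Qed.

Lemma drop_last_max : drop_last ord_max = 0.
Proof. by rewrite /drop_last unlift_none. Qed.

Lemma restr_coef (p : {mpoly K[N.+1]}) m : (restr p)@_m = p@_(mnmwiden m).
Proof.
have -> : restr p = \sum_(m' <- msupp p) p@_m' *: restr 'X_[m'].
  rewrite {1}(mpolyE p) (rmorph_sum (@restr)) /=; apply: eq_bigr => m' _; exact: restrZ.
rewrite raddf_sum [in RHS](mpolyE p) raddf_sum /=; apply: eq_bigr => m' _.
rewrite !mcoeffZ mcoeffX; congr (_ * _).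
rewrite /restr mmapX /mmap1 big_ord_recr /= drop_last_max.
rewrite (eq_bigr (fun i => 'X_i ^+ m' (widen_ord (leqnSn N) i))) => [|i _]; last first.
  by rewrite -drop_last_widen.
case: (eqVneq (m' ord_max) 0%N) => [e0|ne]; last first.
  rewrite expr0n (negbTE ne) mulr0 mcoeff0; case: (eqVneq m' (mnmwiden m)) => // e.
  by rewrite e mnmwiden_ordmax eqxx in ne.
rewrite e0 expr0 mulr1.
pose m2 := [multinom m' (widen_ord (leqnSn N) i) | i < N].
rewrite (_ : \prod_(i < N) _ = 'X_[m2]); last first.
  by rewrite mpolyXE_id; apply: eq_bigr => i _; rewrite mnmE.
rewrite mcoeffX; congr (_%:R); congr nat_of_bool; apply/eqP/eqP => [<-|em].
  apply/mnmP => i; case: (unliftP ord_max i) => [j ->|->]; last by rewrite mnmwiden_ordmax e0.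
  have -> : lift ord_max j = widen_ord (leqnSn N) j.
    by apply: val_inj; rewrite /= /bump leqNgt ltn_ord.
  by rewrite mnmwiden_widen mnmE.
by apply/mnmP => i; rewrite mnmE em mnmwiden_widen.
Qed.
End Restriction.

Definition family (K : comNzRingType) := forall N, {mpoly K[N]}.

(* The last condition makes the family an element of the inverse limit. *)
Definition homog_symfun (K : comNzRingType) n (f : family K) : Prop :=
  [/\ forall N, f N \is symmetric, forall N, f N \is n.-homog & forall N, restr (f N.+1) = f N].

Section HomogSymfun.
Variables (K : comNzRingType).
Implicit Types f : family K.

Lemma homog_symfunM n1 n2 f1 f2 : homog_symfun n1 f1 -> homog_symfun n2 f2 ->
  homog_symfun (n1 + n2) (fun N => f1 N * f2 N).
Proof.
move=> [s1 h1 r1] [s2 h2 r2]; split=> N /=; first exact: rpredM (s1 N) (s2 N).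
  exact: dhomogM (h1 N) (h2 N).
by rewrite rmorphM /= r1 r2.
Qed.

Lemma homog_symfun1 : homog_symfun 0 (fun N => 1 : {mpoly K[N]}).
Proof. by split=> N /=; [exact: rpred1|exact: dhomog1|exact: rmorph1]. Qed.

Lemma homog_symfun_sum (I : Type) (s : seq I) (P : pred I) n (F : I -> family K) :
  (forall i, P i -> homog_symfun n (F i)) ->
  homog_symfun n (fun N => \sum_(i <- s | P i) F i N).
Proof.
move=> hF; split=> N /=.
- by apply: rpred_sum => i /hF[h _ _]; apply: h.
- by apply: rpred_sum => i /hF[_ h _]; apply: h.
by rewrite rmorph_sum /=; apply: eq_bigr => i /hF[_ _ h]; apply: h.
Qed.

Lemma homog_symfunZ n c f : homog_symfun n f -> homog_symfun n (fun N => c *: f N).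
Proof.
move=> [s1 h1 r1]; split=> N /=; [exact: rpredZ (s1 N)|exact: rpredZ (h1 N)|].
by rewrite restrZ r1.
Qed.

Lemma homog_symfun_prod (I : Type) (s : seq I) (P : pred I) (n : I -> nat) (F : I -> family K) :
  (forall i, P i -> homog_symfun (n i) (F i)) ->
  homog_symfun (\sum_(i <- s | P i) n i) (fun N => \prod_(i <- s | P i) F i N).
Proof.
move=> hF; have -> : (\sum_(i <- s | P i) n i)%N = foldr (fun i m => if P i then n i + m else m)%N
  0%N s.
  by rewrite unlock.
elim: s => [|i s IHs] /=.
  have [s1 h1 r1] := homog_symfun1; split=> N; rewrite ?big_nil //.
case: ifP => Pi; last by case: IHs => s1 h1 r1; split=> N; rewrite !big_cons Pi.
by have [s1 h1 r1] := homog_symfunM (hF i Pi) IHs; split=> N; rewrite !big_cons Pi.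
Qed.

Lemma word_sum_homog (T : finType) (pos : T -> nat) (W : {set T * T} -> K) N :
  word_sum pos W N \is #|T|.-homog.
Proof.
apply: rpred_sum => s _; apply: rpredZ.
have -> : \prod_u 'X_(s u) = 'X_[\sum_u U_(s u)] :> {mpoly K[N]} by rewrite mprodXE.
rewrite dhomogX /= mdeg_sum; under eq_bigr do rewrite mdeg1.
by rewrite sum1_card.
Qed.

(** Fillings using the largest letter vanish, and the inversion set of the others does not depend on
    the size of the alphabet. *)
Lemma word_sum_restr (T : finType) (pos : T -> nat) (W : {set T * T} -> K) N :
  restr (word_sum pos W N.+1) = word_sum pos W N.
Proof.
rewrite /word_sum rmorph_sum /=.
rewrite (bigID (fun s : {ffun T -> 'I_N.+1} => [forall u,
  s u != ord_max])) /= [X in _ + X]big1 ?addr0; last first.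
  move=> s /forallPn[u]; rewrite negbK => /eqP su.
  by rewrite restrZ rmorph_prod /= (bigD1 u) //= restrXU su drop_last_max mul0r scaler0.
(* With an empty alphabet the inverse reindexing has no default letter; the sum has one term if [T]
   is empty and none otherwise. *)
case: N => [|N].
  have [/card0_eq T0|/card_gt0P[u _]] := posnP #|T|.
    have i0 (A : Type) (s1 s2 : {ffun T -> A}) : s1 = s2 by apply/ffunP => u; have := T0 u.
    pose s0 n : {ffun T -> 'I_n} := ffun0 (eq_card0 T0).
    rewrite !(big_pred1 (s0 _)).
    - rewrite restrZ rmorph_prod /= !big_pred0 //; congr (W _ *: _).
      by apply/setP => -[u]; have := T0 u.
    - by move=> s /=; apply/esym/eqP/i0.
    move=> s /=; apply/forallP/eqP => [_|_ u]; first exact: i0.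
    by have := T0 u.
  rewrite !big1 //; first by move=> s; case: (s u).
  by move=> s /forallP/(_ u); case: (s u) => -[|m] ltm //; rewrite -val_eqE.
pose up (s : {ffun T -> 'I_N.+1}) := [ffun u => lift ord_max (s u)].
have upK s u : restr ('X_(up s u) : {mpoly K[N.+2]}) = 'X_(s u).
  by rewrite restrXU ffunE /drop_last liftK.
rewrite (reindex_onto up (fun s => [ffun u => odflt ord0 (unlift ord_max (s u))])) /=.
  apply: eq_big => s; last first.
    move=> _; rewrite restrZ rmorph_prod /=; congr (W _ *: _); last by apply: eq_bigr => u _.
    have lv u : lift ord_max (s u) = s u :> nat by rewrite /= /bump leqNgt ltn_ord.
    by apply/setP => e; rewrite !inE !ffunE !lv.
  apply/andP; split; first by apply/forallP => u; rewrite ffunE eq_sym neq_lift.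
  by apply/eqP/ffunP => u; rewrite !ffunE liftK.
move=> s /forallP ns; apply/ffunP => u; rewrite !ffunE.
by case: (unliftP ord_max (s u)) => [j ->|e] //; have := ns u; rewrite e eqxx.
Qed.

Lemma homog_symfun_word_sum (T : finType) (pos : T -> nat) (W : {set T * T} -> K) :
  (forall N, word_sum pos W N \is symmetric) -> homog_symfun #|T| (word_sum pos W).
Proof.
by move=> sW; split=> // N; [apply: word_sum_homog|apply: word_sum_restr].
Qed.

End HomogSymfun.

(** * Coefficients at partitions *)

Section PartitionCoefficients.
Variable K : comNzRingType.
Implicit Types (f : family K) (mu : seq nat).

Definition seq_mnm mu N : 'X_{1.. N} := [multinom nth 0%N mu i | i < N].

(** The coefficient of the monomial symmetric function of [mu]: for a compatible family, any number
    of variables from [size mu] on gives the same value. *)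
Definition pcoef f mu : K := (f (size mu))@_(seq_mnm mu (size mu)).

Definition mnm_part N (m : 'X_{1.. N}) : seq nat := sort geq [seq x <- m | (0 < x)%N].

Lemma geq_trans : transitive geq.
Proof. by move=> a b c; rewrite /geq /= => ??; apply: leq_trans; eassumption. Qed.

Lemma geq_total : total geq.
Proof. by move=> a b; rewrite /geq /= leq_total. Qed.

Lemma mnm_partP N (m : 'X_{1.. N}) :
  [/\ is_part (mnm_part m), sumn (mnm_part m) = mdeg m & (size (mnm_part m) <= N)%N].
Proof.
have pm : perm_eq (mnm_part m) [seq x <- m | (0 < x)%N] by rewrite perm_sort.
split.
- rewrite /is_part (sort_sorted geq_total) /=; apply/negP.
  by rewrite (perm_mem pm) mem_filter.
- rewrite (perm_sumn pm) /mdeg sumnE big_filter [RHS](bigID (fun x => 0 < x)%N) /=.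
  by rewrite [X in _ = (_ + X)%N]big1 ?addn0 // => i; rewrite lt0n negbK => /eqP.
by rewrite (perm_size pm) size_filter -[X in (_ <= X)%N](size_tuple m) count_size.
Qed.

Lemma pcoef_stable n f mu N : homog_symfun n f -> (size mu <= N)%N ->
  (f N)@_(seq_mnm mu N) = pcoef f mu.
Proof.
move=> [_ _ rf] /subnK; move: (N - size mu)%N => k; elim: k N => [|k IHk] N <- //=.
rewrite -(IHk _ erefl) -(rf (k + size mu)%N) restr_coef; congr (mcoeff _ _); apply/mnmP => i;
  rewrite mnmE.
case: (unliftP ord_max i) => [j ->|->].
  have -> : lift ord_max j = widen_ord (leqnSn _) j.
    by apply: val_inj; rewrite /= /bump leqNgt ltn_ord.
  by rewrite mnmwiden_widen mnmE.
by rewrite mnmwiden_ordmax nth_default // leq_addl.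
Qed.

Lemma mkseq_nth_pad mu N : (size mu <= N)%N ->
  mkseq (nth 0%N mu) N = mu ++ nseq (N - size mu) 0%N.
Proof.
move=> le; apply: (@eq_from_nth _ 0%N); first by rewrite size_mkseq size_cat size_nseq subnKC.
move=> i; rewrite size_mkseq => lti; rewrite nth_mkseq // nth_cat nth_nseq if_same.
by case: ltnP => // /(nth_default _)->.
Qed.

(** Symmetry allows the exponents to be permuted into decreasing order with the zeros at the end. *)
Lemma mcoeff_part n f N m : homog_symfun n f -> (f N)@_m = pcoef f (mnm_part m).
Proof.
move=> hf; have [_ _ szm] := mnm_partP m; rewrite -(pcoef_stable hf szm).
have szt : size (mkseq (nth 0%N (mnm_part m)) N) == N by rewrite size_mkseq.
have pm : perm_eq m (Tuple szt).
  rewrite /= mkseq_nth_pad // -(perm_filterC (fun x => 0 < x)%N m).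
  have -> : [seq x <- m | predC (fun x => 0 < x)%N x] = nseq (N - size (mnm_part m)) 0%N.
    rewrite size_sort size_filter -[X in (X - _)%N](size_tuple m) -(count_predC (fun x => 0 < x)%N
      m) addKn.
    rewrite -size_filter; apply/all_pred1P/allP => x.
    by rewrite mem_filter /= -eqn0Ngt => /andP[].
  by rewrite perm_cat2r perm_sym perm_sort.
have /tuple_permP[s es] := pm.
have [sf _ _] := hf.
rewrite {1}(_ : m = [multinom seq_mnm (mnm_part m) N (s i) | i < N]).
  by rewrite -mcoeff_sym (issymP _ (sf N)).
apply/mnmP => i; rewrite !mnmE /fun_of_multinom (tnth_nth 0%N) es -tnth_nth tnth_mktuple.
by rewrite (tnth_nth 0%N) /= nth_mkseq.
Qed.

Lemma homog_symfun_eq0 n f : homog_symfun n f ->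
  (forall mu, is_part mu -> sumn mu = n -> pcoef f mu = 0) -> forall N, f N = 0.
Proof.
move=> hf f0 N; apply/mpolyP => m; rewrite mcoeff0.
have [_ hom _] := hf.
case: (eqVneq (mdeg m) n) => [dm|ne]; last exact: dhomog_nemf_coeff (hom N) ne.
by have [pm sm _] := mnm_partP m; rewrite (mcoeff_part _ hf) f0 // sm.
Qed.

(** A partition of [n] has at most [n] parts, each at most [n], so it arises from an [n]-tuple by
    deleting zeros and sorting. *)
Definition partitions n : seq (seq nat) :=
  [seq mu <- undup [seq sort geq [seq x <- [seq val i | i <- tval t] | (0 < x)%N] | t : n.-tuple
    'I_n.+1]
     | is_part mu && (sumn mu == n)].

Lemma mem_partitions n mu : (mu \in partitions n) = is_part mu && (sumn mu == n).
Proof.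
rewrite mem_filter; apply: andb_idr => /andP[/andP[smu n0] /eqP smn].
rewrite mem_undup; apply/mapP.
have pos x : x \in mu -> (0 < x)%N by case: x => // x0; rewrite x0 in n0.
have szm : (size mu <= n)%N.
  rewrite -smn; elim: (mu) pos => //= x s IHs pos.
  rewrite -add1n leq_add ?pos ?mem_head // IHs // => y ys; apply: pos; by rewrite inE ys orbT.
have lem x : x \in mu -> (x <= n)%N.
  by move=> xm; rewrite -smn (perm_sumn (perm_to_rem xm)) leq_addr.
pose s : seq 'I_n.+1 := map inord (mu ++ nseq (n - size mu) 0%N).
have szs : size s == n by rewrite size_map size_cat size_nseq subnKC.
exists (Tuple szs); first by rewrite mem_enum.
rewrite /= -map_comp map_id_in; last first.
  move=> x; rewrite mem_cat => /orP[/lem|]; first by move=> lx /=; rewrite inordK.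
  by rewrite mem_nseq => /andP[_ /eqP->] /=; rewrite inordK.
rewrite filter_cat (@eq_in_filter _ _ predT mu); last by move=> x /pos->.
rewrite filter_predT (@eq_in_filter _ _ pred0 (nseq _ _)); last first.
  by move=> x; rewrite mem_nseq => /andP[_ /eqP->].
rewrite filter_pred0 cats0 sorted_sort //; exact: geq_trans.
Qed.

Lemma uniq_partitions n : uniq (partitions n).
Proof. by rewrite filter_uniq // undup_uniq. Qed.

End PartitionCoefficients.

(** * Expansions in triangular families *)

Section Expansion.
Variables (K : fieldType) (b : seq nat -> family K) (key : seq nat -> nat).
Hypothesis homog_b : forall la, is_part la -> homog_symfun (sumn la) (b la).
Hypothesis pcoef_b_neq0 : forall la, is_part la -> pcoef (b la) la != 0.
Hypothesis pcoef_b_key : forall la mu, is_part la -> is_part mu -> sumn mu = sumn la ->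
  pcoef (b la) mu != 0 -> mu = la \/ (key la < key mu)%N.

(* Induction on the key: subtracting a combination of the b mu with minimal key
   increases the minimal key of the partitions where f has a nonzero coefficient. *)
Lemma expansion_exists n (f : family K) : homog_symfun n f ->
  exists s : seq (K * seq nat),
    all (fun p => is_part p.2 && (sumn p.2 == n)) s /\ forall N, f N = \sum_(p <- s) p.1 *: b p.2 N.
Proof.
pose m := \max_(mu <- partitions n) (key mu).+1.
suff main k f' : (k <= m)%N -> homog_symfun n f' ->
    (forall mu, is_part mu -> sumn mu = n -> (key mu < m - k)%N -> pcoef f' mu = 0) ->
    exists s : seq (K * seq nat), all (fun p => is_part p.2 && (sumn p.2 == n)) s /\
      forall N, f' N = \sum_(p <- s) p.1 *: b p.2 N.
  by move=> hf; apply: (main m) => // mu; rewrite subnn.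
elim: k f' => [|k IHk] {}f le hf f0.
  exists [::]; split=> // N; rewrite big_nil; apply: (homog_symfun_eq0 hf) => mu pmu smu.
  apply: f0 => //; rewrite subn0 /m.
  have mem : mu \in partitions n by rewrite mem_partitions pmu smu eqxx.
  by rewrite (big_rem mu) //= leq_max leqnn.
(* The layer of smallest key: subtracting its terms cancels the coefficients there and otherwise
   alters only those of larger key. *)
pose L := [seq mu <- partitions n | key mu == (m - k.+1)%N].
pose c mu := pcoef f mu / pcoef (b mu) mu.
pose g N := \sum_(mu <- L) c mu *: b mu N.
have inL mu : (mu \in L) = [&& key mu == (m - k.+1)%N, is_part mu & sumn mu == n].
  by rewrite mem_filter mem_partitions.
have hg : homog_symfun n g.
  pose b' mu N := if mu \in L then c mu *: b mu N else 0.
  have eg N : g N = \sum_(mu <- L | mu \in L) b' mu N.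
    by rewrite /g big_seq; apply: eq_bigr => mu muL; rewrite /b' muL.
  have [] : homog_symfun n (fun N => \sum_(mu <- L | mu \in L) b' mu N).
    apply: homog_symfun_sum => mu muL; rewrite /b' muL.
    have := muL; rewrite inL => /and3P[_ pmu /eqP <-].
    by apply: homog_symfunZ; apply: homog_b.
  by split=> N; rewrite !eg.
have [|||s [sP es]] := IHk (fun N => f N - g N).
- exact: ltnW.
- case: hf hg => [s1 h1 r1] [s2 h2 r2]; split=> N /=; [exact: rpredB (s1 N) (s2 N)|exact: rpredB
  (h1 N) (h2 N)|].
  by rewrite rmorphB /= r1 r2.
- move=> mu pmu smu ltk.
  have -> : pcoef (fun N => f N - g N) mu = pcoef f mu - \sum_(nu <- L) c nu * pcoef (b nu) mu.
    by rewrite /pcoef mcoeffB /g raddf_sum /=; congr (_ - _); apply: eq_bigr => nu _;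
      rewrite mcoeffZ.
  have zero nu : nu \in L -> nu != mu -> (key mu <= m - k.+1)%N -> c nu * pcoef (b nu) mu = 0.
    rewrite inL => /and3P[/eqP knu pnu /eqP snu] ne lek.
    case: (eqVneq (pcoef (b nu) mu) 0) => [->|nz]; first by rewrite mulr0.
    have [e|] := pcoef_b_key pnu pmu (etrans smu (esym snu)) nz; first by rewrite e eqxx in ne.
    by rewrite knu ltnNge lek.
  have lek : (key mu <= m - k.+1)%N by lia.
  case: (boolP (mu \in L)) => muL.
    have uL : uniq L by rewrite filter_uniq // uniq_partitions.
    rewrite (bigD1_seq mu) //= big_seq_cond big1 ?addr0.
      by rewrite divfK ?subrr // pcoef_b_neq0.
    by move=> nu /andP[nuL ne]; apply: zero.
  rewrite big_seq big1 ?subr0.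
    by apply: f0 => //; move: muL; rewrite inL pmu smu eqxx andbT; lia.
  by move=> nu nuL; apply: zero => //; apply: contraNneq muL => <-.
exists (s ++ [seq (c mu, mu) | mu <- L]); split.
  rewrite all_cat sP; apply/allP => _ /mapP[mu muL ->] /=.
  by move: muL; rewrite inL => /and3P[_ -> ->].
by move=> N; rewrite big_cat -es big_map /= subrK.
Qed.

End Expansion.

Section FiniteSupport.
Variable b : seq nat -> symfun.

Lemma expands_seq (f : symfun) (s : seq (Qqt * seq nat)) :
    all (fun p => is_part p.2) s -> (forall N, f N = \sum_(p <- s) p.1 *: b p.2 N) ->
  exists c, expands b f c.
Proof.
move=> /allP sP fE; pose S := [fset p.2 | p in s]%fset.
pose g la := \sum_(p <- s | p.2 == la) p.1.
pose c : {fsfun seq nat -> Qqt with 0} := [fsfun la in S => g la].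
exists c; split.
  move=> la /(fsubsetP (finsupp_sub _ _ _)) /imfsetP[p /= ps ->]; exact: sP.
move=> N; rewrite fE.
have sub : (finsupp c `<=` S)%fset by apply: finsupp_sub.
rewrite (big_fset_incl _ sub) /=; last first.
  by move=> la _; rewrite memNfinsupp => /eqP->; rewrite scale0r.
rewrite (eq_big_seq (fun la => g la *: b la N)); last by move=> la laS; rewrite fsfunE laS.
rewrite /g; under [RHS]eq_bigr do rewrite scaler_suml.
rewrite (exchange_big_dep predT) //= big_seq [RHS]big_seq; apply: eq_bigr => p ps.
have pS : p.2 \in S by apply/imfsetP; exists p.
rewrite big_mkcond (bigD1_seq p.2) ?fset_uniq //= eqxx big1 ?addr0 // => la ne.
by rewrite eq_sym (negbTE ne).
Qed.

End FiniteSupport.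

Lemma uniq_boxes la : uniq (boxes la).
Proof.
apply: allpairs_uniq_dep; first exact: iota_uniq.
  by move=> j _; apply: iota_uniq.
by move=> [j i] [j' i'] /= _ _ [-> ->].
Qed.

Lemma big_box (R : Type) (idx : R) (op : Monoid.com_law idx) la (F : nat -> nat -> R) :
  \big[op/idx]_(u : box la) F (bcol u) (brow u) =
  \big[op/idx]_(0 <= j < size la) \big[op/idx]_(0 <= i < nth 0%N la j) F i j.
Proof.
pose G (p : nat * nat) := F p.1 p.2.
have pm : perm_eq [seq ssval u | u : box la] (boxes la).
  apply: uniq_perm; [by rewrite map_inj_uniq ?enum_uniq //; apply: val_inj|exact: uniq_boxes|].
  move=> p; apply/mapP/idP => [[u _ ->]|pb]; first exact: ssvalP.
  by exists (SeqSub pb) => //; rewrite mem_enum.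
rewrite -[LHS]big_enum /= -(big_map (@ssval _ _) predT G) (perm_big _ pm) /= /boxes
  big_allpairs_dep.
by rewrite {1}/index_iota subn0; apply: eq_bigr => j _; rewrite /index_iota subn0.
Qed.

Lemma sumn_nth (s : seq nat) : sumn s = (\sum_(0 <= j < size s) nth 0 s j)%N.
Proof. by rewrite sumnE (big_nth 0%N). Qed.

Lemma card_box la : #|box la| = sumn la.
Proof.
rewrite -sum1_card sumn_nth (big_box _ la (fun _ _ => 1%N)).
by apply: eq_bigr => j _; rewrite sum_nat_const_nat subn0 muln1.
Qed.

Lemma card_row la j : #|[set u : box la | brow u == j]| = nth 0%N la j.
Proof.
rewrite -sum1dep_card big_mkcond (big_box _ la (fun _ j' => if j' == j then 1 else 0)%N) /=.
rewrite (eq_bigr (fun j' => if j' == j then nth 0 la j else 0)%N) => [|j' _]; last first.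
  by case: eqP => [->|_]; rewrite sum_nat_const_nat subn0 ?muln1 ?muln0.
case: (ltnP j (size la)) => [ltj|lej]; last first.
  rewrite nth_default //; rewrite big1 // => i _; by case: ifP.
rewrite big_mkord (bigD1 (Ordinal ltj)) //= eqxx big1 ?addn0 // => i ne.
by rewrite ifN.
Qed.

Lemma part_eq la mu : is_part la -> is_part mu -> nth 0%N la =1 nth 0%N mu -> la = mu.
Proof.
move=> /andP[_ la0] /andP[_ mu0] e.
have szle s s' : (0%N \notin s) -> nth 0%N s =1 nth 0%N s' -> (size s <= size s')%N.
  move=> s0 es; rewrite leqNgt; apply: contra s0 => lt.
  by rewrite -(nth_default 0%N (leqnn (size s'))) -es mem_nth.
apply: (@eq_from_nth _ 0%N) => [|i _]; last exact: e.
apply/eqP; rewrite eqn_leq !szle //; by move=> i; rewrite e.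
Qed.

Lemma homog_symfun_ext (K : comNzRingType) n (f g : family K) :
  (forall N, f N = g N) -> homog_symfun n f -> homog_symfun n g.
Proof. by move=> e [s h r]; split=> N; rewrite -!e. Qed.

Lemma homog_schur la : is_part la -> homog_symfun (sumn la) (schur la : family Qqt).
Proof.
move=> pla; rewrite -card_box; apply: homog_symfun_ext (fun N => esym (schurE pla N)) _.
by apply: homog_symfun_word_sum => N; apply: word_semistandard_sym.
Qed.

Lemma homog_macdonald la : is_part la -> homog_symfun (sumn la) (macdonaldH la : family Qqt).
Proof.
move=> pla; rewrite -card_box; apply: homog_symfun_ext (fun N => esym (macdonaldHE pla N)) _.
by apply: homog_symfun_word_sum => N; rewrite -macdonaldHE //; apply: macdonald_sym.
Qed.

(** * Triangularity of Schur functions *)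

Section SchurTriangular.
Variables la mu : seq nat.
Hypotheses (pla : is_part la) (pmu : is_part mu).

Definition content N (sg : filling la N) : 'X_{1.. N} := (\sum_u U_(sg u))%MM.

Lemma contentE N (sg : filling la N) i : content sg i = #|[set u | sg u == i]|.
Proof.
rewrite mnm_sumE -sum1dep_card [RHS]big_mkcond; apply: eq_bigr => u _.
by rewrite mnm1E; case: eqP.
Qed.

(** The coefficient is the Kostka number. *)
Lemma pcoef_schur : pcoef (schur la : family Qqt) mu =
  #|[set sg : filling la (size mu) | semistandard sg && (content sg == seq_mnm mu (size mu))]|%:R.
Proof.
rewrite /pcoef /schur raddf_sum /= -sum1dep_card natr_sum big_mkcondr.
by apply: eq_bigr => sg _; rewrite /monomial mprodXE mcoeffX; case: eqP.
Qed.

(** The statistic usually written n(mu), a numerical substitute for the dominance order. *)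
Definition weight_key (s : seq nat) : nat := \sum_(0 <= i < size s) (i * nth 0 s i)%N.

Lemma weight_key_box : weight_key la = (\sum_(u : box la) brow u)%N.
Proof.
rewrite (big_box _ la (fun _ j => j)); apply: eq_bigr => j _.
by rewrite sum_nat_const_nat subn0 mulnC.
Qed.

Lemma weight_key_content (sg : filling la (size mu)) :
  content sg = seq_mnm mu (size mu) -> weight_key mu = (\sum_u sg u)%N.
Proof.
move=> csg; rewrite /weight_key big_mkord.
rewrite (partition_big sg predT) //=; apply: eq_bigr => i _.
rewrite (eq_bigr (fun=> i : nat)) => [|u /eqP->//].
rewrite sum_nat_cond_const mulnC; congr (_ * _)%N.
by have := contentE sg i; rewrite csg mnmE => ->.
Qed.

Lemma semistandard_brow N (sg : filling la N) u : semistandard sg -> (brow u <= sg u)%N.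
Proof.
case/semistandardP => _ H2.
suff main j v : brow v = j -> (j <= sg v)%N by apply: main.
elim: j v => {u}// j IHj u eu.
have lt : (sg (lower u) < sg u)%N by apply: H2; rewrite /below bcol_lower // brow_lower // eqxx eu
  /=.
by apply: leq_ltn_trans lt; apply: IHj; rewrite brow_lower // eu.
Qed.

(* A semistandard filling has at least j (counting from 0) in row j. *)
Lemma pcoef_schur_key : pcoef (schur la : family Qqt) mu != 0 ->
  mu = la \/ (weight_key la < weight_key mu)%N.
Proof.
rewrite pcoef_schur natrQqt_eq0 -lt0n card_gt0 => /set0Pn[sg].
rewrite in_set => /andP[ss /eqP csg].
rewrite weight_key_box (weight_key_content csg).
have le u := semistandard_brow u ss.
case: (boolP [forall u, brow u == sg u]) => [/forallP e|/forallPn[u ne]].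
  left; apply: part_eq => // i; rewrite -(card_row la).
  case: (ltnP i (size mu)) => [lti|lei].
    have := contentE sg (Ordinal lti); rewrite csg mnmE /= => ->.
    by apply: eq_card => u; rewrite !inE (eqP (e u)).
  rewrite nth_default //; apply/esym/eq_card0 => u; rewrite !inE (eqP (e u)).
  by apply/negbTE; rewrite neq_ltn (leq_trans (ltn_ord _) lei).
right; rewrite (bigD1 u) //= [X in (_ < X)%N](bigD1 u) //= -addSn leq_add //.
  by rewrite ltn_neqAle ne le.
by apply: leq_sum.
Qed.

End SchurTriangular.

Lemma pcoef_schur_neq0 la : is_part la -> pcoef (schur la : family Qqt) la != 0.
Proof.
move=> pla; rewrite pcoef_schur natrQqt_eq0 -lt0n card_gt0; apply/set0Pn.
pose sg : filling la (size la) := [ffun u => Ordinal (brow_bound u)].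
exists sg; rewrite in_set; apply/andP; split.
  apply/semistandardP; split=> u v; rewrite !ffunE /=.
    by case/andP=> /eqP->.
  by case/andP.
apply/eqP/mnmP => i; rewrite contentE mnmE -card_row.
by apply: eq_card => u; rewrite !inE ffunE -val_eqE.
Qed.

Lemma schur_expansion n (f : symfun) : homog_symfun n (f : family Qqt) -> exists c,
  expands schur f c.
Proof.
move=> hf; have [s [sP fE]] := expansion_exists homog_schur pcoef_schur_neq0
  (fun la mu pla pmu _ => @pcoef_schur_key la mu pla pmu) hf.
apply: (expands_seq (s := s)) => //; apply: sub_all sP; by move=> p /andP[].
Qed.

Lemma msym_sum_XU (K : comNzRingType) N k : (\sum_(i < N) 'X_i ^+ k : {mpoly K[N]}) \is symmetric.
Proof.
apply/issymP => s; rewrite raddf_sum /= (reindex_inj (@perm_inj _ s)) /=.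
rewrite [RHS](reindex_inj (@perm_inj _ s)) [RHS](reindex_inj (@perm_inj _ s)) /=.
by apply: eq_bigr => i _; rewrite rmorphXn /= msymXU.
Qed.

Lemma homog_power_sum (K : comNzRingType) k : (0 < k)%N ->
  homog_symfun k (fun N => \sum_(i < N) 'X_i ^+ k : {mpoly K[N]}).
Proof.
move=> k0; split=> N /=; first exact: msym_sum_XU.
  by apply: rpred_sum => i _; rewrite mpolyXn dhomogX /= mdegMn mdeg1 mul1n.
rewrite rmorph_sum /= big_ord_recr /= rmorphXn /= restrXU drop_last_max expr0n gtn_eqF // addr0.
by apply: eq_bigr => i _; rewrite rmorphXn /= restrXU drop_last_widen.
Qed.

Lemma homog_powersum la : is_part la -> homog_symfun (sumn la) (powersum la : family Qqt).
Proof.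
case/andP=> _ la0; rewrite sumnE big_seq.
pose F k N : {mpoly Qqt[N]} := \sum_(i < N) 'X_i ^+ k.
apply: (@homog_symfun_ext _ _ (fun N => \prod_(k <- la | k \in la) F k N)).
  by move=> N; rewrite /powersum [RHS]big_seq.
apply: (@homog_symfun_prod _ _ la (fun k => k \in la) id F) => k kla; apply: homog_power_sum.
by case: k kla => // k0; rewrite k0 in la0.
Qed.

(** * Triangularity of power sums *)

Section PowersumTriangular.
Variables la mu : seq nat.
Hypotheses (pla : is_part la) (pmu : is_part mu).

(** The ways to merge the parts of [la] into the parts of [mu]; each is a choice of one variable per
    factor that produces the monomial of [mu]. *)
Definition merge_of (phi : {ffun 'I_(size la) -> 'I_(size mu)}) : bool :=
  [forall i, \sum_(j | phi j == i) nth 0 la j == nth 0 mu i]%N.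

Lemma pcoef_powersum : pcoef (powersum la : family Qqt) mu = #|merge_of|%:R.
Proof.
rewrite /pcoef /powersum (big_nth 0%N) big_mkord bigA_distr_bigA /= raddf_sum /=.
rewrite -sum1_card natr_sum [RHS]big_mkcond; apply: eq_bigr => phi _.
rewrite (eq_bigr (fun j => 'X_[U_(phi j) *+ nth 0%N la j])) => [|j _]; last by rewrite mpolyXn.
rewrite mprodXE mcoeffX.
rewrite (_ : (_ == _) = (phi \in merge_of)); first by case: ifP.
apply/eqP/forallP => [e i|e].
  have := congr1 (fun m : 'X_{1.. size mu} => m i) e; rewrite mnmE mnm_sumE => <-.
  rewrite big_mkcond; apply/eqP; apply: eq_bigr => j _; rewrite mulmnE mnm1E.
  by case: eqP; rewrite ?mul1n ?mul0n.
apply/mnmP => i; rewrite mnmE mnm_sumE -(eqP (e i)) [RHS]big_mkcond; apply: eq_bigr => j _.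
by rewrite mulmnE mnm1E; case: eqP; rewrite ?mul1n ?mul0n.
Qed.

(** Merging two positive parts increases the sum of squares by the cross terms. *)
Definition square_key (s : seq nat) : nat := \sum_(i < size s) (nth 0 s i ^ 2)%N.

Lemma part_gt0 s i : is_part s -> (i < size s)%N -> (0 < nth 0 s i)%N.
Proof.
by case/andP=> _ s0 lti; rewrite lt0n; apply: contraNneq s0 => <-; apply: mem_nth.
Qed.

Lemma pcoef_powersum_key : pcoef (powersum la : family Qqt) mu != 0 ->
  mu = la \/ (square_key la < square_key mu)%N.
Proof.
rewrite pcoef_powersum natrQqt_eq0 -lt0n => /card_gt0P[phi /forallP ephi].
pose a (j : 'I_(size la)) := nth 0%N la j.
have a0 j : (0 < a j)%N by apply: part_gt0.
have sq : square_key mu = (\sum_j \sum_(j' | phi j' == phi j) a j * a j')%N.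
  rewrite /square_key; rewrite [RHS](partition_big phi predT) //=; apply: eq_bigr => i _.
  rewrite -(eqP (ephi i)) -mulnn big_distrl /=; apply: eq_bigr => j /eqP ej.
  by rewrite big_distrr /=; apply: eq_bigl => j'; rewrite ej.
have [inj|ninj] := boolP (injectiveb phi).
  left; have {}inj := injectiveP _ inj.
  have nmu j : nth 0%N mu (phi j) = nth 0%N la j.
    rewrite -(eqP (ephi (phi j))) (big_pred1 j) // => j'.
    by rewrite /= (inj_eq inj).
  have surj i : i \in codom phi.
    apply/negPn/negP => ni; have := part_gt0 pmu (ltn_ord i).
    rewrite -(eqP (ephi i)) big_pred0 // => j; apply/negbTE; apply: contraNneq ni => <-.
    exact: codom_f.
  have pp : perm_eq mu la.
    have tab (s : seq nat) : s = [seq nth 0%N s i | i : 'I_(size s)].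
      apply: (@eq_from_nth _ 0%N) => [|i lti]; first by rewrite size_map size_enum_ord.
      by rewrite (nth_map (Ordinal lti)) ?size_enum_ord // nth_enum_ord.
    have pe : perm_eq (enum 'I_(size mu)) [seq phi j | j <- enum 'I_(size la)].
      apply: uniq_perm; [exact: enum_uniq|by rewrite map_inj_uniq // enum_uniq|].
      by move=> i; rewrite mem_enum; have := surj i; rewrite /image_mem => ->.
    pose g (i : 'I_(size mu)) := nth 0%N mu i.
    have := perm_map g pe; have -> : map g (enum 'I_(size mu)) = mu by rewrite [RHS]tab.
    have -> : map g [seq phi j | j <- enum 'I_(size la)] = la; last by [].
    by rewrite -map_comp [RHS]tab; apply: eq_map => j; rewrite /= /g nmu.
  have [/andP[smu _] /andP[sla _]] := (pmu, pla).
  apply: (sorted_eq geq_trans _ smu sla pp) => x y /andP[le1 le2]; apply/eqP; rewrite eqn_leq.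
  by apply/andP.
right; rewrite sq /square_key.
have /injectivePn[j1 [j2 ne ej]] := ninj.
have le j : (a j ^ 2 <= \sum_(j' | phi j' == phi j) a j * a j')%N.
  by rewrite (bigD1 j) //= mulnn leq_addr.
rewrite (bigD1 j1) //= [X in (_ < X)%N](bigD1 j1) //= -addSn leq_add //;
  last by apply: leq_sum => j _; apply: le.
rewrite (bigD1 j1) //= (bigD1 j2) ?ej ?eqxx 1?eq_sym //= mulnn -addn1 leq_add2l.
by rewrite ltn_addr // muln_gt0 !a0.
Qed.

End PowersumTriangular.

Lemma pcoef_powersum_neq0 la : is_part la -> pcoef (powersum la : family Qqt) la != 0.
Proof.
move=> pla; rewrite pcoef_powersum natrQqt_eq0 -lt0n; apply/card_gt0P.
exists [ffun i => i]; apply/forallP => i; rewrite (big_pred1 i) // => j.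
by rewrite ffunE.
Qed.

Lemma powersum_expansion n (f : symfun) : homog_symfun n (f : family Qqt) -> exists c,
  expands powersum f c.
Proof.
move=> hf; have [s [sP fE]] := expansion_exists homog_powersum pcoef_powersum_neq0
  (fun la mu pla pmu _ => @pcoef_powersum_key la mu pla pmu) hf.
apply: (expands_seq (s := s)) => //; apply: sub_all sP; by move=> p /andP[].
Qed.

(** * Interpolation in the number of variables *)

Section BinomialForm.
Variable L : comNzRingType.
Implicit Types c : {poly L}.

(* The coefficients of c are taken in the basis of binomial coefficients, so
   that the value at -1 is c.[-1]. *)
Definition binval c N : L := \sum_(l < size c) c`_l * 'C(N, l)%:R.

Lemma binvalE c N m : (size c <= m)%N -> binval c N = \sum_(l < m) c`_l * 'C(N, l)%:R.
Proof.
move=> le; rewrite -!(big_mkord predT (fun l => c`_l * 'C(N, l)%:R)).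
rewrite [RHS](big_cat_nat (n := size c)) //= [X in _ + X]big_nat_cond [X in _ + X]big1 ?addr0
  ?big_mkord //.
by move=> l /andP[/andP[lel _] _]; rewrite nth_default ?mul0r.
Qed.

Lemma binvalD c1 c2 N : binval (c1 + c2) N = binval c1 N + binval c2 N.
Proof.
have le := size_polyD c1 c2.
rewrite (binvalE _ le) (binvalE N (leq_maxl _ (size c2))) (binvalE N (leq_maxr (size c1) _)).
by rewrite -big_split; apply: eq_bigr => l _; rewrite coefD mulrDl.
Qed.

Lemma binvalZ a c N : binval (a *: c) N = a * binval c N.
Proof.
rewrite (binvalE _ (size_scale_leq a c)) /binval mulr_sumr; apply: eq_bigr => l _.
by rewrite coefZ mulrA.
Qed.

Lemma binval_sum (I : finType) (P : pred I) (F : I -> {poly L}) N :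
  binval (\sum_(i | P i) F i) N = \sum_(i | P i) binval (F i) N.
Proof.
apply: (big_morph (binval^~ N)); first by move=> c1 c2; apply: binvalD.
by rewrite /binval size_poly0 big_ord0.
Qed.

Lemma size_MXaddC_leq c a : (size (c * 'X + a%:P)%R <= (size c).+1)%N.
Proof. by rewrite size_MXaddC; case: ifP. Qed.

Lemma binval_MXaddC0 c a : binval (c * 'X + a%:P) 0 = a.
Proof.
rewrite (binvalE _ (size_MXaddC_leq c a)) big_ord_recl /= coefD coefMX coefC /= add0r bin0 mulr1.
by rewrite big1 ?addr0 // => l _; rewrite bin0n mulr0.
Qed.

(** Pascal's rule: in the binomial basis multiplication by ['X] inverts the difference operator in
    [N], and the constant term is the value at 0. *)
Lemma binval_MXaddCS c a N :
  binval (c * 'X + a%:P) N.+1 = binval (c * 'X + a%:P) N + binval c N.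
Proof.
rewrite !(binvalE _ (size_MXaddC_leq c a)) !big_ord_recl /= !bin0 -addrA; congr (_ + _).
rewrite /binval -big_split /=; apply: eq_bigr => l _.
by rewrite coefD coefMX coefC /= addr0 binS natrD mulrDr.
Qed.

End BinomialForm.

(** * Removal of the largest letter *)

Section Interpolation.
Variables (L : comNzRingType) (T : finType) (pos : T -> nat) (u : L).
Implicit Types (C A B D : {set T}) (W : {set T * T} -> L).

(** For [B] disjoint from [A]: the inversions in [C] of a filling with the largest letter on [A],
    letters strictly decreasing along [B] in reading order, and the smallest letter elsewhere. *)
Definition out_pairs C A B : {set T * T} :=
  [set e in setX C C | [&& (pos e.1 < pos e.2)%N, e.1 \in A :|: B & e.2 \notin A]].

(* Moving the first element of A :|: B from A to B or back changes the sign. *)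
Lemma toggle_sum C W :
  \sum_(A : {set T} | A \subset C) \sum_(B : {set T} | B \subset C :\: A)
     u ^+ #|A| * ((- u) ^+ #|B| * W (out_pairs C A B)) = W set0.
Proof.
pose G A D := u ^+ #|A| * ((- u) ^+ #|D :\: A| * W (out_pairs C A (D :\: A))).
transitivity (\sum_(A : {set T} | A \subset C) \sum_(D : {set T} | (A \subset D) && (D \subset C))
  G A D).
  apply: eq_bigr => A sA.
  rewrite [RHS](reindex_onto (fun B => A :|: B) (fun D => D :\: A)) /=; last first.
    by move=> D /andP[sAD _]; rewrite setDE setUIr setUCr setIT; apply/setUidPr.
  apply: eq_big => B.
    rewrite subsetUl subUset sA /= setDUl setDv set0U.
    by rewrite subsetD; congr (_ && _); apply/setDidPl/eqP.
  move=> sB; rewrite /G; suff -> : (A :|: B) :\: A = B by [].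
  rewrite setDUl setDv set0U; apply/setDidPl; by move: sB; rewrite subsetD => /andP[].
rewrite (exchange_big_dep (fun D => D \subset C)) /=; last by move=> A D _ /andP[].
rewrite (bigD1 set0) ?sub0set //= [X in _ + X]big1 ?addr0.
  rewrite (big_pred1 set0) => [|A /=].
    rewrite /G setD0 cards0 !expr0 !mul1r; congr (W _); apply/setP => e.
    by rewrite !inE /= !andbF.
  by rewrite subset0 andbT; case: eqP => [->|_]; rewrite ?sub0set ?andbF.
move=> D /andP[sDC /set0Pn[d dD]].
case: (arg_minnP pos dD) => m mD0 minm; have mD : m \in D := mD0.
rewrite (eq_bigl (fun A => A \subset D)) => [|A]; last first.
  by rewrite sDC andbT andbC; case: (boolP (A \subset D)) => //= sAD; rewrite (subset_trans sAD).
rewrite (bigID (fun A => m \in A)) /=.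
rewrite (reindex_onto (fun A => m |: A) (fun A => A :\ m)) /=; last first.
  by move=> A /andP[_ mA]; rewrite setD1K.
apply/eqP; rewrite addr_eq0 -sumrN; apply/eqP.
have eqm A : ((m |: A \subset D) && (m \in m |: A)) && ((m |: A) :\ m == A) = (A \subset D) && (m
  \notin A).
  rewrite setU11 andbT subUset sub1set mD /=; case: (boolP (m \in A)) => mA /=;
    last by rewrite setU1K ?eqxx.
  by rewrite andbF; apply/negbTE; apply: contraL mA => /andP[_ /eqP<-]; rewrite !inE eqxx.
apply: eq_big => A; first exact: eqm.
rewrite eqm => /andP[sAD mA].
rewrite /G; set D' := D :\: (m |: A).
have eD : D :\: A = m |: D'.
  apply/setP => p; rewrite !inE; case: (eqVneq p m) => [->|] //=; by rewrite mA mD.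
have mD' : m \notin D' by rewrite !inE eqxx.
have -> : out_pairs C (m |: A) D' = out_pairs C A (D :\: A).
  apply/setP => e; rewrite eD [in LHS]in_set [in RHS]in_set.
  case: (e \in setX C C) => //=; case: (ltnP (pos e.1) (pos e.2)) => //= lt.
  rewrite !in_setU !in_set1 negb_or; case: (eqVneq e.2 m) => [e2|_] /=.
    have nD : e.1 \notin D by apply/negP => e1D; have := minm _ e1D; rewrite leqNgt -e2 lt.
    have nm : e.1 != m by apply: contraNneq nD => ->.
    by rewrite andbF (negbTE nm) (contraNF (subsetP sAD _) nD) /D' in_setD (negbTE nD) andbF.
  by case: (e.1 == m); rewrite ?orbT.
by rewrite eD !cardsU1 mA mD' !add1n !exprS; ring.
Qed.

(** The letter 0 stands for the variable set to 1 and the [N] other letters for the variables set to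
    [u]; positions outside [C] are frozen at 0. The alphabet [M] only serves to give fillings for
    different [N] the same type. *)
Definition valued M C N (s : {ffun T -> 'I_M}) : bool :=
  [forall p, (s p <= N)%N && ((p \notin C) ==> (s p == 0%N :> nat))].

Definition support M (s : {ffun T -> 'I_M}) : {set T} := [set p | s p != 0%N :> nat].

Definition word_eval M C W N : L :=
  \sum_(s : {ffun T -> 'I_M} | valued C N s) W (invs pos s :&: setX C C) * u ^+ #|support s|.

Lemma word_eval0 M C W : word_eval M.+1 C W 0 = W set0.
Proof.
rewrite /word_eval (big_pred1 [ffun=> ord0]) => [|s /=].
  rewrite (_ : support _ = set0) ?cards0 ?mulr1; last first.
    by apply/setP => p; rewrite !inE ffunE eqxx.
  congr (W _); apply/setP => e; rewrite !inE !ffunE ltnn andbF //.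
apply/forallP/eqP => [H|-> p]; last by rewrite ffunE /= implybT.
by apply/ffunP => p; rewrite ffunE; apply: val_inj => /=; have /andP[] := H p;
  rewrite leqn0 => /eqP.
Qed.

(** The inversions between the positions [A] of the largest letter and the later remaining positions
    are absorbed into the weight. *)
Definition top_weight C A W (X : {set T * T}) := W (X :|: [set e in setX C C |
  [&& (pos e.1 < pos e.2)%N, e.1 \in A & e.2 \notin A]]).

Lemma word_evalS M C W N : (N.+1 < M.+1)%N ->
  word_eval M.+1 C W N.+1 =
  \sum_(A : {set T} | A \subset C) u ^+ #|A| * word_eval M.+1 (C :\: A) (top_weight C A W) N.
Proof.
move=> ltNM; pose top : 'I_M.+1 := Ordinal ltNM.
pose lev (s : {ffun T -> 'I_M.+1}) := [set p | s p == top].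
rewrite /word_eval (partition_big lev (fun A => A \subset C)) /=; last first.
  move=> s /forallP H; apply/subsetP => p; rewrite inE => /eqP sp.
  by have /andP[_] := H p; rewrite sp; apply: contraTT => ->.
apply: eq_bigr => A sA; rewrite mulr_sumr.
pose up (s : {ffun T -> 'I_M.+1}) := [ffun p => if p \in A then top else s p].
pose down (s : {ffun T -> 'I_M.+1}) := [ffun p => if p \in A then ord0 else s p].
rewrite (reindex_onto up down) /=; last first.
  move=> s /andP[_ /eqP levs]; apply/ffunP => p; rewrite !ffunE.
  by case: (boolP (p \in A)) => //; rewrite -levs inE => /eqP->.
have dom s : (valued C N.+1 (up s) && (lev (up s) == A)) && (down (up s) == s) = valued (C :\: A) N
  s.
  apply/idP/forallP => [/andP[/andP[/forallP H /eqP levs] /eqP ds] p|H].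
    case: (boolP (p \in A)) => pA.
      by rewrite -ds ffunE pA /= implybT.
    have /andP[le1 im] := H p; move: le1 im; rewrite ffunE (negbTE pA) in_setD pA /= => le1 ->.
    rewrite andbT; move: le1; rewrite leq_eqVlt => /orP[/eqP eN|//].
    by case/negP: pA; rewrite -levs inE ffunE; case: ifP => // _; rewrite -val_eqE /= eN.
  apply/andP; split; first (apply/andP; split).
  - apply/forallP => p; rewrite ffunE; have /andP[le1] := H p; rewrite in_setD.
    case: (boolP (p \in A)) => pA /=; first by rewrite leqnn (subsetP sA).
    by move=> ->; rewrite ltnW.
  - apply/eqP/setP => p; rewrite inE ffunE; case: (boolP (p \in A)) => pA; first exact: eqxx.
    by have /andP[le1 _] := H p; rewrite -val_eqE /= ltn_eqF.
  apply/eqP/ffunP => p; rewrite !ffunE; case: (boolP (p \in A)) => // pA.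
  by have /andP[_] := H p; rewrite in_setD pA /= => /eqP s0; apply: val_inj.
apply: eq_big => [//|s]; rewrite dom => /forallP H.
have supA : support (up s) = A :|: support s.
  apply/setP => p; rewrite in_setU !in_set ffunE; case: (boolP (p \in A)) => //=.
have dA : [disjoint A & support s].
  apply/pred0P => p /=; apply/negP => /andP[pA]; rewrite in_set.
  by have /andP[_] := H p; rewrite in_setD pA /= => ->.
rewrite supA cardsU (disjoint_setI0 dA) cards0 subn0 exprD mulrCA; congr (_ * _).
rewrite /top_weight; congr (W _ * _); apply/setP => e.
rewrite !inE !ffunE; case: (ltnP (pos e.1) (pos e.2)) => //= lt; rewrite ?andbF //.
have leN p : (s p < N.+1)%N by rewrite ltnS; have /andP[] := H p.
case: (boolP (e.1 \in A)) => e1; case: (boolP (e.2 \in A)) => e2;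
  rewrite /= ?ltnn ?leN ?andbF ?andbT ?orbF //.
by rewrite ltnNge ltnW ?leN.
Qed.

(* Removing the positions A that carry the largest letter expresses the
   difference word_eval N.+1 - word_eval N by smaller sets of positions. *)
Lemma interpolation C W : exists c : {poly L},
  (forall M N, (N < M)%N -> word_eval M C W N = binval c N) /\
  c.[-1] = \sum_(B : {set T} | B \subset C) (- u) ^+ #|B| * W (out_pairs C set0 B).
Proof.
have [n] := ubnP #|C|; elim: n C W => // n IHn C W ltC.
have ltA A : (A \subset C) && (A != set0) -> (#|C :\: A| < n)%N.
  move=> /andP[sA nA]; rewrite ltnS in ltC; apply: leq_trans ltC.
  rewrite cardsD (setIidPr sA) ltn_subrL card_gt0 nA /=.
  by apply: leq_trans (subset_leq_card sA); rewrite card_gt0.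
pose P A (c : {poly L}) := (A \subset C) && (A != set0) ->
  (forall M N, (N < M)%N -> word_eval M (C :\: A) (top_weight C A W) N = binval c N) /\
  c.[-1] = \sum_(B : {set T} | B \subset C :\: A)
             (- u) ^+ #|B| * top_weight C A W (out_pairs (C :\: A) set0 B).
have exc A : exists c, P A c.
  case: (boolP ((A \subset C) && (A != set0))) => [hA|nA]; last by exists 0; rewrite /P (negbTE nA).
  by have [c hc] := IHn _ (top_weight C A W) (ltA A hA); exists c.
have [c hc] := fin_all_exists exc.
(* In [word_evalS] the term of the empty set is the value at [N], so the other terms represent the
   difference between consecutive values. *)
pose g := \sum_(A : {set T} | (A \subset C) && (A != set0)) u ^+ #|A| *: c A.
exists (g * 'X + (W set0)%:P); split.
  case=> // M; elim=> [|N IHN] ltN; first by rewrite word_eval0 binval_MXaddC0.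
  rewrite binval_MXaddCS -IHN ?(ltnW ltN) // word_evalS // (bigD1 set0) ?sub0set //=.
  congr (_ + _).
    rewrite cards0 mul1r setD0; apply: eq_bigr => s _; congr (W _ * _).
    by apply/setP => e; rewrite !inE /= !andbF orbF.
  rewrite binval_sum; apply: eq_bigr => A hA; rewrite binvalZ; congr (_ * _).
  by have [-> //] := hc A hA; apply: ltnW.
(* At -1 the value is [W set0] minus that of [g]. By [toggle_sum], [W set0] is a sum over all [A];
   [g] cancels the nonempty ones, and the empty one is the claim. *)
rewrite hornerMXaddC mulrN1 -(toggle_sum C W) addrC; apply/eqP; rewrite subr_eq eq_sym; apply/eqP.
rewrite [RHS](bigD1 set0) ?sub0set //=; congr (_ + _).
  by rewrite setD0 cards0; apply: eq_bigr => B _; rewrite mul1r.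
rewrite horner_sum; apply: eq_bigr => A hA; rewrite hornerZ; have [_ ->] := hc A hA.
rewrite mulr_sumr; apply: eq_bigr => B sB; congr (_ * (_ * W _)).
apply/setP => e; rewrite !inE.
case: (boolP (e.1 \in B)) => [/(subsetP sB)|_]; rewrite ?inE.
  by case/andP=> /negbTE-> ->; case: (e.2 \in A); case: (e.2 \in C); rewrite ?andbF ?andbT ?orbF.
by case: (e.1 \in A); case: (e.2 \in A); case: (e.2 \in C); rewrite /= ?andbF ?andbT ?orbF.
Qed.
End Interpolation.

(** * The polynomial in the number of variables *)

Section Interpolant.
Variable K : fieldType.
Hypothesis natrK : forall n, n.+1%:R != 0 :> K.

Lemma natr_inj m n : m%:R = n%:R :> K -> m = n.
Proof.
wlog le : m n / (m <= n)%N => [hw e|].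
  by case/orP: (leq_total m n) => le; [apply: hw|apply/esym/hw].
move=> e; apply/eqP; rewrite eqn_leq le /= -subn_eq0.
have : (n - m)%:R == 0 :> K by rewrite natrB // e subrr.
by case: (n - m)%N => // k; rewrite (negbTE (natrK k)).
Qed.

Lemma natr_poly_inj m n : m%:R = n%:R :> {poly K} -> m = n.
Proof. by rewrite -!polyC_natr => /polyC_inj/natr_inj. Qed.

(** The binomial coefficient as a polynomial in the number of variables; the inner polynomial ring
    is the one in u. *)
Definition binpoly l : {poly {poly K}} :=
  ((l`!%:R^-1)%:P)%:P * \prod_(i < l) ('X - (i%:R)%:P).

Lemma binpolyN l N : (binpoly l).[N%:R] = 'C(N, l)%:R.
Proof.
have fact0 : l`!%:R != 0 :> K by rewrite -(prednK (fact_gt0 l)).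
rewrite /binpoly hornerM hornerC horner_prod.
have -> : \prod_(i < l) ('X - i%:R%:P).[N%:R] = (N ^_ l)%:R :> {poly K}.
  elim: l {fact0} => [|l IHl]; first by rewrite big_ord0 ffactn0.
  rewrite big_ord_recr IHl /= hornerXsubC ffactnSr natrM.
  case: (leqP l N) => [le|lt]; first by rewrite natrB.
  by rewrite ffact_small ?mul0r.
by rewrite -bin_ffact natrM mulrCA -(polyC_natr K l`!) -polyCM mulVf // polyC1 mulr1.
Qed.

Lemma binpolyN1 l : (binpoly l).[-1] = (-1) ^+ l.
Proof.
have fact0 : l`!%:R != 0 :> K by rewrite -(prednK (fact_gt0 l)).
rewrite /binpoly hornerM hornerC horner_prod.
have -> : \prod_(i < l) ('X - i%:R%:P).[-1] = (-1) ^+ l * (l`!)%:R :> {poly K}.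
  elim: l {fact0} => [|l IHl]; first by rewrite big_ord0 mulr1.
  rewrite big_ord_recr IHl /= hornerXsubC factS natrM exprS -addn1 natrD; ring.
by rewrite mulrCA -(polyC_natr K l`!) -polyCM mulVf // polyC1 mulr1.
Qed.

Definition special N (i : 'I_N.+1) : {poly K} := if i == ord0 then 1 else 'X.

(* f(1, u, ..., u), with N variables equal to u. *)
Definition special_eval (f : family K) N : {poly K} := mmap (@polyC K) (@special N) (f N.+1).

Definition interpolant (f : family K) (Q : {poly {poly K}}) : Prop :=
  forall N, Q.[N%:R] = special_eval f N.

Lemma interpolant_uniq f Q1 Q2 : interpolant f Q1 -> interpolant f Q2 -> Q1 = Q2.
Proof.
move=> i1 i2; apply/eqP; rewrite -subr_eq0; apply/negPn/negP => nz.
pose s := [seq i%:R : {poly K} | i <- iota 0 (size (Q1 - Q2))].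
have us : uniq s by rewrite map_inj_uniq ?iota_uniq // => m n /natr_poly_inj.
have rs : all (root (Q1 - Q2)) s.
  by apply/allP => _ /mapP[i _ ->]; rewrite rootE hornerD hornerN i1 i2 subrr.
by have := max_poly_roots nz rs us; rewrite size_map size_iota ltnn.
Qed.

Lemma special_eval_word (T : finType) (pos : T -> nat) W N :
  special_eval (word_sum pos W) N =
  word_eval pos 'X N.+1 [set: T] (fun D => (W D)%:P) N.
Proof.
rewrite /special_eval /word_sum rmorph_sum /= /word_eval; apply: eq_big => [s|s _].
  by apply/esym; rewrite /valued; apply/forallP => p; rewrite in_setT -ltnS ltn_ord.
rewrite mmapZ rmorph_prod /=; have -> : invs pos s :&: setX [set: T] [set: T] = invs pos s.
  by apply/setP => -[p r]; rewrite in_setI in_setX !in_setT !andbT.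
congr (_ * _); rewrite (bigID (mem (support s))) /= [X in _ * X]big1 ?mulr1 => [|p].
  rewrite -prodr_const; apply: eq_bigr => p; rewrite in_set => np.
  by rewrite mmapX mmap1U /special -val_eqE /= (negbTE np).
by rewrite in_set negbK => /eqP sp; rewrite mmapX mmap1U /special -val_eqE /= sp.
Qed.

Lemma interpolant_word (T : finType) (pos : T -> nat) W :
  exists Q, interpolant (word_sum pos W) Q /\
    Q.[-1] = \sum_(B : {set T}) (- 'X) ^+ #|B| * (W (out_pairs pos [set: T] set0 B))%:P.
Proof.
have [c [cN c1]] := interpolation pos 'X [set: T] (fun D => (W D)%:P).
exists (\sum_(l < size c) (c`_l)%:P * binpoly l); split.
  move=> N; rewrite special_eval_word cN // horner_sum /binval; apply: eq_bigr => l _.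
  by rewrite hornerM hornerC binpolyN.
transitivity c.[-1].
  rewrite horner_sum horner_coef; apply: eq_bigr => l _.
  by rewrite hornerM hornerC binpolyN1.
by rewrite c1; apply: eq_bigl => B; rewrite subsetT.
Qed.

Lemma interpolant_powersums (s : seq (seq nat)) (c : seq nat -> K) (f : family K) :
    (forall N, f N = \sum_(la <- s) c la *: \prod_(k <- la) \sum_(i < N) 'X_i ^+ k) ->
  interpolant f (\sum_(la <- s) (c la)%:P%:P * \prod_(k <- la) (1 + ('X^k)%:P * 'X)).
Proof.
move=> fE N; rewrite horner_sum /special_eval fE rmorph_sum /=; apply: eq_bigr => la _.
rewrite hornerM hornerC mmapZ; congr (_ * _).
rewrite horner_prod rmorph_prod; apply: eq_bigr => k _.
rewrite hornerD hornerM !hornerC hornerX rmorph_sum /= big_ord_recl /=.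
rewrite rmorphXn /= mmapX mmap1U /special eqxx expr1n; congr (_ + _).
rewrite (eq_bigr (fun=> 'X^k)) => [|i _]; last by rewrite rmorphXn /= mmapX mmap1U.
by rewrite sumr_const card_ord mulr_natr.
Qed.

End Interpolant.

(** * Values at 1 - u *)

Section ConjugatePartition.
Variable la : seq nat.
Hypothesis pla : is_part la.

Lemma ltn_conj i j : (i < head 0 la)%N -> (j < nth 0 (conj_part la) i)%N = (i < nth 0 la j)%N.
Proof.
move=> lti; rewrite /conj_part (nth_map 0%N) ?size_iota // nth_iota // add0n.
have srt s : sorted geq s -> (j < count (fun p => i < p)%N s)%N = (i < nth 0 s j)%N.
  elim: s j => [|x s IHs] j; first by rewrite nth_nil.
  move=> /= ps; have ss := path_sorted ps.
  have lex k : (nth 0 s k <= x)%N.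
    case: (ltnP k (size s)) => [ltk|/(nth_default 0%N)->//].
    have /allP := order_path_min geq_trans ps; apply; exact: mem_nth.
  case: j => [|j] /=.
    case: (ltnP i x) => [ltx|lex0] /=; first by rewrite addn_gt0.
    rewrite add0n; apply/negbTE; rewrite -leqNgt leqn0; apply/eqP.
    by rewrite -(@eq_in_count _ pred0) ?count_pred0 // => y /(nthP 0%N)[k _ <-]; apply/esym/negbTE;
      rewrite -leqNgt (leq_trans (lex k)).
  rewrite -(IHs j ss); case: (ltnP i x) => [ltx|lex0] /=; first by rewrite add1n ltnS.
  rewrite add0n; have -> : count (fun p => i < p)%N s = 0%N.
    by rewrite -(@eq_in_count _ pred0) ?count_pred0 // => y /(nthP 0%N)[k _ <-]; apply/esym/negbTE;
      rewrite -leqNgt (leq_trans (lex k)).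
  by [].
by apply: srt; case/andP: pla.
Qed.

Lemma nth_conj_le i : (nth 0 (conj_part la) i <= size la)%N.
Proof.
case: (ltnP i (head 0 la)) => [lti|le]; last by rewrite nth_default // size_map size_iota.
by rewrite /conj_part (nth_map 0%N) ?size_iota // count_size.
Qed.

Lemma big_box_cols (R : Type) (idx : R) (op : Monoid.com_law idx) (F : nat -> nat -> R) :
  \big[op/idx]_(u : box la) F (bcol u) (brow u) =
  \big[op/idx]_(0 <= i < head 0%N la) \big[op/idx]_(0 <= j < nth 0%N (conj_part la) i) F i j.
Proof.
rewrite big_box.
transitivity (\big[op/idx]_(0 <= j < size la) \big[op/idx]_(0 <= i < head 0 la | (i < nth 0 la
  j)%N) F i j).
  apply: eq_bigr => j _; have le : (nth 0 la j <= head 0 la)%N by rewrite -nth0 nth_part.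
  by rewrite (big_nat_widen _ _ _ _ _ le).
rewrite (exchange_big_dep_nat predT) //=; apply: eq_big_nat => i /andP[_ lti].
rewrite (big_nat_widen _ _ _ _ _ (nth_conj_le i)) /=; apply: eq_bigl => j.
by rewrite ltn_conj.
Qed.

End ConjugatePartition.

(** * Macdonald polynomials at 1 - u *)

Section MacdonaldValue.
Variables (K : fieldType) (a b : K) (la : seq nat).
Hypothesis pla : is_part la.
Notation pos := (@reading_pos la).
Implicit Types (u v : box la) (B : {set box la}).

Lemma out_pairs0 B u v : ((u, v) \in out_pairs pos [set: box la] set0 B) = (pos u < pos v)%N && (u
  \in B).
Proof. by rewrite in_set in_setX !in_setT /= set0U in_set0 andbT. Qed.

Definition co_arm u : nat := #|[set v | left_of v u]|.

Lemma co_armE u : co_arm u = bcol u.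
Proof.
have bx (k : 'I_(bcol u)) : (k : nat, brow u) \in boxes la.
  by rewrite mem_boxes (ltn_trans (ltn_ord k)) // box_bound.
rewrite -[RHS]card_ord -(card_imset predT (_ : injective (fun k => SeqSub (bx k) : box la)));
  last first.
  by move=> k l /(congr1 (@bcol la)) e; apply: val_inj.
apply: eq_card => v; rewrite in_set; apply/idP/imsetP => [/andP[/eqP er lt]|[k _ ->]].
  by exists (Ordinal lt) => //; apply: box_inj.
by rewrite /left_of eqxx; apply: ltn_ord.
Qed.

Lemma arm_lenE u : arm_len u = (nth 0 la (brow u) - (bcol u).+1)%N.
Proof.
have bx (k : 'I_(nth 0 la (brow u) - (bcol u).+1)) : ((bcol u).+1 + k, brow u)%N \in boxes la.
  by rewrite mem_boxes -ltn_subRL.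
rewrite -[RHS]card_ord -(card_imset predT (_ : injective (fun k => SeqSub (bx k) : box la)));
  last first.
  by move=> k l /(congr1 (@bcol la)) /= /addnI e; apply: val_inj.
apply: eq_card => v; rewrite in_set; apply/idP/imsetP => [/andP[/eqP er lt]|[k _ ->]].
  have lt2 : (bcol v - (bcol u).+1 < nth 0 la (brow u) - (bcol u).+1)%N.
    by rewrite ltn_sub2r // er ?box_bound // (leq_ltn_trans lt) ?box_bound.
  by exists (Ordinal lt2) => //; apply: box_inj => //; apply/esym; exact: subnKC.
by rewrite /left_of eqxx /= ltn_addr.
Qed.

Lemma sum_left_of_snd (c : pred (box la)) :
  (\sum_(e : box la * box la | left_of e.1 e.2) c e.2 = \sum_(v | c v) co_arm v)%N.
Proof.
rewrite -(pair_big_dep predT (fun u v => left_of u v) (fun u v => c v : nat)) /=.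
rewrite (exchange_big_dep predT) //= [RHS]big_mkcond; apply: eq_bigr => v _.
rewrite sum_nat_cond_const /co_arm; case: (c v); rewrite ?muln0 // muln1.
by apply: eq_card => u; rewrite !inE.
Qed.

Lemma sum_left_of_fst (c : pred (box la)) :
  (\sum_(e : box la * box la | left_of e.1 e.2) c e.1 = \sum_(u | c u) arm_len u)%N.
Proof.
rewrite -(pair_big_dep predT (fun u v => left_of u v) (fun u v => c u : nat)) /=.
rewrite [RHS]big_mkcond; apply: eq_bigr => u _.
rewrite sum_nat_cond_const /arm_len; case: (c u); rewrite ?muln0 // muln1.
by apply: eq_card => v; rewrite !inE.
Qed.

(** The factor of a box of [B]. Above the bottom row every box of [B] is a descent, and a pair with
    [u] left of [v] is an inversion exactly when [v] is in [B], which counts coarms; in the bottom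
    row it is one exactly when [u] is in [B], which counts arms. *)
Definition theta u : K :=
  if (0 < brow u)%N then a ^+ co_arm u * b ^+ (leg u).+1 else a ^+ arm_len u.

Lemma out_pairs_weight B :
  let D := out_pairs pos [set: box la] set0 B in
  a ^+ word_inv D * b ^+ word_maj D = \prod_(u in B) theta u.
Proof.
move=> D; have inD u v : ((u, v) \in D) = (pos u < pos v)%N && (u \in B) := out_pairs0 B u v.
rewrite {}/D in inD *; move: (out_pairs _ _ _ _) inD => D inD.
have des : word_des D = [set u in B | (0 < brow u)%N].
  apply/setP => u; rewrite !in_set inD; case: (boolP (0 < brow u)%N) => gt0; rewrite ?andbF //=.
  by rewrite lower_pos ?andbT.
have majE : word_maj D = (\sum_(u in B) if 0 < brow u then (leg u).+1 else 0)%N.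
  rewrite /word_maj des -big_mkcondr; apply: eq_bigl => u; by rewrite in_set.
have invE : word_inv D = (\sum_(u in B) if 0 < brow u then co_arm u else arm_len u)%N.
  have -> : word_inv D = (\sum_(e | left_of e.1 e.2) ((0 < brow e.2) && (e.2 \in B) : nat) +
                          \sum_(e | left_of e.1 e.2) (~~ (0 < brow e.1) && (e.1 \in B)))%N.
    rewrite -big_split /= /word_inv -sum1dep_card big_mkcondr /=; apply: eq_bigr => -[u v] /= luv.
    rewrite !inD left_of_pos //=; have /andP[/eqP er _] := luv; rewrite er.
    case: (boolP (0 < brow v)%N) => gt0 /=; last by rewrite addbF; case: (u \in B).
    rewrite !lower_pos ?er //=.
    by case: (u \in B); case: (v \in B).
  rewrite (sum_left_of_snd (fun v => (0 < brow v)%N && (v \in B))).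
  rewrite (sum_left_of_fst (fun v => ~~ (0 < brow v)%N && (v \in B))).
  rewrite [RHS](bigID (fun u => 0 < brow u)%N) /=; congr (_ + _)%N.
    by apply: eq_big => [u|u /andP[-> //]]; rewrite andbC.
  by apply: eq_big => [u|u /andP[/negbTE-> //]]; rewrite andbC.
rewrite invE majE -!prodrXr -big_split /=; apply: eq_bigr => u uB.
by rewrite /theta; case: ifP => //; rewrite mulr1.
Qed.

(** Reversing the bottom row turns arms into column indices, and reversing each column above the
    bottom row turns [(leg u).+1] into the row index. Both reversals only permute factors. *)
Lemma macdonald_value :
  \sum_(B : {set box la}) (- 'X) ^+ #|B| *
     (let D := out_pairs pos [set: box la] set0 B in a ^+ word_inv D * b ^+ word_maj D)%:P =
  \prod_(0 <= j < size la) \prod_(0 <= i < nth 0%N la j) (1 - (a ^+ i * b ^+ j)%:P * 'X).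
Proof.
transitivity (\prod_(u : box la) (1 - (theta u)%:P * 'X)).
  rewrite (eq_bigr (fun B => \prod_(u in B) (- 'X * (theta u)%:P))) => [|B _].
    under [RHS]eq_bigr do rewrite addrC.
    rewrite bigA_distr; apply: eq_bigr => B _; rewrite big_mkcond; apply: eq_bigr => u _.
    by rewrite mulNr mulrC.
  by rewrite /= out_pairs_weight rmorph_prod big_split /= prodr_const.
pose F i j : {poly K} := if (0 < j)%N then 1 - (a ^+ i * b ^+ (nth 0%N (conj_part la) i - j))%:P *
  'X
   else 1 - (a ^+ (head 0%N la - i.+1))%:P * 'X.
transitivity (\prod_(u : box la) F (bcol u) (brow u)).
  apply: eq_bigr => u _; rewrite /F /theta co_armE arm_lenE; case: (posnP (brow u)) => [->|gt0].
    by rewrite nth0.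
  rewrite /leg -subSn ?subSS // ltn_conj ?box_bound // -nth0.
  exact: leq_trans (box_bound u) (nth_part pla (leq0n _)).
pose H i j : {poly K} := 1 - (a ^+ i * b ^+ j)%:P * 'X.
rewrite -(big_box _ la H) (big_box_cols pla _ F) (big_box_cols pla _ H).
have split_col (G : nat -> nat -> {poly K}) :
    \prod_(0 <= i < head 0%N la) \prod_(0 <= j < nth 0%N (conj_part la) i) G i j =
    (\prod_(0 <= i < head 0%N la) G i 0%N) *
     \prod_(0 <= i < head 0%N la) \prod_(1 <= j < nth 0%N (conj_part la) i) G i j.
  rewrite -big_split /=; apply: eq_big_nat => i /andP[_ lti].
  by rewrite big_ltn // ltn_conj // nth0.
rewrite !split_col; congr (_ * _).
  rewrite big_nat_rev /=; apply: eq_big_nat => i /andP[_ lti].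
  by rewrite /F /H add0n subnSK ?subKn ?expr0 ?mulr1 // ltnW.
apply: eq_big_nat => i /andP[_ lti]; rewrite big_nat_rev /=; apply: eq_big_nat => j /andP[j0 ltj].
rewrite /F /H add1n subSS subn_gt0 ltj subKn //; exact: ltnW.
Qed.
End MacdonaldValue.

(** * Schur functions at 1 - u *)

Section SchurValue.
Variables (K : fieldType) (la : seq nat).
Hypothesis pla : is_part la.
Notation pos := (@reading_pos la).
Implicit Types (u v : box la) (B : {set box la}).

(** A box of [B] is larger than everything read after it, so it may have no box on its right; a box
    off [B] is larger than nothing, so it may have no box below it. *)
Lemma out_pairs_semistandard B :
  word_semistandard (out_pairs pos [set: box la] set0 B) =
  [forall u, ((0 < arm_len u)%N ==> (u \notin B)) && ((0 < brow u)%N ==> (u \in B))].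
Proof.
apply/forallP/forallP => [H u|H u].
  apply/andP; split; apply/implyP.
    rewrite card_gt0 => /set0Pn[v]; rewrite in_set => luv.
    have /forallP/(_ v)/andP[/implyP/(_ luv) + _] := H u.
    by rewrite out_pairs0 left_of_pos.
  move=> gt0; have bl : below (lower u) u by rewrite /below bcol_lower // brow_lower // eqxx prednK
    /=.
  have /forallP/(_ u)/andP[_ /implyP/(_ bl)] := H (lower u).
  by rewrite out_pairs0 => /andP[].
apply/forallP => v; rewrite !out_pairs0; apply/andP; split; apply/implyP => luv.
  rewrite left_of_pos //=; have /andP[/implyP im _] := H u; apply: im.
  by rewrite card_gt0; apply/set0Pn; exists v; rewrite in_set.
have /andP[_ /implyP im] := H v.
by rewrite below_pos //= im //; case/andP: luv => _; apply: leq_ltn_trans.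
Qed.

Definition hook_value : {poly K} :=
  if (nth 0%N la 1 <= 1)%N then (- 'X) ^+ (size la).-1 * (1 - 'X) else 0.

Lemma schur_value : (0 < sumn la)%N ->
  \sum_(B : {set box la}) (- 'X) ^+ #|B| *
    ((word_semistandard (out_pairs pos [set: box la] set0 B))%:R)%:P = hook_value.
Proof.
move=> n0; pose leg_set := [set u : box la | (0 < brow u)%N].
have h0 : (0 < nth 0 la 0)%N.
  rewrite lt0n; apply: contraTneq n0 => e; rewrite -leqNgt sumn_nth big1 // => j _.
  by apply/eqP; rewrite -leqn0; apply: leq_trans (nth_part pla (leq0n j)) _; rewrite e.
have s0 : (0 < size la)%N by rewrite ltnNge; apply: contraTN h0 => le; rewrite nth_default.
have bx : ((head 0 la).-1, 0)%N \in boxes la by rewrite mem_boxes nth0 prednK -?nth0.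
(* For a hook, the last box of the bottom row is the only one whose membership in [B] is free; this
   gives the factor 1 - u. *)
pose z : box la := SeqSub bx.
pose good B := word_semistandard (out_pairs pos [set: box la] set0 B).
transitivity (\sum_(B : {set box la} | good B) (- 'X) ^+ #|B| : {poly K}).
  rewrite [RHS]big_mkcond; apply: eq_bigr => B _; rewrite -/(good B).
  by case: (good B); rewrite ?mulr1 ?mulr0.
rewrite /hook_value; case: leqP => [h1|h1]; last first.
  (* This box is above the bottom row and has a box on its right, so it would have to be both in [B]
     and outside [B]. *)
  have bx2 : (0, 1)%N \in boxes la by rewrite mem_boxes (ltn_trans _ h1).
  rewrite big_pred0 // => B; rewrite /good out_pairs_semistandard; apply/negbTE/forallPn.
  exists (SeqSub bx2 : box la); rewrite arm_lenE /= -/(bcol _) /=.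
  by rewrite subn_gt0 h1 /=; case: (_ \in _).
have armE u : (0 < arm_len u)%N = (u \notin z |: leg_set).
  rewrite arm_lenE // subn_gt0 in_setU1 in_set negb_or -leqNgt leqn0.
  case: (posnP (brow u)) => [e|gt0]; last first.
    rewrite andbF; apply/negbTE; rewrite -leqNgt.
    by apply: leq_trans (_ : 1 <= _)%N => //; apply: leq_trans h1; apply: nth_part.
  rewrite andbT e nth0; apply/idP/idP => [lt|].
    by apply: contraTneq lt => ->; rewrite /bcol /= prednK -?nth0 // ltnn.
  move=> ne; have hb := box_bound u; rewrite e nth0 in hb; rewrite ltn_neqAle hb andbT.
  by apply: contra ne => /eqP e2; apply/eqP/box_inj => //; rewrite [RHS]/bcol /= -e2.
have zleg : z \notin leg_set by rewrite in_set.
have goodE B : good B = (leg_set \subset B) && (B \subset z |: leg_set).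
  rewrite /good out_pairs_semistandard; apply/forallP/andP => [H|[H1 H2] u].
    split; apply/subsetP => u; have /andP[/implyP i1 /implyP i2] := H u.
      by rewrite in_set => /i2.
    by apply: contraTT; rewrite -armE; apply: i1.
  apply/andP; split; apply/implyP; last by move=> gt0; apply: (subsetP H1); rewrite in_set.
  by rewrite armE; apply: contra; apply: (subsetP H2).
have cleg : #|leg_set| = (size la).-1.
  rewrite -sum1dep_card big_mkcond (big_box _ la (fun _ j => if 0 < j then 1 else 0)%N) /=.
  rewrite big_ltn // big1 ?add0n => [|i _]; last by [].
  rewrite -[in RHS](muln1 (size la).-1) -subn1 -sum_nat_const_nat;
    apply: eq_big_nat => j /andP[j0 ltj].
  rewrite j0 sum_nat_const_nat subn0 muln1; apply/eqP; rewrite eqn_leq.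
  by rewrite part_gt0 // andbT; apply: leq_trans h1; apply: nth_part.
rewrite (bigD1 leg_set) ?goodE ?subxx ?subsetUr //= (big_pred1 (z |: leg_set)) => [|B].
  by rewrite cardsU1 zleg cleg add1n exprS mulrBr mulr1 mulNr mulrC.
rewrite goodE; apply/andP/eqP => [[/andP[H1 H2] ne]|->]; last first.
  by rewrite subsetUr subxx eq_sym; split=> //; apply: contraNneq zleg => ->; rewrite setU11.
apply/eqP; rewrite eqEsubset H2 subUset H1 andbT sub1set /=.
apply: contraNT ne => zB; rewrite eqEsubset H1 andbT; apply/subsetP => u uB.
have := subsetP H2 _ uB; rewrite in_setU1 => /orP[/eqP e|//].
by rewrite e (negbTE zB) in uB.
Qed.

End SchurValue.

Section Interp.
Variable K : fieldType.

Lemma interpolantZ (f : family K) Q c : interpolant f Q ->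
  interpolant (fun N => c *: f N) (c%:P%:P * Q).
Proof. by move=> iQ N; rewrite hornerM hornerC iQ /special_eval mmapZ. Qed.

Lemma interpolant_sum (I : Type) (s : seq I) (P : pred I) (f : I -> family K) Q :
  (forall i, P i -> interpolant (f i) (Q i)) ->
  interpolant (fun N => \sum_(i <- s | P i) f i N) (\sum_(i <- s | P i) Q i).
Proof.
move=> iQ N; rewrite horner_sum /special_eval rmorph_sum /=; apply: eq_bigr => i Pi.
exact: iQ.
Qed.

Lemma interpolant_prod (I : Type) (s : seq I) (P : pred I) (f : I -> family K) Q :
  (forall i, P i -> interpolant (f i) (Q i)) ->
  interpolant (fun N => \prod_(i <- s | P i) f i N) (\prod_(i <- s | P i) Q i).
Proof.
move=> iQ N; rewrite horner_prod /special_eval rmorph_prod /=; apply: eq_bigr => i Pi.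
exact: iQ.
Qed.

Lemma interpolant_ext (f g : family K) Q : (forall N, f N = g N) -> interpolant f Q -> interpolant
  g Q.
Proof. by move=> e iQ N; rewrite iQ /special_eval e. Qed.

End Interp.

Lemma natrS_Qqt n : n.+1%:R != 0 :> Qqt.
Proof. by rewrite natrQqt_eq0. Qed.

(** The interpolant read off the chosen power-sum expansion equals [Q] by uniqueness, which makes
    the plethysm independent of that choice. *)
Lemma pleth_interpolant n (f : symfun) (Q : {poly {poly Qqt}}) :
  homog_symfun n (f : family Qqt) -> interpolant (f : family Qqt) Q ->
  pleth_1_minus_u f = Q.[-1].
Proof.
move=> hf iQ; have [c0 ec0] := powersum_expansion hf.
have [_ ec] := epsilon_spec (inhabits [fsfun]) (expands powersum f) (ex_intro _ c0 ec0).
rewrite /pleth_1_minus_u -/(coefs powersum f) in ec *.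
have := interpolant_powersums ec.
move=> /(interpolant_uniq natrS_Qqt iQ) ->.
rewrite horner_sum; apply: eq_bigr => la _; rewrite hornerM hornerC mul_polyC; congr (_ *: _).
by rewrite horner_prod; apply: eq_bigr => k _; rewrite hornerD hornerM !hornerC hornerX mulrN1.
Qed.

Definition hook n s : seq nat := (n - s)%N :: nseq s 1%N.

Lemma hook_uniq n : uniq [seq hook n s | s <- iota 0 n].
Proof.
by rewrite map_inj_uniq ?iota_uniq // => s s' [_ /(congr1 size)]; rewrite !size_nseq.
Qed.

Lemma hookP n la : is_part la -> (0 < n)%N ->
  (la \in [seq hook n s | s <- iota 0 n]) = (sumn la == n) && (nth 0%N la 1 <= 1)%N.
Proof.
move=> pla n0; apply/mapP/andP => [[s + ->]|[/eqP sla h1]].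
  rewrite mem_iota add0n /= => lt; split; first by rewrite sumn_nseq mul1n subnK ?eqxx // ltnW.
  by case: s lt.
case: la pla sla h1 => [|h la] pla /= sla h1; first by rewrite -sla in n0.
have e1 : la = nseq (size la) 1%N.
  apply/all_pred1P/allP => x /(nthP 0%N)[j ltj <-] /=; rewrite eqn_leq.
  rewrite (part_gt0 (i := j.+1) pla) // andbT; apply: leq_trans h1.
  exact: (nth_part pla (isT : 1 <= j.+1)%N).
have h0 : (0 < h)%N by exact: (part_gt0 (i := 0) pla).
have es : sumn la = size la by rewrite {1}e1 sumn_nseq mul1n.
exists (size la); first by rewrite mem_iota /= -sla es; lia.
by rewrite /hook -e1 -sla es addnK.
Qed.

Lemma interpolant_schur la : is_part la -> (0 < sumn la)%N ->
  exists Q, interpolant (schur la : family Qqt) Q /\ Q.[-1] = hook_value Qqt la.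
Proof.
move=> pla n0; have [Q [iQ Q1]] := interpolant_word natrS_Qqt (@reading_pos la)
  (fun D => (word_semistandard D)%:R).
exists Q; split; first by apply: interpolant_ext iQ => N; rewrite schurE.
by rewrite Q1; apply: schur_value.
Qed.

Lemma pleth_schur_coefs n (f : symfun) : homog_symfun n (f : family Qqt) -> (0 < n)%N ->
  pleth_1_minus_u f = \sum_(s < n) coefs schur f (hook n s) *: ((- 'X) ^+ s * (1 - 'X)).
Proof.
move=> hf n0; have [c0 ec0] := schur_expansion hf.
have [pc ec] := epsilon_spec (inhabits [fsfun]) (expands schur f) (ex_intro _ c0 ec0).
rewrite -/(coefs schur f) in ec pc *; move: (coefs schur f) ec pc => c ec pc {c0 ec0}.
(* The chosen expansion is not known to be homogeneous; projection onto degree [n] keeps only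
   partitions of [n], which are nonempty. *)
have fE N : f N = \sum_(la <- finsupp c | (la \in finsupp c) && (sumn la == n)) c la *: schur la N.
  have [_ hom _] := hf.
  rewrite -(pihomog_dE (hom N)) ec linear_sum /= [RHS]big_mkcond.
  rewrite big_seq [RHS]big_seq; apply: eq_bigr => la las; rewrite linearZ /= las /=.
  have [_ hs _] := homog_schur (pc _ las).
  case: eqVneq => [e|ne]; first by rewrite pihomog_dE // -e; apply: hs.
  by rewrite (pihomog_ne0 ne (hs N)) scaler0.
have exQ la : exists Q, la \in finsupp c -> sumn la == n ->
    interpolant (schur la : family Qqt) Q /\ Q.[-1] = hook_value Qqt la.
  case: (boolP (la \in finsupp c)) => [las|]; last by exists 0.
  case: (eqVneq (sumn la) n) => [e|]; last by exists 0.
  by have [|Q hQ] := interpolant_schur (pc _ las); [rewrite e|exists Q].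
have {exQ}[Q hQ] := choice _ exQ.
rewrite (pleth_interpolant hf (Q := \sum_(la <- finsupp c | (la \in finsupp c) && (sumn la == n))
  (c la)%:P%:P * Q la)).
  rewrite horner_sum (eq_bigr (fun la => c la *: hook_value Qqt la)) => [|la /andP[las sla]];
    last first.
    by have [_ e] := hQ _ las sla; rewrite hornerM hornerC mul_polyC e.
  pose P la := (sumn la == n) && (nth 0%N la 1 <= 1)%N.
  pose G la := c la *: ((- 'X) ^+ (size la).-1 * (1 - 'X)) : {poly Qqt}.
  transitivity (\sum_(la <- finsupp c | P la) G la).
    rewrite [LHS]big_mkcond [RHS]big_mkcond big_seq [RHS]big_seq; apply: eq_bigr => la las.
    rewrite las /P /hook_value /=; case: (sumn la == n) => //=.
    by case: ifP => _; rewrite ?scaler0.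
  transitivity (\sum_(la <- [seq hook n s | s <- iota 0 n] | la \in finsupp c) G la).
    rewrite -big_filter -[RHS]big_filter; apply: perm_big; apply: uniq_perm.
    - by rewrite filter_uniq // fset_uniq.
    - by rewrite filter_uniq // hook_uniq.
    move=> la; rewrite !mem_filter andbC; case: (boolP (la \in finsupp c)) => //= las.
    by rewrite hookP // pc.
  rewrite big_map big_mkcond (_ : iota 0 n = index_iota 0 n) ; last by rewrite /index_iota subn0.
  rewrite big_mkord; apply: eq_bigr => s _.
  case: ifP => [_|/negbT]; first by rewrite /G /= size_nseq.
  by rewrite memNfinsupp => /eqP ->; rewrite scale0r.
apply: interpolant_ext (fun N => esym (fE N)) _.
apply: (@interpolant_sum _ _ _ _ (fun la N => c la *: schur la N)) => la /andP[las sla].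
by apply: interpolantZ; case: (hQ _ las sla).
Qed.

(** * Cumulants and rooted trees *)

Section SetCumulant.
Variables (R : comNzRingType) (V : finType) (M : {set V} -> R).
Implicit Types (S A B : {set V}) (P Q : {set {set V}}).

(** The Moebius function of the partition lattice from a partition with [k] blocks to the one with a
    single block. *)
Definition mobius k : R := (-1) ^+ k.-1 * (k.-1`!)%:R.

Definition set_cumulant S : R :=
  \sum_(P : {set {set V}} | partition P S) mobius #|P| * \prod_(B in P) M B.

(** The domain of the bijection from partitions of [S] with a marked block [B] avoiding [x] to
    subsets of [S] with a partition: the marked block is removed. *)
Lemma partition_add_block S (x : V) P B :
  [&& (x \in S :\: B), S :\: B \subset S, S :\: B != S & partition (P :\ B) (S :\: B)] &&
    (((S :\: (S :\: B)) |: (P :\ B), S :\: (S :\: B)) == (P, B)) =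
  [&& x \in S, partition P S, B \in P & x \notin B].
Proof.
apply/andP/and4P => [[/and4P[xSB _ ne pPB] /eqP[eP eB]]|[xS pP BP xB]].
  have BP : B \in P by rewrite -eP eB setU11.
  have := xSB; rewrite in_setD => /andP[xB xS]; split=> //.
  have sBS : B \subset S by rewrite -eB subsetDl.
  have B0 : B != set0 by apply: contraNneq ne => ->; rewrite setD0.
  rewrite -(setD1K BP) -(setID S B) (setIidPr sBS); apply: partitionU1 => //.
  by rewrite -setI_eq0 setDE setIC -setIA [~: B :&: B]setIC setICr setI0.
have sBS : B \subset S by rewrite -(cover_partition pP); apply: bigcup_sup.
have eB : S :\: (S :\: B) = B by rewrite setDDr setDv set0U (setIidPr sBS).
rewrite eB setD1K // eqxx in_setD xB xS subsetDl partitionD1 // andbT; split=> //. rewrite /= andbT.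
have : B != set0 by apply: contraTneq BP => ->; case/and3P: pP.
by move=> B0; apply: contraNneq B0 => e; rewrite -eB e setDv.
Qed.

(* Adjoining the block S :\: A to a partition of A gives a partition of S with a
   marked block that avoids x; the partitions with at least two blocks cancel. *)
Lemma moment_recursion S x : M set0 = 1 -> x \in S ->
  M S = \sum_(A : {set V} | (x \in A) && (A \subset S)) set_cumulant A * M (S :\: A).
Proof.
move=> M0 xS; rewrite (bigD1 S) ?xS ?subxx //= setDv M0 mulr1.
have -> : \sum_(A : {set V} | (x \in A) && (A \subset S) && (A != S)) set_cumulant A * M (S :\: A) =
    \sum_(P : {set {set V}} | partition P S) (#|P|.-1)%:R * mobius #|P|.-1 * \prod_(B in P) M B.
  under eq_bigr do rewrite /set_cumulant mulr_suml.
  rewrite pair_big_dep /=.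
  rewrite (reindex_onto (fun PB : {set {set V}} * {set V} => (S :\: PB.2, PB.1 :\ PB.2))
     (fun AP : {set V} * {set {set V}} => ((S :\: AP.1) |: AP.2, S :\: AP.1))) /=; last first.
    move=> [A P] /= /andP[/andP[/andP[xA sA] nA] pP]; congr pair.
      by rewrite setDDr setDv set0U (setIidPr sA).
    rewrite setU1K //; apply/negP => inP; have := cover_partition pP => cP.
    have sub : S :\: A \subset A by rewrite -{2}cP; apply: (bigcup_max (S :\: A)).
    have e0 : S :\: A == set0.
      by rewrite -subset0; apply/subsetP => y yD; have := subsetP sub _ yD; move: yD;
        rewrite in_setD => /andP[/negP].
    by case/and3P: pP => _ _ /negP; rewrite -(eqP e0).
  rewrite (eq_bigl (fun PB => partition PB.1 S && ((PB.2 \in PB.1) && (x \notin PB.2)))) => [|[P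
    B]]; last first.
    by have := partition_add_block S x P B; rewrite xS /= -!andbA => <-.
  rewrite -(pair_big_dep (fun P => partition P S) (fun P B => (B \in P) && (x \notin B))
     (fun P B => mobius #|P :\ B| * \prod_(C in P :\ B) M C * M (S :\: (S :\: B)))) /=.
  apply: eq_bigr => P pP.
  have cP := cover_partition pP.
  rewrite (eq_bigr (fun B => mobius #|P|.-1 * \prod_(C in P) M C)) => [|B /andP[BP xB]]; last first.
    have sBS : B \subset S by rewrite -cP; apply: bigcup_sup.
    rewrite setDDr setDv set0U (setIidPr sBS) (cardsD1 B P) BP /= -mulrA; congr (_ * _).
    by rewrite [RHS](big_setD1 B) //= mulrC.
  rewrite sumr_const mulr_natl mulrnAl; congr (_ *+ _).
  have xcov : x \in cover P by rewrite cP.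
  have tP : trivIset P by case/and3P: pP.
  have pbP := pblock_mem xcov.
  rewrite (cardsD1 (pblock P x) P) pbP /=; apply: eq_card => B; rewrite in_setD1.
  have -> : (B \in (fun i : {set V} => (i \in P) && (x \notin i))) = (B \in P) && (x \notin B) by
    [].
  rewrite andbC; case: (boolP (B \in P)) => BP; rewrite ?andbF ?andbT //.
  congr (~~ _); apply/idP/eqP => [xB|->]; first by rewrite (def_pblock tP BP).
  by rewrite mem_pblock.
rewrite /set_cumulant -big_split /=.
have pS : partition [set S] S.
  apply/and3P; split; first by rewrite /cover big_set1.
    by apply/trivIsetP => A B; rewrite !inE => /eqP-> /eqP->; rewrite eqxx.
  by rewrite inE eq_sym; apply: contraTneq xS => ->; rewrite inE.
rewrite (bigD1 [set S]) //= [X in _ + X]big1 ?addr0.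
  by rewrite cards1 big_set1 /mobius /= expr0 !mul1r mul0r mul0r addr0.
move=> P /andP[pP ne]; rewrite -mulrDl.
case: (ltngtP #|P| 1) => [|lt|/eqP/cards1P[B eB]].
- rewrite ltnS leqn0 cards_eq0 => /eqP e; have := cover_partition pP.
  by rewrite e /cover big_set0 => e0; rewrite -e0 inE in xS.
- case: #|P| lt => [|[|k]] //= _; rewrite /mobius /= factS exprS natrM; ring.
have := cover_partition pP; rewrite eB /cover big_set1 => e.
by rewrite eB e eqxx in ne.
Qed.

End SetCumulant.

(** * A recursion for cumulants *)

Section CutRecursion.
Variables (R : comNzRingType) (V : finType) (M : {set V} -> R) (l : V -> R) (y : V -> V -> R).
Hypothesis M0 : M set0 = 1.
(** The intended [M] is [q] to the number of edges inside a set; deleting [x] splits off its loops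
    and its edges to the other vertices. *)
Hypothesis M_delete : forall (S : {set V}) x, x \in S -> M S = l x * (\prod_(v in S :\ x) y x v) *
  M (S :\ x).
Implicit Types S A B : {set V}.
Notation D := (set_cumulant M).

Let Y x B : R := \prod_(v in B) y x v.

Let YD x S B : B \subset S -> Y x S = Y x B * Y x (S :\: B).
Proof.
move=> sB; rewrite /Y (bigID (mem B)) /=; congr (_ * _); apply: eq_bigl => v.
  by case: (boolP (v \in B)) => [/(subsetP sB)->|]; rewrite ?andbF.
by rewrite in_setD andbC.
Qed.

(** The right-hand side, used in place of the cumulant on all sets containing [w], satisfies the
    moment recursion at [x]. By induction it agrees with the cumulant on smaller sets, so comparing
    the two recursions leaves equality on [S]. *)
Lemma set_cumulant_recursion S x w : x \in S -> w \in S -> x != w ->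
  D S = \sum_(B : {set V} | (w \in B) && (B \subset S :\ x)) (Y x B - 1) * D B * D (S :\: B).
Proof.
have [n] := ubnP #|S|; elim: n S => // n IHn S ltS xS wS nxw.
pose rhs (S : {set V}) := \sum_(B : {set V} | (w \in B) && (B \subset S :\ x)) (Y x B - 1) * D B *
  D (S :\: B).
pose D' (A : {set V}) := if w \in A then rhs A else D A.
suff key : M S = \sum_(A : {set V} | (x \in A) && (A \subset S)) D' A * M (S :\: A).
  have := moment_recursion M0 xS; rewrite {1}key (bigD1 S) ?xS ?subxx //=.
  rewrite [X in _ = X](bigD1 S) ?xS ?subxx //= setDv M0 !mulr1 /D' wS.
  rewrite (eq_bigr (fun A => D A * M (S :\: A))); first by move/addIr => <-.
  move=> A /andP[/andP[xA sA] nA]; case: ifP => // wA; rewrite /rhs -IHn //.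
  have ltA : A \proper S by rewrite properEneq nA.
  by rewrite -ltnS (leq_trans _ ltS) // ltnS proper_card.
rewrite (bigID (fun A => w \in A)) /=.
pose G (A B : {set V}) := (Y x B - 1) * D B * D A * M (S :\: A :\: B).
have -> : \sum_(A : {set V} | (x \in A) && (A \subset S) && (w \in A)) D' A * M (S :\: A) =
   \sum_(A : {set V} | (x \in A) && (A \subset S) && (w \notin A))
     \sum_(B : {set V} | (w \in B) && (B \subset S :\: A)) G A B.
  rewrite (eq_bigr (fun A => \sum_(B : {set V} | (w \in B) && (B \subset A :\ x)) G (A :\: B) B));
    last first.
    move=> A /andP[/andP[xA sA] wA]; rewrite /D' wA mulr_suml; apply: eq_bigr => B /andP[wB sB].
    have sBA : B \subset A by apply: subset_trans sB _; apply: subsetDl.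
    rewrite /G; congr (_ * M _); apply/setP => v; rewrite !in_setD negb_and negbK.
    case: (boolP (v \in B)) => //= vB; by rewrite (subsetP sBA).
  rewrite pair_big_dep /= [RHS]pair_big_dep /=.
  rewrite (reindex_onto (fun AB : {set V} * {set V} => (AB.1 :|: AB.2, AB.2))
                        (fun AB : {set V} * {set V} => (AB.1 :\: AB.2, AB.2))) /=; last first.
    move=> [A B] /= /andP[_ /andP[_ sB]]; congr pair; rewrite setUC -[RHS](setID A B);
      congr (_ :|: _).
    by apply/esym/setIidPr; apply: subset_trans sB _; apply: subsetDl.
  apply: eq_big => [[A B]|[A B]] /=.
    rewrite xpair_eqE eqxx andbT (setDUl A B B) (setDv B) setU0 !in_setU !subUset.
    apply/idP/idP.
      case/andP=> /andP[/andP[/andP[xAB /andP[sA sB]] _] /andP[wB sBA]] /eqP dAB.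
      have xB : x \notin B by apply/negP => /(subsetP sBA); rewrite !inE eqxx.
      have dis : [disjoint A & B] by apply/setDidPl.
      move: xAB; rewrite (negbTE xB) orbF => ->; rewrite sA /= wB subsetD sB disjoint_sym dis
        !andbT /=.
      by move: wB; rewrite -dAB in_setD => ->.
    case/andP=> /andP[/andP[xA sA] wA] /andP[wB]; rewrite subsetD => /andP[sB dis].
    rewrite xA sA sB wB orbT /= subsetD1 subsetUr /= eqEsubset subsetDl subsetD subxx disjoint_sym
      dis !andbT.
    by apply/negP => xB; have := disjointFr dis xB; rewrite xA.
  case/andP=> _ /eqP[dAB]; by rewrite /G dAB.
rewrite -big_split /=.
(* For [w] outside [A], the moment recursion at [w] for [M (S :\: A)] cancels the term -1 in [G]. *)
rewrite (eq_bigr (fun A => \sum_(B : {set V} | (w \in B) && (B \subset S :\: A)) Y x B * D B * D A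
  * M (S :\: A :\: B))); last first.
  move=> A /andP[/andP[xA sA] wA]; rewrite /D' (negbTE wA).
  have wSA : w \in S :\: A by rewrite in_setD wA.
  rewrite (moment_recursion M0 wSA) mulr_sumr -big_split /=; apply: eq_bigr => B _.
  by rewrite /G; ring.
rewrite (exchange_big_dep (fun B => (w \in B) && (B \subset S :\ x))) /=; last first.
  move=> A B /andP[/andP[xA sA] wA] /andP[wB sB]; rewrite wB subsetD1 (subset_trans sB) ?subsetDl
    //=.
  by apply/negP => /(subsetP sB); rewrite in_setD xA.
(* Summing over [A] gives [M (S :\: B)]; deleting [x] from it completes [Y x B] to the product over
   [S :\ x], and the moment recursion at [w] for [S :\ x] remains. *)
rewrite (eq_bigr (fun B => l x * Y x (S :\ x) * (D B * M (S :\ x :\: B)))).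
  have wSx : w \in S :\ x by rewrite !inE eq_sym nxw.
  by rewrite -mulr_sumr -(moment_recursion M0 wSx) -M_delete.
move=> B /andP[wB sB].
have xSB : x \in S :\: B by rewrite in_setD xS andbT; apply/negP => /(subsetP sB);
  rewrite !inE eqxx.
rewrite (eq_bigl (fun A => (x \in A) && (A \subset S :\: B))) => [|A].
  rewrite (eq_bigr (fun A => Y x B * D B * (D A * M (S :\: B :\: A)))) => [|A _]; last first.
    by rewrite setDDl setUC -setDDl -!mulrA.
  rewrite -mulr_sumr -(moment_recursion M0 xSB) (M_delete xSB) (YD x sB).
  have -> : S :\: B :\ x = S :\ x :\: B by rewrite setDDl setUC -setDDl.
  by rewrite /Y; ring.
move: sB; rewrite subsetD1 => /andP[sB xB]; rewrite wB /= !subsetD sB /= disjoint_sym.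
case: (x \in A) => //=; case: (A \subset S) => //=.
by case: (boolP [disjoint A & B]) => [dis|]; rewrite ?andbF // andbT (disjointFl dis).
Qed.

End CutRecursion.

(** * Iterates of a function *)

Section Fconnect.
Variable V : finType.
Implicit Types (f g : V -> V) (P : pred V).

Lemma fconnect_closed f P y z : (forall u, P u -> P (f u)) -> P y -> fconnect f y z -> P z.
Proof.
move=> Pf Py cyz; rewrite -(iter_findex cyz); by elim: (findex f y z) => //= k; apply: Pf.
Qed.

(** Agreement is required only before [z] and at points whose image still leads to [z]. This permits
    two parent functions to differ at the root of a branch. *)
Lemma fconnect_agree f g P y z :
    (forall u, P u -> u != z -> fconnect f (f u) z -> f u = g u /\ P (f u)) ->
  P y -> fconnect f y z -> fconnect g y z.
Proof.
move=> agr Py cyz; have := iter_findex cyz; move: (findex f y z) => k;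
  elim: k y Py {cyz} => [|k IHk] y Py.
  by move=> /= ->.
rewrite iterSr => eyz; case: (eqVneq y z) => [->|nyz]; first exact: connect0.
have cfy : fconnect f (f y) z by rewrite -eyz fconnect_iter.
have [e Pf] := agr y Py nyz cfy.
apply: connect_trans (fconnect1 g y) _; rewrite -e; exact: IHk.
Qed.

Lemma fconnect_fixed f x y : f x = x -> fconnect f x y -> y = x.
Proof.
move=> fx /(fconnect_closed (P := pred1 x)) H; apply/eqP/H; rewrite /= ?eqxx //.
by move=> u /= /eqP->; rewrite fx.
Qed.

(** The witness is the last point before [x] on the trajectory of [w]: the top of the branch of
    [w]. *)
Lemma fconnect_branch f x w : w != x -> fconnect f w x ->
  exists v, [/\ v != x, f v = x & fconnect f w v].
Proof.
move=> nwx cwx; have := iter_findex cwx; move: (findex f w x) => k;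
  elim: k w nwx {cwx} => [|k IHk] w nwx.
  by move=> /= e; rewrite e eqxx in nwx.
rewrite iterSr; case: (eqVneq (f w) x) => [fw _|nfw /(IHk _ nfw)[v [nv fv cv]]].
  by exists w; rewrite connect0.
by exists v; split=> //; apply: connect_trans cv; apply: fconnect1.
Qed.

Lemma fconnect_branch_uniq f x w v v' : f x = x ->
    v != x -> f v = x -> fconnect f w v -> v' != x -> f v' = x -> fconnect f w v' -> v = v'.
Proof.
move=> fx nv fv cv nv' fv' cv'; have := iter_findex cv; have := iter_findex cv'.
move: (findex f w v) (findex f w v') => a b eb ea {cv cv'}.
have fixx k : iter k f x = x by elim: k => //= k ->.
wlog le : a b v v' nv fv nv' fv' ea eb / (a <= b)%N.
  by move=> hw; case/orP: (leq_total a b) => le; [apply: hw ea eb le|apply/esym;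
    apply: hw eb ea le].
move: eb; rewrite -(subnK le) iterD ea; case: (b - a)%N => [//|k].
by rewrite iterSr fv fixx => e; rewrite e eqxx in nv'.
Qed.

End Fconnect.

(** * Sums over parent functions *)

Section ParentFunctions.
Variables (R : comNzRingType) (qq : R) (n : nat) (e : 'I_n -> 'I_n -> nat).
Notation V := 'I_n.
Implicit Types (S B : {set V}) (x v w : V) (f : {ffun V -> V}).

Definition qint m : R := \sum_(k < m) qq ^+ k.

Lemma qintE m : (qq - 1) * qint m = qq ^+ m - 1.
Proof. by rewrite /qint -subrX1. Qed.

(* f is the parent function of a tree on S with root x, extended by the identity. *)
Definition rooted S x f : bool :=
  [&& [forall v, (v \notin S) ==> (f v == v)], f x == x & [forall v in S, fconnect f v x]].

(* The condition of Defs that e (parent i) j be positive is dropped, since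
   otherwise the summand is 0. *)
Definition inversions S x f : nat :=
  \sum_(i in S :\ x) \sum_(j in S :\ x | fconnect f j i && (j < i)%N) e (f i) j.

Definition tree_weight S x f : R :=
  (\prod_(v in S :\ x) qint (e (f v) v)) * qq ^+ inversions S x f.

Definition rooted_sum S x : R := \sum_(f | rooted S x f) tree_weight S x f.

Lemma rootedP S x f : reflect
  [/\ forall v, v \notin S -> f v = v, f x = x & forall v,
    v \in S -> fconnect f v x] (rooted S x f).
Proof.
apply: (iffP and3P) => [[/forallP H1 /eqP H2 /forall_inP H3]|[H1 H2 H3]]; split=> //.
- by move=> v /(implyP (H1 v))/eqP.
- by apply/forallP => v; apply/implyP => /H1->.
- by apply/eqP.
- exact/forall_inP.
Qed.

(** If [f v] were outside [S], it would be a fixed point different from [x], and [v] could not reach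
    [x]. *)
Lemma rooted_closed S x f v : x \in S -> rooted S x f -> v \in S -> f v \in S.
Proof.
move=> xS /rootedP[off fx con] vS; apply: contraT => nf.
have [e1|e1] := eqVneq v x; first by rewrite -fx -e1 in xS; rewrite e1 fx -fx -e1 xS in nf.
have := con _ vS; case/(fconnect_branch e1) => u [nu fu cu].
have ffv : f (f v) = f v by apply: off.
have : fconnect f (f v) x.
  have /iter_findex := con _ vS; case: findex => [/eqP|k]; first by rewrite (negbTE e1).
  by rewrite iterSr => <-; apply: fconnect_iter.
by move/(fconnect_fixed ffv) => e2; rewrite -e2 xS in nf.
Qed.

Section Glue.
Variables (S B : {set V}) (x v : V).
Hypotheses (xS : x \in S) (sB : B \subset S :\ x) (vB : v \in B).

Definition glue (p : {ffun V -> V} * {ffun V -> V}) : {ffun V -> V} :=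
  [ffun y => if y == v then x else if y \in B then p.1 y else p.2 y].

Definition unglue f : {ffun V -> V} * {ffun V -> V} :=
  ([ffun y => if (y \in B) && (y != v) then f y else y], [ffun y => if y \in B then y else f y]).

Let xB : x \notin B. Proof. by apply/negP => /(subsetP sB); rewrite !inE eqxx. Qed.
Let BS y : y \in B -> y \in S. Proof. by move/(subsetP sB); rewrite inE => /andP[]. Qed.
Let nvx : v != x. Proof. by apply: contraNneq xB => <-. Qed.
Let xSB : x \in S :\: B. Proof. by rewrite in_setD xB. Qed.

Section Forward.
Variables f1 f2 : {ffun V -> V}.
Hypotheses (r1 : rooted B v f1) (r2 : rooted (S :\: B) x f2).
Let f := glue (f1, f2).

Let fv : f v = x. Proof. by rewrite ffunE eqxx. Qed.
Let fB y : y \in B -> y != v -> f y = f1 y.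
Proof. by rewrite ffunE => -> /negbTE->. Qed.
Let fNB y : y \notin B -> f y = f2 y.
Proof. by move=> yB; rewrite ffunE (negbTE yB); case: eqP yB => // ->; rewrite vB. Qed.
Let f1v : f1 v = v. Proof. by case/rootedP: r1. Qed.
Let f2x : f2 x = x. Proof. by case/rootedP: r2. Qed.
Let fx : f x = x. Proof. by rewrite fNB. Qed.
Let f1B y : y \in B -> f1 y \in B. Proof. exact: rooted_closed vB r1. Qed.
Let f2NB y : y \notin B -> f2 y \notin B.
Proof.
move=> yB; case: (boolP (y \in S)) => yS; last first.
  have [off _ _] := rootedP _ _ _ r2; rewrite off // in_setD (negbTE yS) andbF //.
by have := rooted_closed xSB r2 (_ : y \in S :\: B); rewrite !in_setD yB yS => /(_ isT)/andP[].
Qed.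

Let connB y z : y \in B -> z \in B -> fconnect f y z = fconnect f1 y z.
Proof.
move=> yB zB; apply/idP/idP; apply: (fconnect_agree (P := mem B)) => // u /= uB nu cu.
  case: (eqVneq u v) cu => [->|nuv _]; last by rewrite fB //; split=> //; apply: f1B.
  by rewrite fv => /(fconnect_fixed fx) ez; have := xB; rewrite -ez zB.
case: (eqVneq u v) cu nu => [->|nuv _ _]; last by rewrite fB //; split=> //; apply: f1B.
by rewrite f1v => /(fconnect_fixed f1v) ->; rewrite eqxx.
Qed.

Let connNB y z : y \notin B -> z \notin B -> fconnect f y z = fconnect f2 y z.
Proof.
move=> yB zB; apply/idP/idP; apply: (fconnect_agree (P := fun u => u \notin B)) => // u /= uB nu _;
  by rewrite fNB //; split=> //; apply: f2NB.
Qed.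

Let conn_out y z : y \in B -> z \notin B -> z != x -> fconnect f y z = false.
Proof.
move=> yB zB nz; apply/negP => /(fconnect_closed (P := fun u => (u \in B) || (u == x))).
rewrite (negbTE zB) (negbTE nz) yB => H; suff // : false by [].
apply: H => // u /orP[uB|/eqP->]; last by rewrite fx eqxx orbT.
case: (eqVneq u v) => [->|nuv]; first by rewrite fv eqxx orbT.
by rewrite fB // f1B.
Qed.

Let conn_in y z : y \notin B -> z \in B -> fconnect f y z = false.
Proof.
move=> yB zB; apply/negP => /(fconnect_closed (P := fun u => u \notin B)).
by rewrite zB => H; suff // : false by []; apply: H => // u uB; rewrite fNB // f2NB.
Qed.

Lemma glue_rooted : rooted S x f.
Proof.
have [off1 _ con1] := rootedP _ _ _ r1; have [off2 _ con2] := rootedP _ _ _ r2.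
apply/rootedP; split=> // y yS.
  have yB : y \notin B by apply: contra yS => /BS.
  by rewrite fNB // off2 // in_setD (negbTE yS) andbF.
case: (boolP (y \in B)) => yB; last by rewrite connNB // con2 // in_setD yB.
apply: (@connect_trans _ _ v); first by rewrite connB // con1.
by rewrite -fv; apply: fconnect1.
Qed.

Lemma glue_branch w : w \in B -> [/\ v != x, f v = x, fconnect f w v & B = [set y in S | fconnect f
  y v]].
Proof.
have [off1 _ con1] := rootedP _ _ _ r1.
move=> wB; split=> //; first by rewrite connB // con1.
apply/setP => y; rewrite in_set; case: (boolP (y \in B)) => yB.
  by rewrite BS // connB // con1.
by rewrite conn_in // andbF.
Qed.

Lemma glueK : unglue f = (f1, f2).
Proof.
have [off1 _ con1] := rootedP _ _ _ r1; have [off2 _ con2] := rootedP _ _ _ r2.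
congr pair; apply/ffunP => y; rewrite !ffunE; last first.
  case: (boolP (y \in B)) => yB; first by rewrite off2 // in_setD yB.
  by case: eqP yB => // ->; rewrite vB.
case: (boolP (y \in B)) => yB /=; last by rewrite off1.
by case: eqP => [->|] /=.
Qed.

(** Ancestry within each of the two trees is unchanged. The only new inversions have [i = v], which
    is no longer a root: its parent is [x], and every smaller [j] in the branch contributes
    [e x j]. *)
Lemma glue_weight : tree_weight S x f =
  qint (e x v) * qq ^+ (\sum_(j in B | (j < v)%N) e x j) * tree_weight B v f1 * tree_weight (S :\:
    B) x f2.
Proof.
have [off1 _ con1] := rootedP _ _ _ r1; have [off2 _ con2] := rootedP _ _ _ r2.
have inSx y : (y \in S :\ x) && (y \in B) = (y \in B).
  by case: (boolP (y \in B)) => [/(subsetP sB)->|]; rewrite ?andbF.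
have ninSx y : (y \in S :\ x) && (y \notin B) = (y \in S :\: B :\ x).
  by rewrite !inE; case: (y == x); case: (y \in B); rewrite ?andbF ?andbT.
rewrite /tree_weight.
have -> : \prod_(i in S :\ x) qint (e (f i) i) =
    qint (e x v) * \prod_(i in B :\ v) qint (e (f1 i) i) * \prod_(i in S :\: B :\ x) qint (e (f2 i)
      i).
  rewrite (bigID (mem B)) /=; congr (_ * _).
    rewrite (eq_bigl _ _ inSx) (big_setD1 v) //= fv; congr (_ * _).
    by apply: eq_bigr => i; rewrite !inE => /andP[ni iB]; rewrite fB.
  rewrite (eq_bigl _ _ ninSx); apply: eq_bigr => i; rewrite !inE => /and3P[_ iB _].
  by rewrite fNB.
have -> : inversions S x f =
    (\sum_(j in B | (j < v)%N) e x j + inversions B v f1 + inversions (S :\: B) x f2)%N.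
  rewrite {1}/inversions (bigID (mem B)) /=; congr (_ + _)%N.
    rewrite (eq_bigl _ _ inSx) (big_setD1 v) //= fv; congr (_ + _)%N.
      apply: eq_bigl => j; case: (boolP (j \in B)) => jB /=; last by rewrite conn_in // andbF.
      by rewrite (subsetP sB) // connB // con1.
    apply: eq_bigr => i; rewrite !inE => /andP[ni iB]; rewrite fB //; apply: eq_bigl => j.
    case: (boolP (j \in B)) => jB /=; last by rewrite conn_in // !inE (negbTE jB) !andbF.
    rewrite (subsetP sB) // connB // !inE jB andbT.
    case: (eqVneq j v) => [->|//] /=; apply/negbTE; rewrite negb_and; apply/orP; left.
    by apply/negP => /(fconnect_fixed f1v) ei; rewrite ei eqxx in ni.
  rewrite (eq_bigl _ _ ninSx); apply: eq_bigr => i; rewrite !inE => /and3P[nix iB iS].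
  rewrite fNB //; apply: eq_bigl => j.
  case: (boolP (j \in B)) => jB; first by rewrite conn_out // !inE jB /= !andbF.
  by rewrite connNB // !inE jB.
by rewrite !exprD; ring.
Qed.

End Forward.

Lemma unglue_rooted f : rooted S x f -> f v = x -> B = [set y in S | fconnect f y v] ->
  [/\ rooted B v (unglue f).1, rooted (S :\: B) x (unglue f).2 & glue (unglue f) = f].
Proof.
move=> /rootedP[off fx con] fv eB; split.
- apply/rootedP; split=> [y yB||y yB]; rewrite ?ffunE ?eqxx ?andbF ?(negbTE yB) //.
  have : fconnect f y v by move: yB; rewrite eB inE => /andP[].
  apply: (fconnect_agree (P := mem B)) => // u /= uB nuv cu.
  rewrite ffunE uB nuv; split=> //; rewrite eB inE cu andbT.
  have := uB; rewrite eB inE => /andP[uS _]; apply: rooted_closed xS _ uS.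
  exact/rootedP.
- apply/rootedP; split=> [y||y]; rewrite ?ffunE ?(negbTE xB) //.
    by rewrite in_setD negb_and negbK => /orP[->//|/off ->]; rewrite if_same.
  rewrite in_setD => /andP[yB yS]; have := con _ yS.
  apply: (fconnect_agree (P := fun u => (u \notin B) && (u \in S))); last by rewrite yB.
  move=> u /andP[uB uS] nux cu; rewrite ffunE (negbTE uB); split=> //.
  have fuS : f u \in S by apply: rooted_closed xS _ uS; apply/rootedP.
  rewrite fuS andbT; apply: contra uB; rewrite eB !inE uS => /andP[_ cv] /=.
  exact: connect_trans (fconnect1 f u) cv.
apply/ffunP => y; rewrite !ffunE; case: (eqVneq y v) => [->//|nyv] /=.
by rewrite andbT; case: (y \in B).
Qed.

End Glue.

(* B is the branch at the root that contains w, and v is its own root. *)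
Lemma rooted_sum_recursion S x w : x \in S -> w \in S -> w != x ->
  rooted_sum S x = \sum_(B : {set V} | (w \in B) && (B \subset S :\ x))
    (\sum_(v in B) qint (e x v) * qq ^+ (\sum_(j in B | (j < v)%N) e x j) * rooted_sum B v) *
     rooted_sum (S :\: B) x.
Proof.
move=> xS wS nwx.
(* The child of [x] on the way to [w]; the default is never reached when [f] is rooted. *)
pose br f := odflt w [pick v | [&& v != x, f v == x & fconnect f w v]].
have brP f : rooted S x f -> [/\ br f != x, f (br f) = x & fconnect f w (br f)].
  move=> /rootedP[_ _ con]; rewrite /br; case: pickP => [v /and3P[? /eqP ? ?] //|none].
  by have [v [nv fv cv]] := fconnect_branch nwx (con _ wS); have := none v; rewrite nv fv eqxx cv.
pose blk f := [set y in S | fconnect f y (br f)].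
pose valid (Bv : {set V} * V) := [&& w \in Bv.1, Bv.1 \subset S :\ x & Bv.2 \in Bv.1].
rewrite /rooted_sum (partition_big (fun f => (blk f, br f)) valid) /=; last first.
  move=> f rf; have [nv fv cv] := brP f rf; have [_ fx con] := rootedP _ _ _ rf.
  have closed : br f \in S.
    apply: (fconnect_closed (P := mem S)) cv => // u; exact: rooted_closed xS rf.
  rewrite /valid /= !inE wS cv closed connect0 /= andbT; apply/subsetP => y;
    rewrite !inE => /andP[yS cy].
  rewrite yS andbT; apply: contraNneq nv => ey; rewrite ey in cy.
  by rewrite (fconnect_fixed fx cy).
under [RHS]eq_bigr do rewrite mulr_suml.
rewrite (eq_bigl (fun Bv : {set V} * V => ((w \in Bv.1) && (Bv.1 \subset S :\ x)) && (Bv.2 \in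
  Bv.1))); last first.
  by move=> Bv; rewrite /valid andbA.
rewrite [RHS]pair_big_dep /=; apply: eq_bigr => -[B v] /= /andP[/andP[wB sB] vB].
rewrite [RHS](_ : _ = \sum_(p : {ffun V -> V} * {ffun V -> V} | rooted B v p.1 && rooted (S :\: B)
  x p.2)
   qint (e x v) * qq ^+ (\sum_(j in B | (j < v)%N) e x j) * tree_weight B v p.1 * tree_weight (S
     :\: B) x p.2); last first.
  rewrite -(pair_big (fun f1 => rooted B v f1) (fun f2 => rooted (S :\: B) x f2)
     (fun f1 f2 => qint (e x v) * qq ^+ (\sum_(j in B | (j < v)%N) e x j) * tree_weight B v f1 *
       tree_weight (S :\: B) x f2)) /=.
  rewrite [X in X * _ = _]mulr_sumr [LHS]mulr_suml; apply: eq_bigr => f1 _; rewrite mulr_sumr.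
  by [].
rewrite (reindex_onto (glue B x v) (unglue B v)) /=; last first.
  move=> f /andP[rf /eqP[eB ev]]; have [nv fv cv] := brP f rf; rewrite ev in fv.
  have eB' : B = [set y in S | fconnect f y v] by rewrite -[LHS]eB /blk ev.
  by have [_ _ ->] := unglue_rooted xS sB rf fv eB'.
apply: eq_big => [[f1 f2]|[f1 f2]] /=.
  apply/idP/idP => [/andP[/andP[rf /eqP[eB ev]] /eqP eu]|/andP[r1 r2]].
    have [nv fv cv] := brP _ rf; rewrite ev in fv.
    have eB' : B = [set y in S | fconnect (glue B x v (f1, f2)) y v] by rewrite -[LHS]eB /blk ev.
    by have := unglue_rooted xS sB rf fv eB'; rewrite eu /= => -[-> ->].
  have rf := glue_rooted xS sB vB r1 r2; rewrite rf (glueK vB r1 r2) eqxx andbT /=.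
  have [nv fv cv eB] := glue_branch xS sB vB r1 r2 wB.
  have [nv' fv' cv'] := brP _ rf; have [_ fx _] := rootedP _ _ _ rf.
  have ev := fconnect_branch_uniq fx nv' fv' cv' nv fv cv.
  by rewrite /blk ev -eB.
case/andP=> /andP[rf /eqP[eB ev]] /eqP eu.
have [nv fv cv] := brP _ rf; rewrite ev in fv.
have eB' : B = [set y in S | fconnect (glue B x v (f1, f2)) y v] by rewrite -[LHS]eB /blk ev.
have [r1 r2 _] := unglue_rooted xS sB rf fv eB'.
by rewrite eu /= in r1 r2; rewrite glue_weight.
Qed.

End ParentFunctions.

(** * Cumulants as sums over trees *)

Section CumulantTrees.
Variables (R : comNzRingType) (qq : R) (n : nat) (e : 'I_n -> 'I_n -> nat).
Implicit Types S B : {set 'I_n}.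

Lemma qint_telescope_nat (a : nat -> nat) m :
  (qq - 1) * \sum_(v < m) qint qq (a v) * qq ^+ (\sum_(j < v) a j) = qq ^+ (\sum_(j < m) a j) - 1.
Proof.
elim: m => [|m IHm]; first by rewrite !big_ord0 expr0 mulr0 subrr.
rewrite !big_ord_recr /= mulrDr IHm mulrA qintE exprD; ring.
Qed.

(** In the order of the labels, each summand times [qq - 1] is a difference of consecutive powers of
    [qq]. *)
Lemma qint_telescope B (c : 'I_n -> nat) :
  (qq - 1) * \sum_(v in B) qint qq (c v) * qq ^+ (\sum_(j in B | (j < v)%N) c j) =
  qq ^+ (\sum_(j in B) c j) - 1.
Proof.
pose a k := if insub k is Some v then (if v \in B then c v else 0%N) else 0%N.
have aE (v : 'I_n) : a v = if v \in B then c v else 0%N by rewrite /a valK.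
have -> : (\sum_(j in B) c j = \sum_(j < n) a j)%N.
  by rewrite big_mkcond; apply: eq_bigr => v _; rewrite aE.
rewrite -qint_telescope_nat; congr (_ * _); rewrite big_mkcond; apply: eq_bigr => v _.
rewrite aE; case: ifP => vB; last by rewrite /qint big_ord0 mul0r.
congr (_ * _ ^+ _); rewrite (big_ord_widen n a (ltnW (ltn_ord v))) big_mkcond [RHS]big_mkcond.
by apply: eq_bigr => j _; rewrite aE; case: (j \in B) => //=; rewrite if_same.
Qed.

Lemma rooted_sum1 x : rooted_sum qq e [set x] x = 1.
Proof.
rewrite /rooted_sum (big_pred1 [ffun y => y]) => [|f /=].
  rewrite /tree_weight /inversions setDv !big_set0 mul1r //.
apply/rootedP/eqP => [[off fx _]|->].
  by apply/ffunP => y; rewrite ffunE; case: (eqVneq y x) => [->//|ne]; rewrite off // inE.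
by split=> [v _||v]; rewrite ?ffunE // inE => /eqP->; apply: connect0.
Qed.

Variable M : {set 'I_n} -> R.
Hypothesis M0 : M set0 = 1.
Hypothesis M_delete : forall S x, x \in S ->
  M S = qq ^+ e x x * (\prod_(v in S :\ x) qq ^+ e x v) * M (S :\ x).

Lemma predD k m : (0 < k)%N -> (0 < m)%N -> (k + m).-1 = (k.-1 + m.-1).+1.
Proof. lia. Qed.

(* The recursions for cumulants and for rooted trees agree because the cumulant
   of a branch B does not depend on its root v, so that the sum over v telescopes. *)
Lemma set_cumulant_rooted_sum S x : x \in S ->
  set_cumulant M S = (qq - 1) ^+ #|S|.-1 * qq ^+ (\sum_(v in S) e v v) * rooted_sum qq e S x.
Proof.
have [m] := ubnP #|S|; elim: m S x => // m IHm S x ltS xS.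
have [eS|nS] := eqVneq S [set x].
  rewrite eS rooted_sum1 cards1 mul1r big_set1 mulr1.
  have := moment_recursion M0 (set11 x); rewrite (big_pred1 [set x]) => [|A].
    rewrite setDv M0 mulr1 => <-; rewrite (M_delete (set11 x)) setDv M0 big_set0 !mulr1 //.
  by rewrite /= subset1; case: eqP => [->|_]; rewrite ?set11 // andbC; case: eqP => // ->;
    rewrite inE.
have [w wSx] : exists w, w \in S :\ x.
  by apply/set0Pn; apply: contraNneq nS => e0; rewrite -(setD1K xS) e0 setU0.
have [nwx wS] : w != x /\ w \in S by move: wSx; rewrite !inE => /andP.
rewrite (set_cumulant_recursion M0 M_delete xS wS) 1?eq_sym //.
rewrite (rooted_sum_recursion _ _ xS wS nwx) mulr_sumr; apply: eq_bigr => B /andP[wB sB].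
have sBS : B \subset S by apply: subset_trans sB (subsetDl _ _).
have xB : x \notin B by apply/negP => /(subsetP sB); rewrite !inE eqxx.
have cS : #|S| = (#|B| + #|S :\: B|)%N by rewrite -(cardsID B S) (setIidPr sBS).
have cB0 : (0 < #|B|)%N by rewrite card_gt0; apply/set0Pn; exists w.
have xSB : x \in S :\: B by rewrite in_setD xB.
have cSB0 : (0 < #|S :\: B|)%N by rewrite card_gt0; apply/set0Pn; exists x.
rewrite (IHm (S :\: B) x) //; last by rewrite -ltnS (leq_trans _ ltS) // ltnS cS -add1n leq_add2r.
have eD v : v \in B -> set_cumulant M B = (qq - 1) ^+ #|B|.-1 * qq ^+ (\sum_(v in B) e v v) *
  rooted_sum qq e B v.
  by move=> vB; apply: IHm => //; rewrite -ltnS (leq_trans _ ltS) // ltnS cS -addn1 leq_add2l.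
rewrite prodrXr -qint_telescope.
have -> : (\sum_(v in S) e v v = \sum_(v in B) e v v + \sum_(v in S :\: B) e v v)%N.
  rewrite (bigID (mem B)) /=; congr (_ + _)%N; apply: eq_bigl => v; rewrite ?in_setD 1?andbC //.
  by case: (boolP (v \in B)) => // /(subsetP sBS)->.
have -> : #|S|.-1 = (#|B|.-1 + #|S :\: B|.-1).+1 by rewrite cS predD.
set dS := (qq - 1) ^+ _; set lS := qq ^+ (\sum_(v in S :\: B) _); set rS := rooted_sum _ _ _ x.
rewrite exprS !exprD -/dS -/lS.
suff key : (\sum_(v in B) qint qq (e x v) * qq ^+ (\sum_(j in B | (j < v)%N) e x j)) * set_cumulant
  M B =
    (qq - 1) ^+ #|B|.-1 * qq ^+ (\sum_(v in B) e v v) *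
      \sum_(v in B) qint qq (e x v) * qq ^+ (\sum_(j in B | (j < v)%N) e x j) * rooted_sum qq e B v.
  rewrite -[(qq - 1) * _ * _]mulrA key; ring.
rewrite mulr_suml mulr_sumr; apply: eq_bigr => v vB; rewrite (eD v vB); ring.
Qed.

End CumulantTrees.

(** * Spanning trees and parent functions *)

Section TreePaths.
Variable r : nat.
Notation V := 'I_r.+1.
Implicit Types (T : {set {set V}}) (p : seq V) (f : {ffun V -> V}).

Lemma adj_sym T : ssrbool.symmetric (adj T).
Proof. by move=> x y; rewrite /adj /= eq_sym setUC. Qed.

Lemma uniq_size_ord p : uniq p -> (size p <= r.+1)%N.
Proof. by move/card_uniqP <-; rewrite -[X in (_ <= X)%N]card_ord max_card. Qed.

(** The bound on the length of sequences in [is_tree] loses nothing, since a cycle without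
    repetition has at most [r.+1] vertices. *)
Lemma cycle_size T p : is_tree T -> ucycle (adj T) p -> (size p <= 2)%N.
Proof.
case/andP=> _ /forallP H ucp.
have up : uniq p by case/andP: ucp.
have szp := uniq_size_ord up.
by have /implyP/(_ ucp) := H (Bseq szp).
Qed.

(** If the paths leave [x] through different vertices, following one and returning along the other
    joins these two vertices without meeting [x]. A simple path extracted from this walk closes up
    through [x] to a cycle of length at least 3. *)
Lemma tree_path_uniq T x p p' : is_tree T ->
    path (adj T) x p -> path (adj T) x p' -> last x p = last x p' ->
  uniq (x :: p) -> uniq (x :: p') -> p = p'.
Proof.
move=> tT; elim: p x p' => [|a p IHp] x [|b p'] //=.
- by move=> _ _ -> /=; rewrite mem_last.
- by move=> _ _ <- /=; rewrite mem_last.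
move=> /andP[xa pa] /andP[xb pb] el /andP[xp up] /andP[xp' up'].
case: (eqVneq a b) => [eab|nab].
  by rewrite -eab in el pb up' *; congr cons; apply: IHp el up up'.
have xap : x \notin rev p' by rewrite mem_rev; apply: contra xp'; rewrite inE => ->; rewrite orbT.
pose w := p ++ rev (belast b p').
have pw : path (adj T) a w.
  rewrite cat_path pa el rev_path.
  by rewrite (eq_path (e' := adj T)) // => y z; apply: adj_sym.
have lw : last a w = b.
  rewrite last_cat; case: (p') el => [|c p''] /= el; first by rewrite el.
  by rewrite rev_cons last_rcons.
have xw : x \notin a :: w.
  rewrite inE mem_cat mem_rev negb_or; apply/andP; split.
    by apply: contra xp => /eqP->; rewrite mem_head.
  apply/negP => /orP[xin|/mem_belast xin]; first by rewrite inE xin orbT in xp.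
  by rewrite xin in xp'.
case: (shortenP pw) lw => c pc uc sub lc; have := @cycle_size T (x :: a :: c) tT.
have c0 : (0 < size c)%N by case: (c) lc => //= eab; rewrite eab eqxx in nab.
suff : ucycle (adj T) (x :: a :: c) by move=> uc' /(_ uc'); rewrite /= !ltnS leqNgt c0.
apply/andP; split.
  rewrite -[path.cycle _ _]/(path (adj T) x (rcons (a :: c) x)) rcons_path.
  rewrite -[path _ x (a :: c)]/(adj T x a && path (adj T) a c) pc.
  by rewrite -[last x (a :: c)]/(last a c) lc (adj_sym T b) (xb : adj T x b) (xa : adj T x a).
rewrite cons_uniq uc andbT; apply/negP => xac; case/negP: xw.
by move: xac; rewrite !inE => /orP[->//|/sub->]; rewrite orbT.
Qed.

Lemma root_pathP T v p : is_tree T -> path (adj T) ord0 p -> last ord0 p = v -> uniq (ord0 :: p) ->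
  root_path T v = p.
Proof.
move=> tT pp lp up; rewrite /root_path; case: pickP => [p' /and3P[pp' /eqP lp' up']|none].
  exact: (tree_path_uniq tT pp' pp (etrans lp' (esym lp)) up' up).
have szp : (size p <= r.+1)%N by apply: uniq_size_ord; case/andP: up.
by have := none (Bseq szp); rewrite /= pp lp eqxx; move: up => /= ->.
Qed.

Lemma root_path_exists T v : is_tree T ->
  [/\ path (adj T) ord0 (root_path T v), last ord0 (root_path T v) = v & uniq (ord0 :: root_path T
    v)].
Proof.
move=> tT; have /andP[/forallP/(_ ord0)/forallP/(_ v)/connectP[p pp ev] _] := tT.
rewrite ev; case: (shortenP pp) => p' pp' up' _.
by rewrite (root_pathP tT pp' erefl up').
Qed.

Lemma root_path0 T : is_tree T -> root_path T ord0 = [::].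
Proof. by move=> tT; apply: root_pathP. Qed.

Lemma root_path_parent T k v : is_tree T -> adj T k v -> ancestor T k v ->
  root_path T v = rcons (root_path T k) v.
Proof.
move=> tT kv; rewrite /ancestor; have [pp lp up] := root_path_exists v tT.
case: (lastP (root_path T v)) pp lp up => [//|p z] pp lp up.
rewrite belast_rcons => kp; move: lp; rewrite last_rcons => ez; rewrite {z}ez in pp up *.
have [p1 [p2 [ep ek]]] : exists p1 p2, p = p1 ++ p2 /\ last ord0 p1 = k.
  have kp' := kp; case/splitPl ep : _ / kp' => [p1 p2 lp1]; by exists p1, p2.
have pp1 : path (adj T) ord0 p1 by move: pp; rewrite ep rcons_cat cat_path => /andP[].
move: up; rewrite -rcons_cons rcons_uniq ep -cat_cons cat_uniq mem_cat negb_or.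
move=> /andP[/andP[vp1 vp2] /andP[up1 up2]].
have e12 : rcons p v = rcons p1 v.
  apply: (tree_path_uniq (x := ord0) tT) => //; rewrite ?last_rcons ?rcons_path ?pp1 ?ek //.
    by rewrite -rcons_cons rcons_uniq ep -cat_cons cat_uniq mem_cat negb_or vp1 vp2 up1.
  by rewrite -rcons_cons rcons_uniq vp1 up1.
by rewrite -ep e12 (root_pathP tT pp1 ek up1).
Qed.

Definition parent_fun T : {ffun V -> V} := [ffun v => parent T v].

Lemma parentP T v : is_tree T -> v != ord0 -> adj T (parent T v) v /\ ancestor T (parent T v) v.
Proof.
move=> tT nv; rewrite /parent; case: pickP => [k /andP[]//|none].
have [pp lp up] := root_path_exists v tT; have := none (last ord0 (belast ord0 (root_path T v))).
rewrite /ancestor; case: (lastP (root_path T v)) pp lp up => [_ /= e|p z pp lp up].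
  by rewrite e eqxx in nv.
rewrite belast_rcons [last ord0 (ord0 :: p)]/= mem_last andbT.
by move: pp lp; rewrite rcons_path last_rcons => /andP[_ az] <-; rewrite az.
Qed.

Lemma parent0 T : is_tree T -> parent T ord0 = ord0.
Proof.
move=> tT; rewrite /parent; case: pickP => [k /andP[_]|//].
by rewrite /ancestor root_path0.
Qed.

Lemma root_path_rcons T v : is_tree T -> v != ord0 -> root_path T v = rcons (root_path T (parent T
  v)) v.
Proof. by move=> tT nv; have [kv av] := parentP tT nv; apply: root_path_parent. Qed.

Lemma fconnectE (f : V -> V) x y : fconnect f x y = (x == y) || fconnect f (f x) y.
Proof.
apply/idP/orP => [cxy|[/eqP->|]]; first last.
- by move=> cxy; apply: connect_trans (fconnect1 f x) cxy.
- exact: connect0.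
have := iter_findex cxy; case: (findex f x y) => [/= ->|k]; first by left.
by rewrite iterSr => <-; right; apply: fconnect_iter.
Qed.

Lemma mem_root_path T v i : is_tree T -> (i \in ord0 :: root_path T v) = fconnect (parent_fun T) v
  i.
Proof.
move=> tT; have [m] := ubnP (size (root_path T v)); elim: m v => // m IHm v ltm.
have [->|nv] := eqVneq v ord0.
  rewrite root_path0 // inE; apply/eqP/idP => [->|]; first exact: connect0.
  by apply: fconnect_fixed; rewrite ffunE parent0.
rewrite fconnectE ffunE root_path_rcons // -rcons_cons mem_rcons inE eq_sym IHm //.
by move: ltm; rewrite (root_path_rcons tT nv) size_rcons.
Qed.

Lemma rooted_parent_fun T : is_tree T -> rooted [set: V] ord0 (parent_fun T).
Proof.
move=> tT; apply/rootedP; split=> [v|| v _]; first by rewrite in_setT.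
  by rewrite ffunE parent0.
by rewrite -mem_root_path // mem_head.
Qed.

Lemma ancestorE T i v : is_tree T -> v != ord0 -> ancestor T i v = fconnect (parent_fun T) (parent
  T v) i.
Proof.
by move=> tT nv; rewrite /ancestor root_path_rcons // belast_rcons mem_root_path.
Qed.

Definition tree_of f : {set {set V}} := [set [set v; f v] | v in [set~ ord0]].

Lemma rooted_acyclic f v : rooted [set: V] ord0 f -> v != ord0 -> fconnect f (f v) v = false.
Proof.
move=> /rootedP[_ f0 con] nv; apply/negP => cv.
have : fconnect f ord0 v.
  apply: (fconnect_closed (P := fun u => fconnect f u v)) (con v (in_setT v)); last exact: connect0.
  by move=> u; rewrite fconnectE => /orP[/eqP->|].
by move/(fconnect_fixed f0) => e; rewrite e eqxx in nv.
Qed.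

Lemma rooted_neq f v : rooted [set: V] ord0 f -> v != ord0 -> v != f v.
Proof.
by move=> rf nv; apply/eqP => e; have := rooted_acyclic rf nv; rewrite -e connect0.
Qed.

Lemma set2_eq (a b c d : V) : [set a; b] = [set c; d] -> a != b -> (a = c /\ b = d) \/ (a = d /\ b
  = c).
Proof.
move=> eS nab; have /set2P[ea|ea] : a \in [set c; d] by rewrite -eS set21.
  have /set2P[eb|eb] : b \in [set c; d] by rewrite -eS set22.
    by rewrite ea eb eqxx in nab.
  by left.
have /set2P[eb|eb] : b \in [set c; d] by rewrite -eS set22.
  by right.
by rewrite ea eb eqxx in nab.
Qed.

Lemma adj_tree_of f u v : adj (tree_of f) u v -> (u != ord0 /\ f u = v) \/ (v != ord0 /\ f v = u).
Proof.
case/andP=> nuv /imsetP[w]; rewrite !inE => nw /set2_eq/(_ nuv)[[-> ->]|[-> ->]];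
  [by left|by right].
Qed.

Lemma tree_of_adj f v : rooted [set: V] ord0 f -> v != ord0 -> adj (tree_of f) v (f v).
Proof.
move=> rf nv; rewrite /adj /= rooted_neq //=; apply/imsetP; exists v => //; by rewrite !inE.
Qed.

(* A vertex of a cycle with the fewest descendants has only its parent as a
   neighbour in the cycle. *)
Lemma tree_of_tree f : rooted [set: V] ord0 f -> is_tree (tree_of f).
Proof.
move=> rf; have [_ f0 con] := rootedP _ _ _ rf; apply/andP; split.
  have con0 x : connect (adj (tree_of f)) x ord0.
    apply: connect_sub (con x (in_setT x)) => u w /= /eqP <-.
    have [->|nu] := eqVneq u ord0; first by rewrite f0 connect0.
    exact/connect1/tree_of_adj.
  apply/forallP => x; apply/forallP => y; apply: connect_trans (con0 x) _.
  by rewrite (sym_connect_sym (adj_sym _)).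
apply/forallP => -[c szc] /=; apply/implyP => uc; rewrite leqNgt; apply/negP => lt2.
pose d v := #|[set u | fconnect f u v]|.
have d_lt v : v != ord0 -> (d v < d (f v))%N.
  move=> nv; apply: proper_card; apply/properP; split.
    by apply/subsetP => u; rewrite !inE => cu; apply: connect_trans cu (fconnect1 f v).
  by exists (f v); rewrite !inE ?connect0 // rooted_acyclic.
have [v0 v0c] : exists v0, v0 \in c by case: (c) lt2 => // a c' _; exists a; rewrite mem_head.
case: (arg_minnP d v0c) => v vc minv.
have nbr u : u \in c -> adj (tree_of f) v u -> u = f v.
  move=> uc' /adj_tree_of[[_ ->//]|[nu eu]].
  by have := d_lt u nu; rewrite eu ltnNge minv.
have [i s es] := rot_to vc.
have : ucycle (adj (tree_of f)) (rot i c) by rewrite /ucycle rot_cycle rot_uniq.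
have memc u : u \in v :: s -> u \in c by rewrite -es mem_rot.
have : (2 < size (v :: s))%N by rewrite -es size_rot.
rewrite es; case: s memc {es} => [|y s] //= memc szs /andP[/=].
rewrite rcons_path => /andP[vy /andP[_ zv]] /andP[_ /andP[ys _]].
have ey : y = f v by apply: nbr => //; apply: memc; rewrite !inE eqxx orbT.
have ez : last y s = f v.
  apply: nbr; last by rewrite adj_sym.
  by apply: memc; rewrite inE mem_last orbT.
by case: s ys szs ez {memc zv} => // a s ys _ /= ez; rewrite ey -ez mem_last in ys.
Qed.

(** If [F v] is not [f v], the tree edge from [v] to [F v] forces [f (F v) = v], while [F (F v)]
    cannot be [v]; so [F v] is wrong as well, and the error would climb to the root. *)
Lemma tree_ofK f : rooted [set: V] ord0 f -> parent_fun (tree_of f) = f.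
Proof.
move=> rf; have tT := tree_of_tree rf; have rF := rooted_parent_fun tT.
set F := parent_fun _ in rF *; have [_ F0 conF] := rootedP _ _ _ rF;
  have [_ f0 _] := rootedP _ _ _ rf.
pose bad v := (v != ord0) && (F v != f v).
have bad_closed v : bad v -> bad (F v).
  case/andP=> nv ne; have [adjv _] := parentP tT nv.
  have : adj (tree_of f) (F v) v by rewrite ffunE.
  case/adj_tree_of=> [[nF eF]|[_ e]]; last by rewrite e eqxx in ne.
  rewrite /bad nF eF; apply/negP => /eqP eFF.
  have := rooted_acyclic rF nv; rewrite fconnectE eFF connect0 orbT //.
apply/ffunP => v; have [->|nv] := eqVneq v ord0; first by rewrite F0 f0.
apply/eqP/negPn/negP => ne.
have : bad ord0 by apply: fconnect_closed bad_closed _ (conF v (in_setT v)); rewrite /bad nv ne.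
by rewrite /bad eqxx.
Qed.

(** Two distinct vertices are not ancestors of each other, so one end of an edge lies off the root
    path of the other end. Extending that path by the edge shows that the other end is its
    parent. *)
Lemma parent_funK e T : spanning_tree e T -> tree_of (parent_fun T) = T.
Proof.
case/andP=> /subsetP sT tT; apply/setP => E; apply/imsetP/idP => [[v]|ET].
  rewrite !inE => nv ->; have [/andP[_ +] _] := parentP tT nv.
  by rewrite ffunE setUC.
have /imsetP[[a b] + eE] := sT _ ET; rewrite inE /= => /andP[nab _]; rewrite /= in eE.
have adjab : adj T a b by rewrite /adj /= nab -eE.
suff main x y : adj T x y -> y \notin ord0 :: root_path T x -> y != ord0 /\ parent T y = x.
  case: (boolP (b \in ord0 :: root_path T a)) => [bin|/(main _ _ adjab)[nb pb]]; last first.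
    by exists b; rewrite ?inE // ffunE pb setUC.
  case: (boolP (a \in ord0 :: root_path T b)) => [ain|]; last first.
    by rewrite adj_sym in adjab; case/(main _ _ adjab) => na pa; exists a; rewrite ?inE // ffunE pa.
  rewrite !mem_root_path // in ain bin; have rF := rooted_parent_fun tT.
  have [ea|na] := eqVneq a ord0.
    rewrite ea in bin; have [_ F0 _] := rootedP _ _ _ rF.
    by rewrite (fconnect_fixed F0 bin) ea eqxx in nab.
  have := rooted_acyclic rF na; move: bin; rewrite fconnectE (negbTE nab) /= => bin.
  by rewrite (connect_trans bin ain).
move=> xy ny; have [px lx ux] := root_path_exists x tT.
have ny0 : y != ord0 by apply: contraNneq ny => ->; rewrite mem_head.
have e1 : root_path T y = rcons (root_path T x) y.
  apply: root_pathP => //; rewrite ?last_rcons ?rcons_path ?px ?lx //.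
  by rewrite -rcons_cons rcons_uniq ny ux.
split=> //; have := root_path_rcons tT ny0; rewrite e1 => /rcons_inj[e2].
by have [_ l2 _] := root_path_exists (parent T y) tT; rewrite -l2 -e2.
Qed.

End TreePaths.

Section InversionPoly.
Variables (r : nat) (e : multigraph r.+1).
Hypothesis e_sym : forall i j, e i j = e j i.
Notation V := 'I_r.+1.
Implicit Types (f : {ffun V -> V}).

Lemma tree_of_kappa f : rooted [set: V] ord0 f ->
  tree_kappa e (tree_of f) = inversions e [set: V] ord0 f.
Proof.
move=> rf; have tT := tree_of_tree rf; have pf := tree_ofK rf.
have pE i : parent (tree_of f) i = f i by rewrite -[in RHS]pf ffunE.
rewrite /tree_kappa /inversions pair_big_dep /= big_mkcond [RHS]big_mkcond /=.
apply: eq_bigr => -[i j] _ /=; rewrite pE /kappa_inversion !inE !andbT.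
case: (eqVneq i ord0) => //= ni; case: (eqVneq j ord0) => //= nj.
rewrite ancestorE // pf pE (fconnectE f j i); case: (ltnP j i) => [lt|]; last by rewrite !andbF.
have -> : j == i = false by apply/negbTE; rewrite neq_ltn lt.
rewrite /= pE !andbT; case: (fconnect _ _ _) => //=.
by case: posnP => // ->.
Qed.

Lemma tree_of_prod f : rooted [set: V] ord0 f ->
  \prod_(ij : V * V | (ij.1 < ij.2)%N && ([set ij.1; ij.2] \in tree_of f)) qnum (e ij.1 ij.2) =
  \prod_(v in [set: V] :\ ord0) qnum (e (f v) v).
Proof.
move=> rf; have [_ f0 _] := rootedP _ _ _ rf.
pose h (v : V) := if (v < f v)%N then (v, f v) else (f v, v).
(* An edge of the tree is encoded by its child: [h] lists the edge in increasing order and [h']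
   recovers the child. *)
pose h' (ij : V * V) := if (ij.1 != ord0) && (f ij.1 == ij.2) then ij.1 else ij.2.
have nff v : v != ord0 -> f (f v) == v = false.
  move=> nv; apply/negP => /eqP efv; have := rooted_acyclic rf nv.
  by rewrite fconnectE efv connect0 orbT.
rewrite (reindex_onto h h') /=.
  apply: eq_big => v.
    rewrite !inE andbT; case: (eqVneq v ord0) => [->|nv] /=.
      by rewrite /h f0 ltnn /= ?ltnn.
    rewrite /h; case: (ltnP v (f v)) => [lt|le]; rewrite /h' /=.
      by rewrite ?nv eqxx /= lt eqxx andbT; apply/imsetP; exists v; rewrite ?inE.
    rewrite nff // andbF eqxx andbT setUC ltn_neqAle le andbT; apply/andP; split.
      by rewrite val_eqE eq_sym rooted_neq.
    by apply/imsetP; exists v; rewrite ?inE.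
  by move=> _; rewrite /h; case: ifP => // _; rewrite e_sym.
move=> [i j] /= /andP[ltij /imsetP[w]]; rewrite !inE => nw.
have nij : i != j by rewrite neq_ltn ltij.
case/set2_eq => // -[ei ej]; rewrite /h' /=.
  by rewrite ei nw ej eqxx /= /h -ej -ei ltij.
rewrite ei ej nff // andbF /h -ei -ej ltnNge ltnW //.
Qed.

(** A parent function using a pair of multiplicity 0 has weight 0, so the sum may run over all
    rooted functions and not only over spanning trees. *)
Lemma inversion_polyE :
  inversion_poly e = q ^+ (\sum_(i : V) e i i)%N * rooted_sum q e [set: V] ord0.
Proof.
rewrite /inversion_poly /rooted_sum; congr (_ * _).
pose pos f := [forall v in [set: V] :\ ord0, (0 < e (f v) v)%N].
rewrite [RHS](bigID pos) /= [X in _ = _ + X]big1 ?addr0; last first.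
  move=> f /andP[_ /forall_inPn[v vV]]; rewrite -eqn0Ngt => /eqP e0.
  by rewrite /tree_weight (bigD1 v) //= e0 /qint big_ord0 !mul0r.
rewrite (reindex_onto (@tree_of r) (@parent_fun r)) /=; last by move=> T; apply: parent_funK.
apply: eq_big => f.
  apply/andP/andP => [[/andP[/subsetP sT tT] /eqP pf]|[rf /forall_inP pf]].
    have rf : rooted [set: V] ord0 f by rewrite -pf; apply: rooted_parent_fun.
    split=> //; apply/forall_inP => v; rewrite !inE andbT => nv.
    have /imsetP[[a b]] : [set v; f v] \in simple_edges e.
      by apply: sT; apply/imsetP; exists v; rewrite ?inE.
    rewrite inE /= => /andP[nab e0] /set2_eq[|[-> ->]|[-> ->]] //; first exact: rooted_neq.
    by rewrite e_sym.
  split; last by rewrite tree_ofK.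
  apply/andP; split; last exact: tree_of_tree.
  apply/subsetP => E /imsetP[v nv ->]; apply/imsetP; exists (v, f v) => //.
  have nv0 : v != ord0 by move: nv; rewrite !inE.
  by rewrite inE /= rooted_neq // e_sym pf // !inE nv0.
case/andP=> /andP[sT tT] /eqP pf.
have rf : rooted [set: V] ord0 f by rewrite -pf; apply: rooted_parent_fun.
by rewrite tree_of_kappa // tree_of_prod // mulrC.
Qed.

End InversionPoly.

(** * Colored columns *)

Lemma count_conj la j : is_part la -> count (fun h => j < h)%N (conj_part la) = nth 0%N la j.
Proof.
move=> pla; have le : (nth 0 la j <= head 0 la)%N by rewrite -nth0 nth_part.
rewrite -sum1_count (big_nth 0%N) size_map size_iota big_mkcond /=.
transitivity (\sum_(0 <= i < nth 0 la j) 1)%N; last by rewrite sum_nat_const_nat subn0 muln1.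
rewrite (big_nat_widen _ _ _ _ _ le) [RHS]big_mkcond; apply: eq_big_nat => i /andP[_ lti].
by rewrite ltn_conj.
Qed.

Section PartSum.
Variables (r : nat) (lam : 'I_r -> seq nat).
Hypothesis Hlam : forall b, is_part (lam b).
Implicit Types B : {set 'I_r}.

Lemma nth_part_sum B j : nth 0%N (part_sum lam B) j = (\sum_(b in B) nth 0 (lam b) j)%N.
Proof.
rewrite /part_sum; set m := \max_(b in B) _.
case: (ltnP j m) => [ltj|lej]; first by rewrite (nth_map 0%N) ?size_iota // nth_iota.
rewrite nth_default ?size_map ?size_iota // big1 // => b bB; rewrite nth_default //.
by apply: leq_trans lej; apply: (@leq_bigmax_cond _ (mem B) (fun b => size (lam b))).
Qed.

Lemma part_sum_part B : is_part (part_sum lam B).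
Proof.
have mono j j' : (j <= j')%N -> (nth 0 (part_sum lam B) j' <= nth 0 (part_sum lam B) j)%N.
  by move=> le; rewrite !nth_part_sum; apply: leq_sum => b _; apply: nth_part.
apply/andP; split.
  by apply/(sortedP 0%N) => j _; apply: mono.
apply/negP => /(nthP 0%N)[j]; rewrite size_map size_iota => ltj /eqP.
rewrite nth_part_sum sum_nat_eq0 => /forall_inP H.
suff : (\max_(b in B) size (lam b) <= j)%N by rewrite leqNgt ltj.
apply/bigmax_leqP => b bB; rewrite leqNgt; apply/negP => lt.
by have := H b bB; apply/negP; rewrite -lt0n; apply: part_gt0.
Qed.

Lemma sumn_part_sum B : sumn (part_sum lam B) = (\sum_(b in B) sumn (lam b))%N.
Proof.
rewrite sumn_nth (eq_bigr _ (fun j _ => nth_part_sum B j)) exchange_big; apply: eq_bigr => b bB.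
rewrite sumn_nth; have le : (size (lam b) <= size (part_sum lam B))%N.
  rewrite size_map size_iota; exact: (@leq_bigmax_cond _ (mem B) (fun b => size (lam b))).
rewrite (big_cat_nat (n := size (lam b))) //= [X in (_ + X)%N]big_nat_cond [X in (_ + X)%N]big1
  ?addn0 //.
by move=> j /andP[/andP[lej _] _]; rewrite nth_default.
Qed.

End PartSum.

Section Coloring.
Variables (r : nat) (lam : 'I_r.+1 -> seq nat).
Hypothesis Hlam : forall b, is_part (lam b).
Implicit Types B : {set 'I_r.+1}.
Notation LA := (lam_all lam).
Notation cc := (colored_columns lam).

Definition col_color i : 'I_r.+1 := (nth (ord0, 0%N) cc i).1.

Lemma color_col (u : box LA) : color u = col_color (bcol u).
Proof. by []. Qed.

(** The index that a column [i] with color in [B] receives once the columns with other colors are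
    deleted. *)
Definition color_rank B i : nat := count (fun i' => col_color i' \in B) (iota 0 i).

Lemma count_colored (a : pred ('I_r.+1 * nat)) :
  count a cc = (\sum_(b : 'I_r.+1) count (fun h => a (b, h)) (conj_part (lam b)))%N.
Proof.
rewrite /colored_columns (seq.permP (permEl (perm_sort _ _))) count_flatten sumnE !big_map
  -[RHS]big_enum /=.
by rewrite enumT; apply: eq_bigr => b _; rewrite count_map.
Qed.

(** Lengths decrease, so the columns that reach row [j] come first. *)
Lemma take_colored j : take (nth 0%N LA j) cc = [seq x <- cc | (j < x.2)%N].
Proof.
have cE : count (fun x : 'I_r.+1 * nat => j < x.2)%N cc = nth 0%N LA j.
  rewrite count_colored nth_part_sum; apply: eq_big => [b|b _]; first by rewrite in_setT.
  by rewrite /= count_conj.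
rewrite -cE.
have : sorted (fun x y : 'I_r.+1 * nat => y.2 <= x.2)%N cc.
  set leT := fun x y : 'I_r.+1 * nat => (y.2 < x.2)%N || ((x.2 == y.2) && (x.1 <= y.1)%N).
  have : sorted leT cc.
    apply: sort_sorted => x y; rewrite /leT; case: (ltngtP y.2 x.2) => //= _; exact: leq_total.
  by apply: sub_sorted => x y /orP[/ltnW//|/andP[/eqP-> _]].
elim: (cc) => //= x s IHs ps.
have tr : transitive (fun x y : 'I_r.+1 * nat => y.2 <= x.2)%N.
  by move=> y z w /= le1 le2; apply: leq_trans le2 le1.
case: (ltnP j x.2) => [lt|le] /=; first by rewrite IHs // (path_sorted ps).
have c0 : count (fun x : 'I_r.+1 * nat => j < x.2)%N s = 0%N.
  apply/eqP; rewrite -leqn0 leqNgt -has_count; apply/negP => /hasP[y ys lt].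
  have /allP/(_ _ ys) := order_path_min tr ps.
  by rewrite leqNgt (leq_ltn_trans le lt).
by rewrite c0 take0; apply/esym/eqP; rewrite -size_eq0 size_filter c0.
Qed.

Lemma color_rank_row B j : color_rank B (nth 0%N LA j) = nth 0%N (part_sum lam B) j.
Proof.
have sz : (nth 0 LA j <= size cc)%N.
  have cE : count (fun x : 'I_r.+1 * nat => j < x.2)%N cc = nth 0%N LA j.
    rewrite count_colored nth_part_sum; apply: eq_big => [b|b _]; first by rewrite in_setT.
    by rewrite /= count_conj.
  by rewrite -cE count_size.
transitivity (count (fun x : 'I_r.+1 * nat => x.1 \in B) (take (nth 0%N LA j) cc)).
  rewrite -[X in count _ X](map_nth_iota0 (ord0, 0%N)) ?size_takel // count_map /color_rank.
  apply: eq_in_count => i; rewrite mem_iota /= add0n => lti.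
  by [].
rewrite take_colored count_filter count_colored nth_part_sum [RHS]big_mkcond /=.
apply: eq_bigr => b _; case: ifP => bB; last first.
  by apply/eqP; rewrite -leqn0 leqNgt -has_count; apply/hasPn.
by rewrite -(count_conj j (Hlam b)).
Qed.

Lemma prod_color_rank (R : comNzRingType) B (g : nat -> R) L :
  \prod_(0 <= i < L | col_color i \in B) g (color_rank B i) = \prod_(0 <= k < color_rank B L) g k.
Proof.
elim: L => [|L IHL]; first by rewrite /color_rank /= !big_geq.
have cS : color_rank B L.+1 = (color_rank B L + (col_color L \in B))%N.
  by rewrite /color_rank -[L.+1]addn1 iotaD count_cat /= add0n addn0.
rewrite big_mkcond big_nat_recr //= -big_mkcond IHL cS.
case: (col_color L \in B); last by rewrite addn0 mulr1.
by rewrite addn1 big_nat_recr.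
Qed.

(** Deleting the columns of [LA] with colors outside [B] leaves, row by row, the diagram of
    [part_sum lam B]; its boxes are thus indexed inside one diagram common to all [B]. *)
Lemma prod_part_sum (R : comNzRingType) B (g : nat -> nat -> R) :
  \prod_(0 <= j < size (part_sum lam B)) \prod_(0 <= i < nth 0%N (part_sum lam B) j) g i j =
  \prod_(u : box LA | color u \in B) g (color_rank B (bcol u)) (brow u).
Proof.
rewrite [RHS]big_mkcond.
rewrite (big_box _ LA (fun i j => if col_color i \in B then g (color_rank B i) j else 1)).
rewrite [RHS](eq_bigr (fun j => \prod_(0 <= i < nth 0%N (part_sum lam B) j) g i j)); last first.
  by move=> j _; rewrite -big_mkcond (prod_color_rank B (g^~ j)) color_rank_row.
have le : (size (part_sum lam B) <= size LA)%N.
  rewrite !size_map !size_iota; apply/bigmax_leqP => b bB.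
  by apply: (@leq_bigmax_cond _ (mem [set: 'I_r.+1]) (fun b => size (lam b))); rewrite inE.
rewrite [RHS](big_cat_nat (n := size (part_sum lam B))) //= [X in _ * X]big_nat_cond [X in _ *
  X]big1 ?mulr1 //.
by move=> j /andP[/andP[lej _] _]; rewrite nth_default // big_geq.
Qed.

Lemma color_rankE B (u : box LA) :
  color_rank B (bcol u) = #|[set v | left_of v u && (color v \in B)]|.
Proof.
have bx (k : 'I_(bcol u)) : (k : nat, brow u) \in boxes LA.
  by rewrite mem_boxes (ltn_trans (ltn_ord k)) // box_bound.
rewrite /color_rank -sum1_count (_ : iota 0 _ = index_iota 0 (bcol u)) ?big_mkord ?sum1dep_card;
  last by rewrite /index_iota subn0.
rewrite -(card_imset _ (_ : injective (fun k => SeqSub (bx k) : box LA))); last first.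
  by move=> k l /(congr1 (@bcol LA)) e; apply: val_inj.
apply: eq_card => v; rewrite in_set; apply/imsetP/idP => [[k + ->]|/andP[/andP[/eqP er lt] cB]].
  by rewrite inE /left_of eqxx color_col [bcol _]/= => ->; rewrite andbT; apply: ltn_ord.
by exists (Ordinal lt); [rewrite inE|apply: box_inj].
Qed.

End Coloring.

(** * Plethysm of the cumulant *)

Section BlockEdges.
Variables (r : nat) (lam : 'I_r.+1 -> seq nat).
Hypothesis Hlam : forall b, is_part (lam b).
Notation LA := (lam_all lam).
Notation V := 'I_r.+1.
Implicit Types (S : {set box LA}) (B : {set V}) (P : {set {set V}}) (u v : box LA).

(** The number of edges of [box_graph S] with both ends in [B], loops included. *)
Definition block_edges S B : nat :=
  #|[set uv : box LA * box LA | [&& uv.1 \in S, left_of uv.2 uv.1,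
    color uv.1 \in B & color uv.2 \in B]]|.

Lemma set2_inj (x y z : V) : ([set x; y] == [set x; z]) = (y == z).
Proof.
apply/eqP/eqP => [e|->//]; apply/eqP.
have : y \in [set x; z] by rewrite -e set22.
rewrite !inE => /orP[/eqP eyx|//].
have : z \in [set x; y] by rewrite e set22.
by rewrite eyx !inE orbb eq_sym.
Qed.

Lemma pair_in_block (a b x : V) B : x \in B ->
  ((a \in B) && (b \in B) : nat) =
  (\sum_(y in B) ([set a; b] == [set x; y]) + ((a \in B :\ x) && (b \in B :\ x)))%N.
Proof.
move=> xB; have delta c : (\sum_(y in B) (c == y) = (c \in B))%N.
  case: (boolP (c \in B)) => cB.
    rewrite (bigD1 c) //= eqxx big1 ?addn0 // => y /andP[_ ne]; by rewrite eq_sym (negbTE ne).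
  by rewrite big1 // => y yB; apply/eqP; rewrite eqb0; apply: contraNneq cB => ->.
rewrite !inE; case: (eqVneq a x) => [->|nax] /=.
  rewrite xB addn0 -delta; apply: eq_bigr => y _; by rewrite set2_inj.
case: (eqVneq b x) => [->|nbx] /=.
  rewrite xB !andbT andbF addn0 -delta; apply: eq_bigr => y _; by rewrite setUC set2_inj.
rewrite big1 // => y _; apply/eqP; rewrite eqb0; apply: contra nax => /eqP e.
have : x \in [set a; b] by rewrite e set21.
by rewrite !inE [x == b]eq_sym (negbTE nbx) orbF eq_sym.
Qed.

Lemma block_edges_delete S B x : x \in B ->
  block_edges S B = (box_graph S x x + \sum_(y in B :\ x) box_graph S x y + block_edges S (B :\
    x))%N.
Proof.
move=> xB; pose base (uv : box LA * box LA) := (uv.1 \in S) && left_of uv.2 uv.1.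
have card_base (c : pred (box LA * box LA)) :
    #|[set uv | [&& uv.1 \in S, left_of uv.2 uv.1 & c uv]]| = (\sum_(uv | base uv) c uv)%N.
  rewrite -sum1dep_card (eq_bigl (fun uv => base uv && c uv)) => [|uv]; last by rewrite andbA.
  by rewrite big_mkcondr.
have -> : (box_graph S x x + \sum_(y in B :\ x) box_graph S x y = \sum_(y in B) box_graph S x y)%N.
  by rewrite [RHS](big_setD1 x).
rewrite /block_edges (card_base (fun uv => (color uv.1 \in B) && (color uv.2 \in B))).
rewrite (card_base (fun uv => (color uv.1 \in B :\ x) && (color uv.2 \in B :\ x))).
rewrite (eq_bigr (fun y => \sum_(uv | base uv) ([set color uv.1; color uv.2] == [set x; y]))%N);
  last first.
  by move=> y _; rewrite -(card_base (fun uv => [set color uv.1; color uv.2] == [set x; y])).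
rewrite exchange_big -big_split; apply: eq_bigr => uv _ /=.
exact: pair_in_block.
Qed.

Lemma box_graph_sym S (i j : V) : box_graph S i j = box_graph S j i.
Proof. by rewrite /box_graph; apply: eq_card => uv; rewrite !inE [[set j; i]]setUC. Qed.

Lemma set_cumulant_box_graph S :
  set_cumulant (fun B => q ^+ block_edges S B) [set: V] = (q - 1) ^+ r * inversion_poly (box_graph
    S).
Proof.
rewrite (set_cumulant_rooted_sum (qq := q) (e := box_graph S) _ _ (in_setT ord0)).
- rewrite cardsT card_ord (inversion_polyE (box_graph_sym S)) -mulrA; congr (_ * (q ^+ _ * _)).
  by apply: eq_bigl => v; rewrite in_setT.
- rewrite /block_edges (_ : [set _ | _] = set0) ?cards0 //.
  by apply/setP => uv; rewrite !inE !andbF.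
move=> B x xB; rewrite (block_edges_delete S xB) !exprD; congr (_ * _ * _).
by rewrite prodrXr.
Qed.

Section Blocks.
Variables (P : {set {set V}}).
Hypothesis pP : partition P [set: V].

Lemma in_block c B : (B \in P) && (c \in B) = (B == pblock P c).
Proof.
have cc : c \in cover P by rewrite (cover_partition pP) in_setT.
have tP : trivIset P by case/and3P: pP.
apply/andP/eqP => [[BP cB]|->]; first by rewrite (def_pblock tP BP cB).
by rewrite mem_pblock cc pblock_mem.
Qed.

(** Each edge inside a block is counted at its box in [S], where [color_rank] counts the boxes to
    the left with a color in the same block. *)
Lemma sum_block_edges S :
  (\sum_(B in P) block_edges S B = \sum_(u in S) color_rank lam (pblock P (color u)) (bcol u))%N.
Proof.
rewrite (eq_bigr (fun B => \sum_(u in S | color u \in B) color_rank lam B (bcol u))%N); last first.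
  move=> B BP; rewrite /block_edges -sum1dep_card.
  rewrite (eq_bigl (fun uv => ((uv.1 \in S) && (color uv.1 \in B)) && (left_of uv.2 uv.1 && (color
    uv.2 \in B)))); last first.
    by move=> uv; case: (uv.1 \in S); case: (left_of _ _); case: (color uv.1 \in B);
      case: (color uv.2 \in B).
  rewrite -(pair_big_dep (fun u => (u \in S) && (color u \in B)) (fun u v => left_of v u && (color
    v \in B)) (fun _ _ => 1%N)) /=.
  by apply: eq_bigr => u _; rewrite color_rankE sum1dep_card.
rewrite (exchange_big_dep (mem S)) /=; last by move=> B u _ /andP[].
apply: eq_bigr => u uS; rewrite (big_pred1 (pblock P (color u))) // => B /=.
by rewrite uS in_block.
Qed.

Lemma prod_blocks (K : fieldType) (a b : K) :
  \prod_(B in P) \prod_(u : box LA | color u \in B) (1 - (a ^+ color_rank lam B (bcol u) * b ^+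
    brow u)%:P * 'X) =
  \sum_(S : {set box LA}) (- 'X) ^+ #|S| *
    ((\prod_(B in P) a ^+ block_edges S B) * b ^+ (\sum_(u in S) coleg u))%:P.
Proof.
rewrite (exchange_big_dep predT) //=.
pose th u := a ^+ color_rank lam (pblock P (color u)) (bcol u) * b ^+ brow u.
transitivity (\prod_(u : box LA) (1 - (th u)%:P * 'X)).
  apply: eq_bigr => u _; rewrite (big_pred1 (pblock P (color u))) // => B.
  exact: in_block.
under eq_bigr do rewrite addrC.
rewrite bigA_distr; apply: eq_bigr => S _.
rewrite -big_mkcond /= (eq_bigr (fun u => - 'X * (th u)%:P)) => [|u _]; last by rewrite mulNr mulrC.
rewrite big_split /= prodr_const; congr (_ * _); rewrite -rmorph_prod; congr (_%:P).
by rewrite big_split /= !prodrXr sum_block_edges.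
Qed.

End Blocks.

Lemma interpolant_macdonald B : exists Q, interpolant (macdonaldH (part_sum lam B) : family Qqt) Q
  /\
  Q.[-1] = \prod_(u : box LA | color u \in B) (1 - (q ^+ color_rank lam B (bcol u) * t ^+ brow
    u)%:P * 'X).
Proof.
have pB := part_sum_part Hlam B.
have [Q [iQ Q1]] := interpolant_word natrS_Qqt (@reading_pos (part_sum lam B)) (@macdonald_weight
  (part_sum lam B)).
exists Q; split; first by apply: interpolant_ext iQ => N; rewrite macdonaldHE.
rewrite Q1 -(prod_part_sum Hlam B (fun i j => 1 - (q ^+ i * t ^+ j)%:P * 'X)).
exact: (macdonald_value q t pB).
Qed.

Lemma homog_cumulant : homog_symfun (sumn LA) (cumulant lam : family Qqt).
Proof.
apply: homog_symfunZ.
apply: (@homog_symfun_sum _ _ _ (fun P => partition P [set: V]) _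
  (fun P N => ((-1) ^+ #|P|.-1 * (#|P|.-1)`!%:R) *: \prod_(B in P) macdonaldH (part_sum lam B) N))
    => P pP.
apply: homog_symfunZ.
have -> : sumn LA = (\sum_(B in P) sumn (part_sum lam B))%N.
  rewrite sumn_part_sum -(cover_partition pP) big_trivIset /=; last by case/and3P: pP.
  by apply: eq_bigr => B _; rewrite sumn_part_sum.
apply: (@homog_symfun_prod _ _ _ (mem P) (fun B => sumn (part_sum lam B)) (fun B => macdonaldH
  (part_sum lam B))) => B _.
exact: homog_macdonald (part_sum_part Hlam B).
Qed.

Definition graph_weight S : Qqt := inversion_poly (box_graph S) * t ^+ (\sum_(u in S) coleg u)%N.

Lemma pleth_cumulant : pleth_1_minus_u (cumulant lam) =
  \sum_(S : {set box LA}) (- 'X) ^+ #|S| * (graph_weight S)%:P.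
Proof.
have [Q hQ] := fin_all_exists interpolant_macdonald.
pose c P : Qqt := (-1) ^+ #|P|.-1 * (#|P|.-1)`!%:R.
pose QC := (((q - 1) ^- r)%:P)%:P * \sum_(P : {set {set V}} | partition P [set: V]) ((c P)%:P)%:P *
  \prod_(B in P) Q B.
rewrite (pleth_interpolant homog_cumulant (Q := QC)); last first.
  apply: interpolantZ.
  apply: (@interpolant_sum _ _ _ _ (fun P N => c P *: \prod_(B in P) macdonaldH (part_sum lam B)
    N)) => P _.
  apply: interpolantZ; apply: (@interpolant_prod _ _ _ _ (fun B => macdonaldH (part_sum lam B))) =>
    B _.
  by case: (hQ B).
rewrite /QC hornerM hornerC horner_sum.
rewrite (eq_bigr (fun P => \sum_(S : {set box LA}) (- 'X) ^+ #|S| *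
    (c P * (\prod_(B in P) q ^+ block_edges S B) * t ^+ (\sum_(u in S) coleg u))%:P)) => [|P pP];
      last first.
  rewrite hornerM hornerC horner_prod (eq_bigr _ (fun B _ => proj2 (hQ B))) (prod_blocks pP)
    mulr_sumr.
  by apply: eq_bigr => S _; rewrite mulrCA -polyCM mulrA.
(* For a fixed set of boxes the sum over set partitions is a cumulant of edge counts, whose power of
   [q - 1] cancels the normalization. *)
rewrite exchange_big mulr_sumr; apply: eq_bigr => S _ /=.
rewrite -mulr_sumr mulrCA; congr (_ * _); rewrite -rmorph_sum -polyCM; congr (_%:P).
rewrite -mulr_suml -/(set_cumulant (fun B => q ^+ block_edges S B) [set: V]) set_cumulant_box_graph.
by rewrite mulrA mulKf // expf_neq0 // qB1_neq0.
Qed.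

End BlockEdges.

(** * Nonnegative integer coefficients *)

Section NonnegativeCoefficients.
Variables (K : comNzRingType) (a b : K).

(** Listing monomials with repetition makes closure under sums and products a matter of
    concatenating or pairing lists. *)
Definition nonneg_comb (x : K) : Prop :=
  exists s : seq (nat * nat), x = \sum_(p <- s) a ^+ p.1 * b ^+ p.2.

Lemma nonneg_comb0 : nonneg_comb 0.
Proof. by exists [::]; rewrite big_nil. Qed.

Lemma nonneg_combX i j : nonneg_comb (a ^+ i * b ^+ j).
Proof. by exists [:: (i, j)]; rewrite big_seq1. Qed.

Lemma nonneg_combD x y : nonneg_comb x -> nonneg_comb y -> nonneg_comb (x + y).
Proof. by move=> [s ->] [s' ->]; exists (s ++ s'); rewrite big_cat. Qed.

Lemma nonneg_combM x y : nonneg_comb x -> nonneg_comb y -> nonneg_comb (x * y).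
Proof.
move=> [s ->] [s' ->]; exists [seq (p.1 + p'.1, p.2 + p'.2)%N | p <- s, p' <- s'].
rewrite big_allpairs_dep mulr_suml; apply: eq_bigr => p _; rewrite mulr_sumr;
  apply: eq_bigr => p' _.
by rewrite /= !exprD mulrACA.
Qed.

Lemma nonneg_comb_sum (I : Type) (s : seq I) (P : pred I) (F : I -> K) :
  (forall i, P i -> nonneg_comb (F i)) -> nonneg_comb (\sum_(i <- s | P i) F i).
Proof. by move=> hF; apply: (big_ind nonneg_comb) => //; [apply: nonneg_comb0|apply: nonneg_combD].
  Qed.

Lemma nonneg_comb_prod (I : Type) (s : seq I) (P : pred I) (F : I -> K) :
  (forall i, P i -> nonneg_comb (F i)) -> nonneg_comb (\prod_(i <- s | P i) F i).
Proof.
move=> hF; apply: (big_ind nonneg_comb) => //; last by apply: nonneg_combM.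
by have := nonneg_combX 0 0; rewrite !expr0 mulr1.
Qed.

Lemma nonneg_comb_coefs x : nonneg_comb x ->
  exists (d : nat) (c : nat -> nat -> nat), x = \sum_(i < d) \sum_(j < d) (c i j)%:R * a ^+ i * b
    ^+ j.
Proof.
case=> s ->; pose d := (\max_(p <- s) maxn p.1 p.2).+1.
exists d, (fun i j => count_mem (i, j) s).
have : all (fun p : nat * nat => (p.1 < d) && (p.2 < d))%N s.
  apply/allP => p ps; rewrite /d !ltnS; have : (maxn p.1 p.2 <= \max_(p <- s) maxn p.1 p.2)%N.
    by rewrite (big_rem p) //= leq_max leqnn.
  by rewrite geq_max.
move: d => d; elim: s => [_|p s IHs] /=.
  by rewrite big_nil big1 // => i _; rewrite big1 // => j _; rewrite !mul0r.
case/andP=> /andP[lt1 lt2] alls; rewrite big_cons (IHs alls).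
rewrite -[X in X + _](_ : \sum_(i < d) \sum_(j < d) (p == (i : nat,
  j : nat))%:R * a ^+ i * b ^+ j = _).
  rewrite -big_split; apply: eq_bigr => i _; rewrite -big_split; apply: eq_bigr => j _ /=.
  by rewrite natrD !mulrDl.
rewrite (bigD1 (Ordinal lt1)) //= [X in _ + X]big1 ?addr0.
  rewrite (bigD1 (Ordinal lt2)) //= [X in _ + X]big1 ?addr0.
    by rewrite -surjective_pairing eqxx mul1r.
  by move=> j nj; case: eqP => [e|]; rewrite ?mul0r //; case/eqP: nj; apply: val_inj; rewrite /= e.
move=> i ni; rewrite big1 // => j _; case: eqP => [e|]; rewrite ?mul0r //.
by case/eqP: ni; apply: val_inj; rewrite /= e.
Qed.

End NonnegativeCoefficients.

Lemma nonneg_inversion_poly r (e : multigraph r.+1) : nonneg_comb q t (inversion_poly e).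
Proof.
have nq i : nonneg_comb q t (q ^+ i) by have := nonneg_combX q t i 0; rewrite expr0 mulr1.
apply: nonneg_combM => //; apply: nonneg_comb_sum => T _; apply: nonneg_combM => //.
by apply: nonneg_comb_prod => ij _; apply: nonneg_comb_sum.
Qed.

Lemma coef_negX_exp (K : comNzRingType) k s : ((- 'X : {poly K}) ^+ k)`_s = (-1) ^+ k * (s == k)%:R.
Proof. by rewrite -scaleN1r exprZn coefZ coefXn. Qed.

(** * The corner box *)

Section Corner.
Variables (r : nat) (lam : 'I_r.+1 -> seq nat).
Notation LA := (lam_all lam).
Implicit Types S : {set box LA}.

(** The corner has no box on its left and lies in the bottom row, so it brings neither an edge nor a
    power of [t]. *)
Lemma graph_weight_corner S (z : box LA) : ssval z = (0%N, 0%N) -> z \notin S ->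
  graph_weight (z |: S) = graph_weight S.
Proof.
move=> ez zS; rewrite /graph_weight big_setU1 //= /coleg /brow ez add0n;
  congr (inversion_poly _ * _).
apply: functional_extensionality => i; apply: functional_extensionality => j.
apply: eq_card => uv; rewrite !inE; case: (eqVneq uv.1 z) => [->|] //=.
by rewrite (negbTE zS) /left_of /bcol ez ltn0 andbF.
Qed.

Lemma sum_graph_weight_corner (z : box LA) s : ssval z = (0%N, 0%N) ->
  \sum_(S : {set box LA} | #|S| == s.+1) graph_weight S =
  \sum_(S : {set box LA} | (#|S| == s.+1) && (z \notin S)) graph_weight S +
  \sum_(S : {set box LA} | (#|S| == s) && (z \notin S)) graph_weight S.
Proof.
move=> ez; rewrite (bigID (fun S => z \notin S)) /=; congr (_ + _).
rewrite (reindex_onto (fun S => z |: S) (fun S => S :\ z)) /=; last first.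
  by move=> S /andP[_]; rewrite negbK => zS; rewrite setD1K.
have cond S : (#|z |: S| == s.+1) && ~~ (z \notin z |: S) && ((z |: S) :\ z == S) = (#|S| == s) &&
  (z \notin S).
  rewrite setU11 andbT; case: (boolP (z \in S)) => zS;
    last by rewrite setU1K // eqxx !andbT cardsU1 zS.
  by rewrite andbF; apply/negbTE; rewrite negb_and; apply/orP; right; apply/eqP => /setP/(_ z);
    rewrite !inE eqxx zS.
by apply: eq_big => // S; rewrite cond => /andP[_ zS]; apply: graph_weight_corner.
Qed.

End Corner.

Theorem theorem6p1 (r : nat) (lam : 'I_r.+1 -> seq nat) (n : nat)
    (Hlam : forall b, is_part (lam b)) (Hn : sumn (lam_all lam) = n) :
  (forall s : nat,
     (-1) ^+ s * (pleth_1_minus_u (cumulant lam))`_s =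
     \sum_(S : {set box (lam_all lam)} | #|S| == s)
        inversion_poly (box_graph S) * t ^+ (\sum_(u in S) coleg u)%N) /\
  (forall s : nat, (s < n)%N ->
     nonneg_int_poly (qtKostka ((n - s)%N :: nseq s 1%N) lam) /\
     qtKostka ((n - s)%N :: nseq s 1%N) lam =
     \sum_(S : {set box (lam_all lam)} |
             (#|S| == s) && [forall u in S, ssval u != (0%N, 0%N)])
        inversion_poly (box_graph S) * t ^+ (\sum_(u in S) coleg u)%N).
Proof.
have part1 s : (-1) ^+ s * (pleth_1_minus_u (cumulant lam))`_s =
    \sum_(S : {set box (lam_all lam)} | #|S| == s) graph_weight S.
  rewrite (pleth_cumulant Hlam) coef_sum mulr_sumr [RHS]big_mkcond; apply: eq_bigr => S _.
  rewrite coefMC coef_negX_exp [#|S| == s]eq_sym; case: eqP => [->|_];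
    last by rewrite mulr0 mul0r mulr0.
  by rewrite mulr1 signrMK.
split=> [s|s lts]; first exact: part1.
have n0 : (0 < n)%N by apply: leq_trans lts.
pose k m := qtKostka (hook n m) lam.
have hom : homog_symfun n (cumulant lam : family Qqt) by rewrite -Hn; apply: homog_cumulant.
(* The factor 1 - u of a hook makes the coefficient of (-u)^m the sum of two consecutive hook
   coefficients. Splitting subsets by whether they contain the corner gives the same recurrence for
   the sums over boxes, and induction on [m] identifies the two. *)
have coefs_k m : (m < n)%N ->
    (-1) ^+ m * (pleth_1_minus_u (cumulant lam))`_m = k m + (if m is m'.+1 then k m' else 0).
  move=> ltm; rewrite (pleth_schur_coefs hom n0) coef_sum.
  rewrite (eq_bigr (fun i : 'I_n => (if val i == m then (-1) ^+ m * k m else 0) +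
      (if (val i).+1 == m then (-1) ^+ m * k m.-1 else 0))); last first.
    move=> i _; rewrite coefZ mulrBr mulr1 coefB coef_negX_exp.
    have -> : ((- 'X) ^+ i * 'X : {poly Qqt})`_m = - ((- 'X) ^+ i.+1 : {poly Qqt})`_m.
      by rewrite exprSr mulrN coefN opprK.
    rewrite opprK coef_negX_exp mulrDr ![m == _]eq_sym; congr (_ + _).
      by case: eqP => [<-|_]; rewrite ?mulr0 // mulr1 mulrC.
    by case: eqP => [<-|_]; rewrite ?mulr0 // mulr1 mulrC.
  rewrite big_split /= -!big_mkcond /= (big_pred1 (Ordinal ltm)) //= mulrDr signrMK; congr (_ + _).
  case: m ltm => [|m] ltm; first by rewrite big_pred0 ?mulr0.
  by rewrite (big_pred1 (Ordinal (ltnW ltm))) //= signrMK.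
have LA0 : (0 < nth 0 (lam_all lam) 0)%N.
  apply: part_gt0; first exact: part_sum_part.
  by rewrite lt0n; apply: contraTneq n0 => /size0nil e; rewrite -Hn e.
have bz : (0, 0)%N \in boxes (lam_all lam) by rewrite mem_boxes.
pose z : box (lam_all lam) := SeqSub bz.
have ez : ssval z = (0, 0)%N by [].
have main m : (m < n)%N -> k m = \sum_(S : {set box (lam_all lam)} | (#|S| == m) && (z \notin S))
  graph_weight S.
  elim: m => [|m IHm] ltm; have := coefs_k _ ltm; rewrite part1.
    rewrite addr0 => <-; apply: eq_bigl => S; rewrite cards_eq0.
    by case: eqP => // ->; rewrite in_set0.
  rewrite (sum_graph_weight_corner _ ez) -IHm; last exact: ltnW.
  by move/addIr => ->.
have eqk : k s = \sum_(S : {set box (lam_all lam)} |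
             (#|S| == s) && [forall u in S, ssval u != (0%N, 0%N)]) graph_weight S.
  rewrite main //; apply: eq_bigl => S; congr (_ && _).
  apply/idP/forall_inP => [zS u uS|H]; last by apply/negP => /H; rewrite ez eqxx.
  by apply: contraNneq zS => eu; rewrite (_ : z = u) //; apply: val_inj; rewrite /= eu.
split; last exact: eqk.
rewrite -/(k s) eqk; apply: nonneg_comb_coefs; apply: nonneg_comb_sum => S _.
apply: nonneg_combM; first exact: nonneg_inversion_poly.
by have := nonneg_combX q t 0 (\sum_(u in S) coleg u); rewrite expr0 mul1r.
Qed.
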